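(* Let $T>0$ and $p_1,p_2\in(1,\infty)$. Let $\{Q_n\}_{n\in\mathbb N}$ be a sequence of random variables, defined on a standard probability space $(\Omega,\mathcal F,\mathbb P)$, taking values in $L^{p_1}(L^{p_2}_w)$. Suppose that, uniformly in $n\in\mathbb N$, (i) $\mathbb E\|Q_n\|_{L^{p_1}([0,T];L^{p_2}(\mathbb S^1))}\lesssim 1$; (ii) $\mathbb E\|Q_n\|_{L^{\bar p_1}([0,T];L^{1}(\mathbb S^1))}\lesssim 1$ for some $\bar p_1>p_1$; (iii) for all $\varphi\in C^\infty(\mathbb S^1)$ and all $\vartheta\in(0,T\wedge1)$, $$\mathbb E\sup_{\tau\in(0,\vartheta)}\int_0^{T-\tau}\Bigl|\int_{\mathbb S^1}\varphi(x)\bigl(Q_n(t+\tau,x)-Q_n(t,x)\bigr)\,\mathrm{d}x\Bigr|\,\mathrm{d}t\le C_\varphi\,\vartheta^\alpha,$$ for some $\alpha\in(0,1)$ and a constant $C_\varphi$ independent of $n$. Then the sequence $\{\mathcal L(Q_n)\}_{n\in\mathbb N}$ of probability laws is tight on $L^{p_1}(L^{p_2}_w)$.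
   Context: $\mathbb S^1=\mathbb R/(2\pi\mathbb Z)$. For $p_1,p_2\in(1,\infty)$, $L^{p_1}(L^{p_2}_w)=L^{p_1}([0,T];L^{p_2}(\mathbb S^1)-w)$ denotes the Bochner space $L^{p_1}([0,T];L^{p_2}(\mathbb S^1))$ equipped with the locally convex topology generated by the seminorms $$z\mapsto\Bigl(\int_0^T\Bigl|\int_{\mathbb S^1}\phi(x)z(t,x)\,\mathrm{d}x\Bigr|^{p_1}\mathrm{d}t\Bigr)^{1/p_1},\qquad \phi\in L^{p_2'}(\mathbb S^1),\ \tfrac1{p_2}+\tfrac1{p_2'}=1,$$ with its Borel $\sigma$-algebra (which coincides with the Borel $\sigma$-algebra of the norm topology). Tightness of a family of laws $\{\mu_n\}$ means: for every $\kappa>0$ there is a compact set $\mathcal K_\kappa$ (in this topology) with $\mu_n(\mathcal K_\kappa^c)\le\kappa$ for all $n$. The exponent $\alpha$ is independent of $n$, $\vartheta$ and $\varphi$. *)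

(* Defs.v *)
From HB Require Import structures.
From mathcomp Require Import all_boot all_order all_algebra.
From mathcomp Require Import all_classical all_reals all_analysis.
From mathcomp Require Import measurable_realfun.

Set Implicit Arguments.
Unset Strict Implicit.
Unset Printing Implicit Defensive.
Import Order.TTheory GRing.Theory Num.Theory.
Import numFieldNormedType.Exports.

Local Open Scope classical_set_scope.
Local Open Scope ring_scope.
Local Open Scope quotient_scope.

Section measures.
Context {R : realType}.

(* The circle R/(2 pi Z) is represented by its fundamental domain [0, 2 pi[:
   [circle] is Lebesgue measure on R restricted to [0, 2 pi[. *)
Lemma measurable_circle :
  measurable (`[0, 2 * pi[%classic : set (measurableTypeR R)).
Proof. exact: measurable_itv. Qed.

Definition circle : {measure set (measurableTypeR R) -> \bar R} :=
  mrestr lebesgue_measure measurable_circle.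

Lemma measurable_time (T : R) :
  measurable (`[0, T]%classic : set (measurableTypeR R)).
Proof. exact: measurable_itv. Qed.

Definition time (T : R) : {measure set (measurableTypeR R) -> \bar R} :=
  mrestr lebesgue_measure (measurable_time T).

Definition smooth_circle (phi : R -> R) : Prop :=
  periodic phi (2 * pi) /\ forall k x, derivable (derive1n k phi) x 1.

(* The duality pairing of two functions on the circle. *)
Definition pairing (phi f : R -> R) : R := \int[circle]_x (phi x * f x).

Lemma lt1_le1e (p : R) : 1 < p -> (1 <= p%:E)%E.
Proof. by move=> p1; rewrite lee_fin ltW. Qed.

End measures.

Section zero_Lq.
Context {R : realType}.

Definition mzero : {mfun measurableTypeR R >-> measurableTypeR R} := cst (0 : R).

Definition zero_mfun : {mfun_ (@circle R), measurableTypeR R >-> measurableTypeR R} :=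
  \pi_({mfun_ (@circle R), measurableTypeR R >-> measurableTypeR R}) mzero.

Lemma zero_mfun_ae :
  \forall x \ae (@circle R), zero_mfun x = 0.
Proof.
have /eqmodP/= : repr zero_mfun = mzero
    %[mod {mfun_ (@circle R), measurableTypeR R >-> measurableTypeR R}].
  by rewrite reprK.
move=> /asboolP.
by apply: (@filterS _ _ (ae_filter_ringOfSetsType (@circle R))) => x /(_ I).
Qed.

Lemma zero_mfun_Lnorm (p : R) : 1 < p ->
  Lnorm (@circle R) p%:E (EFin \o zero_mfun) = 0%E.
Proof.
move=> p1; have p0 : 0 < p by exact: lt_trans p1.
rewrite -(@Lnorm0 _ _ _ (@circle R) p%:E); last by rewrite eqe gt_eqF.
rewrite unlock; congr (_ `^ _)%E.
apply: ge0_ae_eq_integral => //.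
- apply: (@measurableT_comp _ _ _ _ _ _ (fun x : \bar R => x `^ p)%E).
    exact: measurable_poweR.
  apply: measurableT_comp => //.
  by apply/measurable_EFinP; exact: (@measurable_funPT _ _ _ _ (repr zero_mfun)).
- by move=> x _; exact: poweR_ge0.
- by move=> x _; exact: poweR_ge0.
- apply: (@filterS _ _ (ae_filter_ringOfSetsType (@circle R)) _ _ _
    zero_mfun_ae) => x /= x0 _.
  by rewrite x0.
Qed.

Lemma zero_mfun_finite (p : R) : 1 < p -> finite_norm (@circle R) p%:E zero_mfun.
Proof. by move=> p1; rewrite /finite_norm zero_mfun_Lnorm. Qed.

Definition zero_Lq (p : R) (p1 : 1 < p) : LspaceType (@circle R) (lt1_le1e p1) :=
  HB.pack zero_mfun (isFinLebesgue.Build _ _ _ (@circle R) p%:E (lt1_le1e p1) zero_mfun (zero_mfun_finite p1)).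

Lemma Lnorm_zero_Lq (p : R) (p1 : 1 < p) :
  Lnorm circle p%:E (fun x => (zero_Lq p1 x)%:E) = 0%E.
Proof. exact: zero_mfun_Lnorm. Qed.

End zero_Lq.

Section bochner.
Context {R : realType}.
Variables (T p1 p2 : R) (p2_gt1 : 1 < p2).

Definition Lq : Type := LspaceType (@circle R) (lt1_le1e p2_gt1).

(* Bochner's notion: almost everywhere a norm limit of measurable functions
   with finitely many values. *)
Definition simple_map (s : R -> Lq) : Prop :=
  finite_set (range s) /\
  forall c : Lq, measurable (s @^-1` [set c] : set (measurableTypeR R)).

Definition strongly_measurable (z : R -> Lq) : Prop :=
  exists s : nat -> R -> Lq, (forall n, simple_map (s n)) /\
    {ae time T, forall t,
      Lnorm circle p2%:E (fun x => (s n t x - z t x)%:E)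
        @[n --> \oo] --> 0%E}.

(* The norm of L^p([0, T]; L^q(S^1)), for functions of (t, x). *)
Definition mixed_norm (p q : R) (f : R -> R -> R) : \bar R :=
  Lnorm (time T) p%:E (fun t => Lnorm circle q%:E (fun x => (f t x)%:E)).

(* Functions on [0, T] are represented by functions on R, considered up to
   equality almost everywhere on [0, T]. *)
Record bochner_fun : Type := BochnerFun {
  bfun :> R -> Lq ;
  bfun_strong : strongly_measurable bfun ;
  bfun_fin : (mixed_norm p1 p2 (fun t => bfun t) < +oo)%E }.

HB.instance Definition _ := gen_eqMixin bochner_fun.
HB.instance Definition _ := gen_choiceMixin bochner_fun.

Definition bochner_eq (z w : bochner_fun) : bool :=
  `[< {ae time T, forall t, z t = w t} >].

Lemma bochner_eq_refl : reflexive bochner_eq.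
Proof. by move=> z; apply/asboolP; apply: aeW. Qed.

Lemma bochner_eq_sym : symmetric bochner_eq.
Proof.
by move=> z w; apply/idP/idP => /asboolP h; apply/asboolP;
   apply: (@filterS _ _ (ae_filter_ringOfSetsType (time T))) h => t ->.
Qed.

Lemma bochner_eq_trans : transitive bochner_eq.
Proof.
move=> w z u /asboolP h1 /asboolP h2; apply/asboolP.
by apply: (@filterS2 _ _ (ae_filter_ringOfSetsType (time T))) h1 h2 => t -> ->.
Qed.

Canonical bochner_eq_equiv :=
  EquivRel bochner_eq bochner_eq_refl bochner_eq_sym bochner_eq_trans.

Definition bochner : Type := {eq_quot bochner_eq}.
HB.instance Definition _ := Choice.on bochner.
HB.instance Definition _ := EqQuotient.on bochner.

(* The pointwise values z(t, x) of a representative of z. *)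
Definition bochner_val (z : bochner) : R -> R -> R := fun t => (repr z) t.
Coercion bochner_val : bochner >-> Funclass.

Lemma bochner_eqP (z w : bochner_fun) :
  reflect {ae time T, forall t, z t = w t}
    (\pi_bochner z == \pi_bochner w).
Proof. by apply/(iffP idP); rewrite eqmodE// => /asboolP. Qed.

Definition weak_seminorm (phi : R -> R) (f : R -> R -> R) : \bar R :=
  Lnorm (time T) p1%:E (fun t => (pairing phi (f t))%:E).

Definition weak_ball (phi : R -> R) (z : bochner) (e : R) : set bochner :=
  [set w : bochner | (weak_seminorm phi (fun t x => w t x - z t x)%R < e%:E)%E].

(* The balls of the seminorms form a subbase of the topology they generate. *)
Definition weak_subbase : set (set bochner) :=
  [set U | exists phi z e,
    [/\ phi \in Lfun circle (hoelder_conjugate p2%:E), 0 < e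
      & U = weak_ball phi z e]].

HB.instance Definition _ :=
  isSubBaseTopological.Build bochner weak_subbase id.


Lemma zero_strong : strongly_measurable (cst (zero_Lq p2_gt1)).
Proof.
exists (fun _ => cst (zero_Lq p2_gt1)); split.
  move=> n; split.
    apply: (@sub_finite_set _ _ [set zero_Lq p2_gt1]) => //.
    by move=> _ [t _ <-].
  move=> c /=; rewrite preimage_cst; case: ifP => _.
  - exact: measurableT.
  - exact: measurable0.
apply: aeW => t.
have p0 : 0 < p2 by exact: lt_trans p2_gt1.
suff -> : (fun x => (zero_Lq p2_gt1 x - zero_Lq p2_gt1 x)%:E) = cst 0%E.
  by rewrite Lnorm0; [exact: cvg_cst|rewrite eqe gt_eqF].
by apply/funext => x; rewrite subrr.
Qed.

Lemma zero_fin : (mixed_norm p1 p2 (fun t => cst (zero_Lq p2_gt1) t) < +oo)%E.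
Proof.
rewrite /mixed_norm /cst Lnorm_zero_Lq -[X in Lnorm _ _ X]/(cst 0%E).
have [->|p10] := eqVneq p1 0; last by rewrite Lnorm0.
by rewrite unlock invr0 poweRe0 ltry.
Qed.

HB.instance Definition _ := isPointed.Build bochner
  (\pi_bochner (BochnerFun zero_strong zero_fin)).

End bochner.

Arguments bochner {R} T p1 {p2} p2_gt1.
Arguments mixed_norm {R} T p q f.

(* sup_(0 < tau < theta) int_0^(T - tau) |<phi, f(t + tau) - f(t)>| dt *)
Definition translation_modulus {R : realType} (T theta : R) (phi : R -> R)
    (f : R -> R -> R) : \bar R :=
  ereal_sup [set (\int[lebesgue_measure]_(t in `[0%R, (T - tau)%R])
      `|pairing phi (fun x => f (t + tau) x - f t x)%R|%:E)%E
    | tau in `]0, theta[].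

Definition borel (X : ptopologicalType) : Type := g_sigma_algebraType (@open X).
HB.instance Definition _ (X : ptopologicalType) :=
  Measurable.copy (borel X) (g_sigma_algebraType (@open X)).

Definition tight {R : realType} {X : ptopologicalType}
    (mu : nat -> set (borel X) -> \bar R) : Prop :=
  forall kappa : R, 0 < kappa -> exists K : set X,
    compact K /\ forall n, (mu n (~` K) <= kappa%:E)%E.

(* Standard probability spaces, with or without the null sets added: up to a
   null set, an injective random variable X identifies the space with R,
   endowed with the law of X, and maps measurable sets to sets that are
   measurable for the completion of that law. *)
Definition standard_probability {R : realType} d (Omega : measurableType d)
    (P : probability Omega R) : Prop :=
  exists (X : {RV P >-> measurableTypeR R}) (Omega0 : set Omega),
    [/\ measurable Omega0, P Omega0 = 1%E, {in Omega0 &, injective X}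
      & forall A, measurable A -> A `<=` Omega0 ->
          exists B : set (measurableTypeR R),
            [/\ measurable B, B `<=` X @` A & distribution P X B = P A]].

(* Main.v *)
(** Let [c m j t] be the average of [Q t] over the [j]-th dyadic arc of level
    [m].  Hypothesis (i) bounds the norm of the spatial dyadic averages of [Q],
    (ii) bounds [c m j] in [L^pb] of time with [pb > p1], and (iii), applied to
    smooth bumps that approximate the indicators of arcs and to the dyadic
    shifts [T 2^-i], makes the dyadic time averages of [c m j] converge in [L^1]
    at a geometric rate.  By Markov's inequality and countable subadditivity,
    [Q] satisfies all these countably many bounds, with suitable constants,
    outside an event of small probability.  Each bound only involves finitely
    many seminorms, so it cuts out a closed set.

    The set of fields satisfying all the bounds is compact: along an
    ultrafilter the integrals over each planar Borel set converge, the limits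
    form a finite charge, and its Radon-Nikodym density [g] with respect to
    Lebesgue measure is the limit point.  The coefficients [c m j] converge to
    those of [g] in [L^1] of time by the uniform rate in (iii), then in [L^p1]
    by interpolation with (ii); the seminorm of a general test function follows
    because dyadic step functions are dense in [L^(p2')].  Finally, [g] is
    strongly measurable because countably many coefficients determine it. *)

From HB Require Import structures.
Require Import Defs.
From mathcomp Require Import all_boot all_order all_algebra.
From mathcomp Require Import all_classical all_reals all_analysis.
From mathcomp Require Import measurable_realfun.
From mathcomp Require Import ring lra.
Set Implicit Arguments.
Unset Strict Implicit.
Unset Printing Implicit Defensive.
Import Order.TTheory GRing.Theory Num.Theory.
Import numFieldNormedType.Exports.
Local Open Scope classical_set_scope.
Local Open Scope ring_scope.

(** * Integrals of arbitrary functions, lower limits and L^p norms *)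

(** The integrands over [Omega] in the three hypotheses, one of them a supremum over uncountably
    many shifts, come without a proof of measurability. The integral of a nonnegative function is
    however the supremum over the simple functions below it, so monotonicity and Markov's inequality
    persist as soon as the exceptional event itself is measurable. Open sets are Borel: this is why
    the exceptional events are written as unions of complements of closed sets.

    Compactness is tested on ultrafilters, along which neither almost everywhere subsequences nor
    dominated convergence are available. Uniform estimates take their place: Hölder's inequality
    with the common norm bound keeps the limit charge countably additive, and the common rate in
    time lets the dyadic level be chosen before the index.

    The gain [alpha] is spent twice. Increments over shifts T 2^-i are of order 2^(-alpha i) in
    mean; one factor 2^(-alpha i / 2) makes the exceptional probabilities summable over i, the other
    is the rate kept outside the exceptional event. *)

Lemma lee_poweR (R : realType) (a : R) (x y : \bar R) :
  0 <= a -> (0 <= x)%E -> (x <= y)%E -> (x `^ a <= y `^ a)%E.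
Proof.
move=> a0 x0 xy; apply: gt0_ler_poweR => //; rewrite in_itv/= leey andbT//.
exact: le_trans xy.
Qed.

Section lower_integral.
Context d (T : measurableType d) (R : realType).
Variable mu : {measure set T -> \bar R}.
Local Open Scope ereal_scope.
Import HBNNSimple.

(* [\int[mu]_x f x] is a supremum over simple functions below [f], so it is
   monotone even when [f] and [g] are not measurable. *)
Lemma ge0_le_lower_integral (f g : T -> \bar R) :
  (forall x, 0 <= f x) -> (forall x, f x <= g x) ->
  \int[mu]_x f x <= \int[mu]_x g x.
Proof.
move=> f0 fg; have g0 x : 0 <= g x by exact: le_trans (f0 x) (fg x).
rewrite !ge0_integralTE//; apply: le_ereal_sup => _ /= [h hf <-].
by exists h => // x; exact: le_trans (hf x) (fg x).
Qed.

(** A simple function below [f], set to zero on a measurable null set that contains the exceptional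
    points, keeps its integral and lies below [g] everywhere. *)
Lemma ae_le_lower_integral (f g : T -> \bar R) :
  (forall x, 0 <= f x) -> (forall x, 0 <= g x) ->
  {ae mu, forall x, f x <= g x} -> \int[mu]_x f x <= \int[mu]_x g x.
Proof.
move=> f0 g0 [N [mN N0 fgN]].
rewrite [leLHS]ge0_integralTE//; apply: ge_ereal_sup => _ /= [h hf <-].
rewrite -integralT_nnsfun.
pose k := proj_nnsfun h (measurableC mN).
have -> : \int[mu]_x (h x)%:E = \int[mu]_x (k x)%:E.
  apply: ge0_ae_eq_integral => //.
  - exact/measurable_EFinP.
  - exact/measurable_EFinP.
  - by move=> x _; rewrite lee_fin fun_ge0.
  - by move=> x _; rewrite lee_fin fun_ge0.
  exists N; split => // x /= /not_implyP[_] hk; apply: contrapT => Nx; apply: hk.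
  by rewrite /k /= /mindic indicE mem_set// mulr1.
apply: ge0_le_lower_integral => x; first by rewrite lee_fin fun_ge0.
rewrite /k /= /mindic indicE; have [xN|xN] := boolP (x \in ~` N).
  rewrite mulr1; apply: le_trans (hf x) _.
  by apply: contrapT => fgx; move: xN; rewrite inE; apply; exact: fgN.
by rewrite mulr0.
Qed.

Lemma ae_eq_lower_integral (f g : T -> \bar R) :
  (forall x, 0 <= f x) -> (forall x, 0 <= g x) ->
  {ae mu, forall x, f x = g x} -> \int[mu]_x f x = \int[mu]_x g x.
Proof.
move=> f0 g0 fg; apply/eqP; rewrite eq_le; apply/andP; split;
  apply: ae_le_lower_integral => //;
  by apply: (@filterS _ _ (ae_filter_ringOfSetsType mu)) fg => x ->.
Qed.

Lemma ae_eq_Lnorm (p : R) (f g : T -> \bar R) :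
  {ae mu, forall x, f x = g x} -> Lnorm mu p%:E f = Lnorm mu p%:E g.
Proof.
move=> fg; rewrite unlock; congr (_ `^ _).
apply: ae_eq_lower_integral => [x|x|]; [exact: poweR_ge0|exact: poweR_ge0|].
by apply: (@filterS _ _ (ae_filter_ringOfSetsType mu)) fg => x ->.
Qed.

Lemma ae_le_Lnorm (p : R) (f g : T -> \bar R) : (0 < p)%R ->
  {ae mu, forall x, `|f x| <= `|g x|} -> Lnorm mu p%:E f <= Lnorm mu p%:E g.
Proof.
move=> p0 fg; rewrite unlock; apply: lee_poweR; first by rewrite invr_ge0 ltW.
  by apply: integral_ge0 => x _; exact: poweR_ge0.
apply: ae_le_lower_integral => [x|x|]; [exact: poweR_ge0|exact: poweR_ge0|].
apply: (@filterS _ _ (ae_filter_ringOfSetsType mu)) fg => x fgx.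
by apply: lee_poweR => //; exact: ltW.
Qed.

(** [c] times the indicator of [A] is a simple function below [f]; measurability enters through [A]
    alone. *)
Lemma lower_markov (f : T -> \bar R) (A : set T) (c : R) :
  measurable A -> (0 <= c)%R -> (forall x, 0 <= f x) ->
  (forall x, A x -> c%:E <= f x) -> c%:E * mu A <= \int[mu]_x f x.
Proof.
move=> mA c0 f0 cf.
have -> : c%:E * mu A = \int[mu]_x (c%:E * (\1_A x)%:E).
  rewrite ge0_integralZl_EFin//; last exact/measurable_EFinP/measurable_indic.
  by rewrite integral_indic// setIT.
apply: ge0_le_lower_integral => x; first by rewrite mule_ge0// lee_fin.
rewrite indicE; have [xA|xA] := boolP (x \in A).
  by rewrite mule1; apply: cf; rewrite inE in xA.
by rewrite mule0.
Qed.

End lower_integral.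

Section limn_einf.
Context {R : realType}.
Local Open Scope ereal_scope.

(** Testing a lower limit on the reals strictly below [l] turns it into eventual inequalities, which
    survive the application of an increasing map. *)
Lemma le_limn_einfP (u : (\bar R)^nat) (l : \bar R) :
  (forall r : R, r%:E < l -> \forall n \near \oo, r%:E <= u n) <->
  l <= limn_einf u.
Proof.
have E : limn_einf u = ereal_sup (range (einfs u)).
  by rewrite limn_einf_lim; apply/cvg_lim => //; exact: cvg_einfs_sup.
split.
  move=> hu; apply: contrapT => /negP; rewrite -ltNge => ul.
  have [r /andP[ur rl]] : exists r : R, (limn_einf u < r%:E < l).
    move: ul; case: (limn_einf u) => [a| |]; case: l {hu} => [b| |] //.
    - rewrite lte_fin => ab; exists ((a + b) / 2)%R.
      by rewrite !lte_fin midf_lt//=; rewrite midf_lt.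
    - by move=> _; exists (a + 1)%R; rewrite lte_fin ltrDl ltr01 ltry.
    - by move=> _; exists (b - 1)%R; rewrite lte_fin ltrBlDr ltrDl ltr01 ltNyr.
    - by move=> _; exists 0%R; rewrite ltNyr ltry.
  have [N _ HN] := hu _ rl.
  move: ur; rewrite ltNge => /negP; apply.
  rewrite E; apply: le_trans (ereal_sup_ubound _); last by exists N.
  apply: le_ereal_inf_tmp.
  by move=> _ /= [n Nn <-]; exact: HN.
move=> ll r rl.
have : r%:E < limn_einf u by exact: lt_le_trans rl ll.
rewrite E => /ereal_sup_gt[_ [N _ <-] rN].
exists N => // n Nn; apply: le_trans (ltW rN) _.
by apply: ereal_inf_lbound; exists n.
Qed.

Lemma poweR_limn_einf (u : (\bar R)^nat) (l : \bar R) (a : R) :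
  (0 < a)%R -> 0 <= l -> (forall n, 0 <= u n) ->
  l <= limn_einf u -> l `^ a <= limn_einf (fun n => u n `^ a).
Proof.
move=> a0 l0 u0 /le_limn_einfP hl; apply/le_limn_einfP => r rl.
have [r0|r0] := leP r 0%R.
  by near=> n; apply: le_trans (poweR_ge0 _ _); rewrite lee_fin.
have ia : (0 <= a^-1)%R by rewrite invr_ge0 ltW.
have rE : r%:E = (r `^ a^-1)%:E `^ a.
  by rewrite poweR_EFin -powRrM mulVf ?gt_eqF// powRr1// ltW.
have : \forall n \near \oo, (r `^ a^-1)%:E <= u n.
  apply: hl; rewrite ltNge; apply/negP => lr.
  move: rl; rewrite ltNge => /negP; apply; rewrite rE.
  by apply: lee_poweR => //; exact: ltW.
apply: filterS => n rn; rewrite rE; apply: lee_poweR => //; first exact: ltW.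
by rewrite lee_fin powR_ge0.
Unshelve. all: by end_near. Qed.

End limn_einf.

Lemma limn_einf_le (R : realType) (x : (\bar R)^nat) (M : R) :
  (forall n, (x n <= M%:E)%E) -> (limn_einf x <= M%:E)%E.
Proof.
move=> xM; rewrite leNgt; apply/negP => hlt.
have [r /andP[Mr rl]] : exists r : R, (M%:E < r%:E < limn_einf x)%E.
  move: hlt; case: (limn_einf _) => [a| |] //.
  - by rewrite lte_fin => ab; exists ((M + a) / 2); rewrite !lte_fin !midf_lt.
  - by move=> _; exists (M + 1); rewrite lte_fin ltrDl ltr01 ltry.
have [N _ HN] := (le_limn_einfP _ _).2 (lexx _) r rl.
have := le_trans (HN N (leqnn _)) (xM N).
by rewrite leNgt Mr.
Qed.

Section Lp_tools.
Context d (T : measurableType d) (R : realType).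
Variable mu : {measure set T -> \bar R}.
Local Notation "'N_ p [ f ]" := (Lnorm mu p%:E (EFin \o f)).

Lemma measurable_normpowR (f : T -> R) (p : R) : measurable_fun setT f ->
  measurable_fun setT (fun x => `|f x| `^ p).
Proof.
move=> mf; apply: (@measurableT_comp _ _ _ _ _ _ (@powR R ^~ p)) => //.
exact: measurableT_comp.
Qed.

Lemma Lnorm_powE (p : R) (f : T -> R) : 0 < p ->
  (\int[mu]_x (`|f x| `^ p)%:E = 'N_p[f] `^ p)%E.
Proof. by move=> p0; rewrite poweR_Lnorm// gt_eqF. Qed.

Lemma Lnorm_leP (p c : R) (f : T -> R) : 0 < p -> 0 <= c ->
  ('N_p[f] <= c%:E)%E <-> (\int[mu]_x (`|f x| `^ p)%:E <= (c `^ p)%:E)%E.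
Proof.
move=> p0 c0; rewrite Lnorm_powE// -poweR_EFin; split => h.
  by apply: lee_poweR; rewrite ?Lnorm_ge0// ltW.
have : (('N_p[f] `^ p) `^ p^-1 <= (c%:E `^ p) `^ p^-1)%E.
  by apply: lee_poweR => //; rewrite ?poweR_ge0// invr_ge0 ltW.
by rewrite -!poweRrM mulfV ?gt_eqF// !poweRe1 ?Lnorm_ge0 ?lee_fin.
Qed.

Lemma Lnorm_lty (p : R) (f : T -> R) : 0 < p ->
  ('N_p[f] < +oo)%E <-> (\int[mu]_x (`|f x| `^ p)%:E < +oo)%E.
Proof.
move=> p0; rewrite Lnorm_powE//; split => [/poweR_lty//|].
by apply: lty_poweRy; rewrite gt_eqF.
Qed.

Lemma Lnorm_cvg0P (p : R) (f : (T -> R)^nat) : 0 < p ->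
  'N_p[f n] @[n --> \oo] --> 0%E <->
  (forall e : R, 0 < e -> \forall n \near \oo, ('N_p[f n] <= e%:E)%E).
Proof.
move=> p0; split => [/fine_cvgP[/= fin cv] e e0|h].
  move/cvgr0Pnorm_le : cv => /(_ _ e0) cv.
  apply: filterS2 fin cv => n /= fin.
  by rewrite ger0_norm ?fine_ge0 ?Lnorm_ge0// -lee_fin fineK.
apply/fine_cvgP; split.
  apply: filterS (h _ ltr01) => n hn; rewrite ge0_fin_numE ?Lnorm_ge0//.
  exact: le_lt_trans hn (ltry _).
apply/cvgr0Pnorm_le => e e0; apply: filterS (h _ e0) => n hn /=.
have fn : 'N_p[f n] \is a fin_num.
  by rewrite ge0_fin_numE ?Lnorm_ge0//; exact: le_lt_trans hn (ltry _).
by rewrite ger0_norm ?fine_ge0 ?Lnorm_ge0// -lee_fin fineK.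
Qed.

End Lp_tools.

(** * Real powers: continuity, convexity and interpolation *)

Section powR_facts.
Context {R : realType}.
Implicit Types (a b p e : R).

Lemma powR_root a p : 0 < p -> 0 <= a -> (a `^ p^-1) `^ p = a.
Proof. by move=> p0 a0; rewrite -powRrM mulVf ?gt_eqF// powRr1. Qed.

Lemma powR_rootV a p : 0 < p -> 0 <= a -> (a `^ p) `^ p^-1 = a.
Proof. by move=> p0 a0; rewrite -powRrM mulfV ?gt_eqF// powRr1. Qed.

(** Bounds on the power pull back through the inverse power. When a^p - e is negative, in particular
    for a = 0, the lower bound holds trivially. *)
Lemma cvg_powR (I : Type) (F : set_system I) (FF : Filter F) (u : I -> R) a p :
  0 < p -> (forall i, 0 <= u i) -> 0 <= a -> u @ F --> a ->
  (fun i => u i `^ p) @ F --> a `^ p.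
Proof.
move=> p0 u0 a0 ua; apply/cvgrPdist_lt => e e0.
have ip0 : 0 < p^-1 by rewrite invr_gt0.
have ap0 : 0 <= a `^ p + e by rewrite addr_ge0 ?powR_ge0// ltW.
have up : a < (a `^ p + e) `^ p^-1.
  rewrite -[ltLHS](powR_rootV p0 a0); apply: gt0_ltr_powR => //;
    by rewrite ?nnegrE ?powR_ge0// ltrDl.
have down : exists2 b, b < a & forall x, 0 <= x -> b < x -> a `^ p - e < x `^ p.
  have [ape|ape] := ltP (a `^ p - e) 0.
    exists (a - 1); first by rewrite ltrBlDr ltrDl.
    by move=> x x0 _; apply: lt_le_trans ape _; exact: powR_ge0.
  exists ((a `^ p - e) `^ p^-1).
    rewrite -[ltRHS](powR_rootV p0 a0); apply: gt0_ltr_powR => //;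
      by rewrite ?nnegrE ?powR_ge0// ltrBlDr ltrDl.
  move=> x x0 bx; rewrite -[ltLHS](powR_root p0 ape); apply: gt0_ltr_powR => //.
  by rewrite nnegrE powR_ge0.
case: down => b ba bP.
have nu : \forall i \near F, u i < (a `^ p + e) `^ p^-1.
  by move/cvgr_lt : ua; apply.
have nd : \forall i \near F, b < u i by move/cvgr_gt : ua; apply.
apply: filterS2 nu nd => i ui bi.
rewrite ltr_distl ltrBlDr -[X in _ && X]ltrBlDr bP// andbT.
rewrite -[ltRHS](powR_root p0 ap0); apply: gt0_ltr_powR => //;
  by rewrite nnegrE ?powR_ge0.
Qed.

(** Convexity of the power at the midpoint of 2|a| and 2|b|. It makes the integrand of the Scheffé
    argument nonnegative. *)
Lemma powR_normB a b p : 1 <= p ->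
  `|a - b| `^ p <= 2 `^ (p - 1) * (`|a| `^ p + `|b| `^ p).
Proof.
move=> p1; have p0 : 0 < p by exact: lt_le_trans p1.
have h0 : 0 <= 2^-1 :> R by rewrite invr_ge0.
have h1 : 2^-1 <= 1 :> R by rewrite invf_le1// ler1n.
have hE : 2^-1 = 1 - 2^-1 :> R by rewrite {2}(splitr 1) div1r addrK.
have := @convex_powR R p p1 (Itv01 h0 h1) (2 * `|a|) (2 * `|b|).
rewrite !inE/= !in_itv/= !andbT !mulr_ge0//= => /(_ isT isT) h.
rewrite convRE [X in X `^ _ <= _]convRE/= /unstable.onem -!hE !(mulrA _ 2) mulVf// !mul1r in h.
apply: le_trans (_ : (`|a| + `|b|) `^ p <= _).
  by apply: ge0_ler_powR; rewrite ?nnegrE ?addr_ge0 ?(ltW p0)// ler_normB.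
apply: (le_trans h); rewrite -mulrDr !powRM// -mulrDr mulrA.
by rewrite -powR_inv1// -powRD ?pnatr_eq0 ?implybT// addrC.
Qed.

(** Below the threshold [l] use a^(p-1) <= l^(p-1); above it use a^(p-q) <= l^(p-q), as p - q <= 0.
    For p < q a large [l] makes the second term small under an L^q bound, after which a small L^1
    norm handles the first. *)
Lemma powR_interpolation (l a p q : R) : 0 < l -> 0 <= a -> 1 <= p -> p <= q ->
  a `^ p <= l `^ (p - 1) * a + l `^ (p - q) * a `^ q.
Proof.
move=> l0 a0 p1 pq; have p0 : 0 < p by exact: lt_le_trans p1.
have [al|la] := leP a l.
  apply: le_trans (_ : l `^ (p - 1) * a <= _); last first.
    by rewrite lerDl mulr_ge0 ?powR_ge0.
  rewrite -mulr_powRB1// mulrC ler_wpM2r// ge0_ler_powR ?subr_ge0//.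
  by rewrite nnegrE ltW.
apply: le_trans (_ : l `^ (p - q) * a `^ q <= _); last first.
  by rewrite lerDr mulr_ge0 ?powR_ge0.
have a0' : 0 < a by exact: lt_trans la.
have -> : a `^ p = a `^ (p - q) * a `^ q.
  by rewrite -powRD ?subrK// gt_eqF ?implybT.
rewrite ler_wpM2r ?powR_ge0//.
rewrite -opprB !powRN lef_pV2 ?posrE ?powR_gt0//.
by rewrite ge0_ler_powR ?subr_ge0// ?nnegrE ltW.
Qed.

End powR_facts.

(** * Almost everywhere convergence and L^p norms *)

Section scheffe.
Context d (T : measurableType d) (R : realType).
Variable mu : {measure set T -> \bar R}.
Local Notation "'N_ p [ f ]" := (Lnorm mu p%:E (EFin \o f)).

Lemma ae_cvg_Lnorm_fatou (p : R) (f : T -> R) (g : (T -> R)^nat) : 0 < p ->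
  measurable_fun setT f -> (forall n, measurable_fun setT (g n)) ->
  {ae mu, forall x, g n x @[n --> \oo] --> f x} ->
  ('N_p[f] <= limn_einf (fun n => 'N_p[g n]))%E.
Proof.
move=> p0 mf mg gf.
have -> : 'N_p[f] = ((\int[mu]_x (`|f x| `^ p)%:E) `^ p^-1)%E by rewrite unlock.
have -> : (fun n => 'N_p[g n]) =
    (fun n => ((\int[mu]_x (`|g n x| `^ p)%:E) `^ p^-1)%E).
  by apply/funext => n; rewrite unlock.
have ip0 : 0 < p^-1 by rewrite invr_gt0.
apply: poweR_limn_einf => //; first by apply: integral_ge0 => x _; rewrite lee_fin powR_ge0.
  by move=> n; apply: integral_ge0 => x _; rewrite lee_fin powR_ge0.
apply: le_trans (fatou mu measurableT _ _).
- apply: ae_le_lower_integral => [x|x|].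
  + by rewrite lee_fin powR_ge0.
  + by apply/le_limn_einfP => r r0; near=> n; apply: le_trans (ltW r0) _; rewrite lee_fin powR_ge0.
  apply: (@filterS _ _ (ae_filter_ringOfSetsType mu)) gf => x gfx.
  have : (`|g n x| `^ p)%:E @[n --> \oo] --> (`|f x| `^ p)%:E.
    by apply: cvg_EFin; [exact: nearW|apply: cvg_powR => //; exact: cvg_norm].
  by move=> /cvg_limn_einf_sup[-> _].
- by move=> n; apply/measurable_EFinP; exact: measurable_normpowR.
- by move=> n x _; rewrite lee_fin powR_ge0.
Unshelve. all: by end_near. Qed.

(* Riesz-Scheffe: Fatou's lemma applied to
   [2^(p-1) (|f|^p + |g n|^p) - |f - g n|^p]. *)
Lemma ae_cvg_Lnorm_cvg (p : R) (f : T -> R) (g : (T -> R)^nat) : 1 <= p ->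
  measurable_fun setT f -> (forall n, measurable_fun setT (g n)) ->
  ('N_p[f] < +oo)%E -> (forall n, ('N_p[g n] <= 'N_p[f])%E) ->
  {ae mu, forall x, g n x @[n --> \oo] --> f x} ->
  forall e : R, 0 < e -> \forall n \near \oo, ('N_p[(f \- g n)%R] <= e%:E)%E.
Proof.
move=> p1 mf mg ffin gf cv e e0; have p0 : 0 < p by exact: lt_le_trans p1.
pose I (h : T -> R) := (\int[mu]_x (`|h x| `^ p)%:E)%E.
have I0 h : (0 <= I h)%E by apply: integral_ge0 => x _; rewrite lee_fin powR_ge0.
have fin_I h : ('N_p[h] < +oo)%E -> I h \is a fin_num.
  by move=> /(Lnorm_lty _ _ p0) hf; rewrite ge0_fin_numE.
have gfin n : ('N_p[g n] < +oo)%E by exact: le_lt_trans (gf n) ffin.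
have Igf n : (I (g n) <= I f)%E.
  by rewrite /I !Lnorm_powE//; apply: lee_poweR; rewrite ?Lnorm_ge0// ltW.
have mp (h : T -> R) : measurable_fun setT h -> measurable_fun setT (fun x => (`|h x| `^ p)%:E).
  by move=> mh; apply/measurable_EFinP; exact: measurable_normpowR.
pose c := 2 `^ (p - 1) : R.
have c0 : 0 <= c by exact: powR_ge0.
pose u n x := (c * (`|f x| `^ p + `|g n x| `^ p) - `|f x - g n x| `^ p)%:E.
have u0 n x : (0 <= u n x)%E by rewrite lee_fin subr_ge0 powR_normB.
have mD n : measurable_fun setT (f \- g n) by exact: measurable_funB.
have mu_ n : measurable_fun setT (u n).
  apply/measurable_EFinP; apply: measurable_funB.
    apply: measurable_funM => //; apply: measurable_funD.
      exact: (measurable_normpowR p mf).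
    exact: (measurable_normpowR p (mg n)).
  exact: (measurable_normpowR p (mD n)).
have sum n : (\int[mu]_x u n x + I (f \- g n)%R = c%:E * (I f + I (g n)))%E.
  rewrite /I -ge0_integralD//; last exact: mp.
  rewrite -ge0_integralD//; [|exact: mp..].
  rewrite -ge0_integralZl_EFin//.
  - by apply: eq_integral => x _; rewrite -!EFinD subrK -EFinM.
  - by move=> x _; rewrite adde_ge0// lee_fin powR_ge0.
  - by apply: emeasurable_funD; exact: mp.
have fat : ((c * 2)%:E * I f <= limn_einf (fun n => \int[mu]_x u n x))%E.
  apply: le_trans (fatou mu measurableT _ _) => //.
  rewrite /I -ge0_integralZl_EFin//; [|exact: mp|by rewrite mulr_ge0].
  apply: ae_le_lower_integral => [x|x|].
  + by rewrite -EFinM lee_fin mulr_ge0 ?mulr_ge0 ?powR_ge0.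
  + by apply/le_limn_einfP => r r0; near=> n; apply: le_trans (ltW r0) _.
  apply: (@filterS _ _ (ae_filter_ringOfSetsType mu)) cv => x cvx.
  have : u n x @[n --> \oo] --> (c * 2 * `|f x| `^ p)%:E.
    apply: cvg_EFin; first exact: nearW.
    have -> : c * 2 * `|f x| `^ p = c * (`|f x| `^ p + `|f x| `^ p) - `|f x - f x| `^ p.
      by rewrite subrr normr0 powR0 ?gt_eqF// subr0 -mulrA mulr_natl mulr2n.
    apply: cvgB.
      apply: cvgMr; apply: cvgD; first exact: cvg_cst.
      by apply: cvg_powR => //; exact: cvg_norm.
    apply: cvg_powR => //; apply: cvg_norm; apply: cvgB => //; exact: cvg_cst.
  by move=> /cvg_limn_einf_sup[-> _]; rewrite EFinM.
have IfE : I f = (fine (I f))%:E by rewrite fineK// fin_I.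
(* Eventually the integral of [u n] is at least 2c I(f) - e^p by Fatou, while that integral plus I(f
   - g n) is at most 2c I(f), because the norm of [g n] does not exceed that of [f]. Subtracting
   leaves I(f - g n) <= e^p. *)
move: fat => /le_limn_einfP /(_ (c * 2 * fine (I f) - e `^ p)).
have ep : 0 < e `^ p by exact: powR_gt0.
rewrite IfE -EFinM lte_fin ltrBlDr ltrDl => /(_ ep).
apply: filterS => n hn; apply/Lnorm_leP => //; first exact: ltW.
have le : (\int[mu]_x u n x + I (f \- g n)%R <= (c * 2 * fine (I f))%:E)%E.
  rewrite sum -mulrA mulr_natl mulr2n EFinM EFinD -IfE.
  by apply: lee_pmul; [rewrite lee_fin|exact: adde_ge0|exact: lexx|exact: leeD2l].
have Iu : (\int[mu]_x u n x)%E \is a fin_num.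
  rewrite ge0_fin_numE ?integral_ge0//; apply: le_lt_trans (ltry _).
  by apply: le_trans le; rewrite leeDl.
have Ia : I (f \- g n)%R \is a fin_num.
  rewrite ge0_fin_numE//; apply: le_lt_trans (ltry _).
  by apply: le_trans le; rewrite leeDr ?integral_ge0.
rewrite -/(I (f \- g n)%R) -(fineK Ia) lee_fin.
rewrite -(fineK Iu) -(fineK Ia) -EFinD lee_fin in le.
rewrite -(fineK Iu) lee_fin/= in hn.
lra.
Unshelve. all: by end_near. Qed.

End scheffe.

(** * Dyadic averages *)

Lemma sum_integral_le d (T : measurableType d) (R : realType)
    (nu : {measure set T -> \bar R}) (n : nat) (F : 'I_n -> set T) (D : set T)
    (h : T -> \bar R) :
  (forall i, measurable (F i)) -> measurable D -> (forall i, F i `<=` D) ->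
  trivIset setT F -> (forall x, (0 <= h x)%E) -> measurable_fun setT h ->
  (\sum_(i < n) \int[nu]_(x in F i) h x <= \int[nu]_(x in D) h x)%E.
Proof.
move=> mF mD FD tF h0 mh; rewrite -ge0_integral_bigsetU//=.
- apply: ge0_subset_integral => //.
  + exact: bigsetU_measurable.
  + exact: measurable_funS mh.
  + by elim/big_ind : _ => // A B AD BD x [/AD|/BD].
- exact: index_enum_uniq.
- by apply: sub_trivIset tF => i.
- exact: measurable_funS mh.
Qed.

Section integrable_real.
Context d (T : measurableType d) (R : realType).
Variables (nu : {measure set T -> \bar R}) (D : set T).
Hypothesis mD : measurable D.
Implicit Types f g : T -> R.

Lemma integrableZ_EFin (r : R) f : nu.-integrable D (EFin \o f) ->
  nu.-integrable D (EFin \o (fun x => r * f x)).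
Proof. exact: integrableZl. Qed.

Lemma integrableB_EFin f g : nu.-integrable D (EFin \o f) ->
  nu.-integrable D (EFin \o g) ->
  nu.-integrable D (EFin \o (fun x => f x - g x)).
Proof. by move=> fi gi; have := integrableB mD fi gi. Qed.

End integrable_real.

(** The left side is the tangent at [a] of the convex function y^p; Young's inequality with
    exponents p and p / (p - 1) yields it. The case p = 1 is separate, as it has no finite conjugate
    exponent. *)
Lemma powR_tangent (R : realType) (p a y : R) : 1 <= p -> 0 <= a -> 0 <= y ->
  p * a `^ (p - 1) * y - (p - 1) * a `^ p <= y `^ p.
Proof.
move=> p1 a0 y0; have p0 : 0 < p by exact: lt_le_trans p1.
have [p1'|p1'] := eqVneq p 1.
  by rewrite p1' subrr powRr0 !powRr1// mulr1 mul1r mul0r subr0.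
have pm1 : 0 < p - 1 by rewrite subr_gt0 lt_neqAle eq_sym p1'.
have pm1' : p - 1 != 0 by rewrite gt_eqF.
have := @conjugate_powR R y (a `^ (p - 1)) p (p / (p - 1)) y0 (powR_ge0 _ _) p0.
rewrite divr_gt0// => /(_ isT).
have -> : p^-1 + (p / (p - 1))^-1 = 1 by field; rewrite pm1' gt_eqF.
move=> /(_ erefl); rewrite -powRrM mulrCA mulfV// mulr1 => h.
have := ler_wpM2l (ltW p0) h.
have -> : p * (y `^ p / p + a `^ p / (p / (p - 1))) = y `^ p + (p - 1) * a `^ p.
  by field; rewrite pm1' gt_eqF.
by rewrite lerBlDr mulrAC -mulrA.
Qed.

Section translation.
Context {R : realType}.
Local Notation leb := (@lebesgue_measure R).

Lemma measurable_shift (h : R) :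
  measurable_fun setT (fun x : measurableTypeR R => (x + h : measurableTypeR R)).
Proof. exact: measurable_funD. Qed.

Lemma lebesgue_measure_shift (h : R) (A : set (measurableTypeR R)) :
  measurable A ->
  pushforward leb (fun x : measurableTypeR R => (x + h : measurableTypeR R)) A
  = leb A.
Proof.
move=> mA; apply/esym; apply: lebesgue_measure_unique => //=.
  exact: measurable_shift.
move=> mf _ [[a b]] _ <-; rewrite /pushforward/=.
have -> : (fun x => x + h) @^-1` `]a, b]%classic = `]a - h, b - h]%classic.
  by apply/seteqP; split => x /=; rewrite !in_itv/= ltrBlDr lerBrDr.
rewrite !lebesgue_measure_itv/= !lte_fin ltrD2r.
by case: ifP => // _; rewrite -!EFinB; congr EFin; ring.
Qed.

End translation.

Section dyadic.
Context {R : realType} (L : R) (mu : {measure set (measurableTypeR R) -> \bar R}).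
Hypothesis L0 : 0 < L.
Hypothesis muE : forall A : set (measurableTypeR R), measurable A ->
  mu A = lebesgue_measure (A `&` `[0, L[%classic).
Implicit Types (f g : R -> R) (k i j : nat).

Local Notation "'N_ p [ f ]" := (Lnorm mu p%:E (EFin \o f)).

(** Interval and measure stay abstract so that the results serve both space, with L = 2 pi and
    [circle], and time, with L = T and [time T]. *)
Definition mesh (k : nat) : R := L / 2 ^+ k.

Lemma mesh_gt0 k : 0 < mesh k.
Proof. by rewrite divr_gt0 ?exprn_gt0. Qed.

Lemma mesh_ge0 k : 0 <= mesh k.
Proof. exact/ltW/mesh_gt0. Qed.

Lemma meshS k : mesh k = mesh k.+1 * 2.
Proof. by rewrite /mesh exprSr invfM mulrA divfK// pnatr_eq0. Qed.

Lemma mesh_total k : (2 ^ k)%:R * mesh k = L.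
Proof. by rewrite natrX /mesh mulrC divfK// expf_eq0 pnatr_eq0 andbF. Qed.

Definition cell (k i : nat) : set (measurableTypeR R) :=
  `[i%:R * mesh k, i.+1%:R * mesh k[%classic.

Lemma measurable_cell k i : measurable (cell k i).
Proof. exact: measurable_itv. Qed.
#[local] Hint Extern 0 (measurable (cell _ _)) => solve [exact: measurable_cell] : core.

Lemma measurable_indic_cell k i :
  measurable_fun setT (\1_(cell k i) : R -> R).
Proof. exact (measurable_indic (measurable_cell k i)). Qed.

Lemma cellP k i x : cell k i x <-> i%:R * mesh k <= x < i.+1%:R * mesh k.
Proof. by rewrite /cell /= in_itv/=. Qed.

Lemma sub_cell k i : (i < 2 ^ k)%N -> cell k i `<=` `[0, L[%classic.
Proof.
move=> ik x /cellP/andP[ix xi]; rewrite /= in_itv/=; apply/andP; split.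
  by apply: le_trans ix; rewrite mulr_ge0// mesh_ge0.
apply: lt_le_trans xi _; rewrite -(mesh_total k) ler_pM2r ?mesh_gt0//.
by rewrite ler_nat.
Qed.

Lemma lebesgue_cell k i : lebesgue_measure (cell k i) = (mesh k)%:E.
Proof.
rewrite lebesgue_measure_itv/= lte_fin ltr_pM2r ?mesh_gt0// ltr_nat ltnSn.
by rewrite -EFinB -mulrBl -natrB// subSnn mul1r.
Qed.

Lemma mu_cell k i : (i < 2 ^ k)%N -> mu (cell k i) = (mesh k)%:E.
Proof. by move=> ik; rewrite muE// setIidl ?lebesgue_cell//; exact: sub_cell. Qed.

Lemma cell_inj k i j x : cell k i x -> cell k j x -> i = j.
Proof.
have h a b : cell k a x -> cell k b x -> (a <= b)%N.
  move=> /cellP/andP[ax _] /cellP/andP[_ xb].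
  by have := le_lt_trans ax xb; rewrite ltr_pM2r ?mesh_gt0// ltr_nat ltnS.
by move=> xi xj; apply/eqP; rewrite eqn_leq !h.
Qed.

Lemma cell_ex k x : `[0, L[%classic x -> exists2 i, (i < 2 ^ k)%N & cell k i x.
Proof.
rewrite /= in_itv/= => /andP[x0 xL].
have xk0 : 0 <= x / mesh k by exact: divr_ge0 x0 (mesh_ge0 k).
exists (Num.Def.trunc (x / mesh k)).
  rewrite truncn_lt_nat//.
  by rewrite ltr_pdivrMr ?mesh_gt0// mesh_total.
have /andP[h1 h2] := truncn_itv xk0.
by apply/cellP; rewrite -ler_pdivlMr ?mesh_gt0// -ltr_pdivrMr ?mesh_gt0// h1.
Qed.

Lemma cellS k i : cell k i = cell k.+1 i.*2 `|` cell k.+1 i.*2.+1.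
Proof.
have h := mesh_gt0 k.+1.
have E1 : i.*2%:R * mesh k.+1 = i%:R * mesh k.
  by rewrite (meshS k) -muln2 natrM; ring.
have E2 : i.*2.+2%:R * mesh k.+1 = i.+1%:R * mesh k.
  by rewrite (meshS k) -doubleS -muln2 natrM; ring.
have E3 : i.*2.+1%:R * mesh k.+1 = i%:R * mesh k + mesh k.+1.
  by rewrite -natr1 mulrDl mul1r E1.
have E4 : i.+1%:R * mesh k = i%:R * mesh k + mesh k.+1 + mesh k.+1.
  by rewrite -natr1 (meshS k); ring.
apply/seteqP; split => x.
  move=> /cellP/andP[ix xi]; have [xm|xm] := ltP x (i.*2.+1%:R * mesh k.+1).
    by left; apply/cellP; rewrite E1 ix.
  by right; apply/cellP; rewrite E2 xm.
case=> /cellP/andP[ix xi]; apply/cellP.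
  by rewrite -E1 ix (lt_trans xi)// E3 E4 ltrDl.
by rewrite -E2 xi andbT; apply: le_trans ix; rewrite E3 lerDl ltW.
Qed.

Lemma ae_in_domain : {ae mu, forall x, `[0, L[%classic x}.
Proof.
exists (~` `[0, L[%classic); split => //; first exact: measurableC.
by rewrite muE; [rewrite setICl measure0|exact: measurableC].
Qed.

Definition stepf k (c : nat -> R) (x : R) : R :=
  \sum_(i < 2 ^ k) c i * \1_(cell k i) x.

Lemma stepfE k c i x : (i < 2 ^ k)%N -> cell k i x -> stepf k c x = c i.
Proof.
move=> ik xi; rewrite /stepf (bigD1 (Ordinal ik))//= indicE mem_set// mulr1.
rewrite big1 ?addr0// => j ji; rewrite indicE memNset ?mulr0// => xj.
by move/eqP : ji; apply; apply: val_inj => /=; exact: cell_inj xj xi.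
Qed.

Lemma stepf_out k c x : ~ `[0, L[%classic x -> stepf k c x = 0.
Proof.
move=> nx; rewrite /stepf big1// => i _; rewrite indicE memNset ?mulr0// => xi.
by apply: nx; exact: sub_cell xi.
Qed.

Lemma measurable_stepf k c : measurable_fun setT (stepf k c).
Proof.
by apply: measurable_sum => i; apply: measurable_funM.
Qed.

Lemma stepf_comp (V : nmodType) (Phi : R -> V) k c x : Phi 0 = 0 ->
  Phi (stepf k c x) =
  \sum_(i < 2 ^ k) if x \in cell k i then Phi (c i) else 0.
Proof.
move=> Phi0; have [xL|xL] := pselect (`[0, L[%classic x).
  have [i ik xi] := cell_ex k xL; rewrite (stepfE _ ik)// (bigD1 (Ordinal ik))//=.
  rewrite mem_set// big1 ?addr0// => j ji; rewrite memNset// => xj.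
  by move/eqP : ji; apply; apply: val_inj => /=; exact: cell_inj xj xi.
rewrite stepf_out// Phi0 big1// => i _; rewrite memNset// => xi.
by apply: xL; exact: sub_cell xi.
Qed.

Lemma integral_stepf k c p : 0 < p ->
  (\int[mu]_x (`|stepf k c x| `^ p)%:E =
   (\sum_(i < 2 ^ k) `|c i| `^ p * mesh k)%:E)%E.
Proof.
move=> p0.
have E x : (`|stepf k c x| `^ p)%:E =
    (\sum_(i < 2 ^ k) (`|c i| `^ p)%:E * (\1_(cell k i) x)%:E)%E.
  rewrite (@stepf_comp _ (fun y => `|y| `^ p)); last by rewrite normr0 powR0 ?gt_eqF.
  rewrite -sumEFin; apply: eq_bigr => i _; rewrite indicE.
  by case: ifP; rewrite ?mule1 ?mule0.
under eq_integral do rewrite E.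
rewrite ge0_integral_sum//; last first.
  by move=> i; apply: emeasurable_funM => //; apply/measurable_EFinP; exact: measurable_indic_cell.
rewrite -sumEFin; apply: eq_bigr => i _.
rewrite ge0_integralZl_EFin ?powR_ge0//; last first.
  apply/measurable_EFinP; exact: measurable_indic_cell.
by rewrite integral_indic// setIT mu_cell.
Qed.

Lemma Lnorm1_stepf k c :
  'N_1[stepf k c] = (\sum_(i < 2 ^ k) `|c i| * mesh k)%:E.
Proof.
rewrite Lnorm1.
transitivity (\int[mu]_x (`|stepf k c x| `^ 1)%:E)%E.
  by apply: eq_integral => x _; rewrite powRr1.
rewrite integral_stepf//; congr EFin.
by apply: eq_bigr => i _; rewrite powRr1.
Qed.

Definition avg k i f : R := (mesh k)^-1 * \int[mu]_(x in cell k i) f x.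

Definition dyad k f := stepf k (fun i => avg k i f).

Lemma measurable_dyad k f : measurable_fun setT (dyad k f).
Proof. exact: measurable_stepf. Qed.

Lemma Lnorm_integrable p f : 1 <= p -> measurable_fun setT f ->
  ('N_p[f] < +oo)%E -> mu.-integrable setT (EFin \o f).
Proof.
move=> p1 mf fp; apply/Lfun1_integrable.
apply: (@Lfun_subset _ _ _ mu 1 p%:E) => //.
- by rewrite muE// setTI lebesgue_measure_itv/= lte_fin L0.
- by rewrite inE; apply/andP; split; rewrite inE.
Qed.

Lemma integrable_cell k i f : mu.-integrable setT (EFin \o f) ->
  mu.-integrable (cell k i) (EFin \o f).
Proof. by move=> fi; exact: integrableS fi. Qed.

Lemma le_norm_avg k i f : mu.-integrable setT (EFin \o f) ->
  `|avg k i f| <= avg k i (fun x => `|f x|).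
Proof.
move=> fi; rewrite /avg normrM gtr0_norm ?invr_gt0 ?mesh_gt0//.
rewrite ler_wpM2l ?invr_ge0 ?mesh_ge0//.
by apply: le_normr_Rintegral => //; exact: integrable_cell.
Qed.

Lemma avgB k i f g : mu.-integrable setT (EFin \o f) ->
  mu.-integrable setT (EFin \o g) ->
  avg k i (fun x => f x - g x) = avg k i f - avg k i g.
Proof.
by move=> fi gi; rewrite /avg RintegralB ?mulrBr//; exact: integrable_cell.
Qed.

Lemma trivIset_cell k : trivIset setT (fun i : 'I_(2 ^ k) => cell k i).
Proof.
by move=> i j _ _ [x [xi xj]]; apply: val_inj => /=; exact: cell_inj xi xj.
Qed.

(** Jensen's inequality: integrate over the cell the tangent of y^p at the mean [a] of |f|. Since p
    a^(p-1) a - (p-1) a^p = a^p, the tangent integrates to a^p times the measure of the cell. *)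
Lemma le_avg_powR k i p f : (i < 2 ^ k)%N -> 1 <= p -> measurable_fun setT f ->
  ('N_p[f] < +oo)%E ->
  ((`|avg k i f| `^ p * mesh k)%:E <= \int[mu]_(x in cell k i) (`|f x| `^ p)%:E)%E.
Proof.
move=> ik p1 mf fp; have p0 : 0 < p by exact: lt_le_trans p1.
have fi := Lnorm_integrable p1 mf fp.
have fi' := integrable_norm fi.
pose a := avg k i (fun x => `|f x|).
have a0 : 0 <= a.
  by rewrite mulr_ge0 ?invr_ge0 ?mesh_ge0// Rintegral_ge0.
have fpi : mu.-integrable (cell k i) (EFin \o (fun x => `|f x| `^ p)).
  apply: (@integrableS _ _ _ mu setT) => //; apply: Lfun_integrable => //.
  by rewrite inE; apply/andP; split; rewrite inE.
apply: (@le_trans _ _ (a `^ p * mesh k)%:E).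
  rewrite lee_fin ler_wpM2r ?mesh_ge0// ge0_ler_powR ?nnegrE ?(ltW p0)//.
  exact: le_norm_avg.
have -> : (\int[mu]_(x in cell k i) (`|f x| `^ p)%:E)%E =
    (\int[mu]_(x in cell k i) (`|f x| `^ p))%:E.
  by rewrite /Rintegral fineK//; exact: integrable_fin_num.
rewrite lee_fin.
have fic : mu.-integrable (cell k i) (EFin \o (fun x => `|f x|)).
  exact: integrable_cell.
have mfin : (mu (cell k i) < +oo)%E by rewrite mu_cell// ltry.
have ci (r : R) : mu.-integrable (cell k i) (EFin \o cst r).
  apply: measurable_bounded_integrable => //; apply: bounded_cst.
have fic2 : mu.-integrable (cell k i) (EFin \o (fun x => p * a `^ (p - 1) * `|f x|)).
  exact: integrableZ_EFin.
have tan_int := integrableB_EFin (measurable_cell k i) fic2 (ci ((p - 1) * a `^ p)).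
have := le_Rintegral (measurable_cell k i) tan_int fpi
  (fun x _ => powR_tangent p1 a0 (normr_ge0 (f x))).
rewrite RintegralB// RintegralZl// Rintegral_cst// mu_cell//=.
have -> : \int[mu]_(x in cell k i) `|f x| = mesh k * a.
  by rewrite /a /avg mulrA mulfV ?mul1r// gt_eqF// mesh_gt0.
by apply: le_trans; rewrite -(mulr_powRB1 a0 p0); lra.
Qed.

Lemma Lnorm_dyad_le k p f : 1 <= p -> measurable_fun setT f ->
  ('N_p[dyad k f] <= 'N_p[f])%E.
Proof.
move=> p1 mf; have p0 : 0 < p by exact: lt_le_trans p1.
have [->|/eqP fp] := eqVneq 'N_p[f] +oo%E; first by rewrite leey.
have {}fp : ('N_p[f] < +oo)%E by rewrite ltey; apply/eqP.
rewrite [in leLHS]unlock [in leRHS]unlock; apply: lee_poweR.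
- by rewrite invr_ge0 ltW.
- by apply: integral_ge0 => x _; rewrite lee_fin powR_ge0.
change (\int[mu]_x (`|dyad k f x| `^ p)%:E <= \int[mu]_x (`|f x| `^ p)%:E)%E.
rewrite integral_stepf// -sumEFin.
apply: (@le_trans _ _ (\sum_(i < 2 ^ k) \int[mu]_(x in cell k i) (`|f x| `^ p)%:E)%E).
  by apply: lee_sum => i _; exact: le_avg_powR.
apply: sum_integral_le => //.
- exact: trivIset_cell.
- by apply/measurable_EFinP; exact: measurable_normpowR.
Qed.

End dyadic.

#[export] Hint Extern 0 (measurable (cell _ _ _)) => solve [exact: measurable_cell] : core.

(** * Convergence of dyadic averages, with a rate from translations *)

Section dyadic_convergence.
Context {R : realType} (L : R) (mu : {measure set (measurableTypeR R) -> \bar R}).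
Hypothesis L0 : 0 < L.
Hypothesis muE : forall A : set (measurableTypeR R), measurable A ->
  mu A = lebesgue_measure (A `&` `[0, L[%classic).
Implicit Types (f g : R -> R) (k i j : nat).
Local Notation leb := (@lebesgue_measure R).
Local Notation "'N_ p [ f ]" := (Lnorm mu p%:E (EFin \o f)).

Lemma integral_lebesgueE (D : set (measurableTypeR R)) (h : R -> \bar R) :
  D `<=` `[0, L[%classic -> (\int[mu]_(x in D) h x = \int[leb]_(x in D) h x)%E.
Proof.
move=> DL; apply: eq_measure_integral => A mA AD.
by rewrite muE// setIidl//; exact: subset_trans DL.
Qed.

Lemma integralT_lebesgueE (h : R -> \bar R) : (forall x, (0 <= h x)%E) ->
  (\int[mu]_x h x = \int[leb]_(x in `[0%R, L[) h x)%E.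
Proof.
move=> h0; rewrite -integral_lebesgueE//.
rewrite [RHS]integral_mkcond; apply: ae_eq_lower_integral => //.
  by move=> x; rewrite /patch; case: ifP.
apply: (@filterS _ _ (ae_filter_ringOfSetsType mu)) (ae_in_domain muE) => x xL.
by rewrite /patch mem_set.
Qed.

Lemma integrable_lebesgueE f : mu.-integrable setT (EFin \o f) <->
  leb.-integrable `[0, L[ (EFin \o f) /\ measurable_fun setT f.
Proof.
split.
  move=> /integrableP[mf fi]; split; last by apply/measurable_EFinP.
  apply/integrableP; split; first exact: measurable_funS mf.
  by rewrite -integralT_lebesgueE.
move=> [/integrableP[_ fi] mf]; apply/integrableP; split.
  exact/measurable_EFinP.
by rewrite integralT_lebesgueE.
Qed.

(** Lebesgue differentiation takes a shrinking family at each real point; outside [0, L[ the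
    interval starting at [x] is a mere placeholder. *)
Lemma exists_cell_around (x : R) k : exists a : R,
  a <= x < a + mesh L k /\
  (`[0, L[%classic x -> exists2 i, (i < 2 ^ k)%N & a = i%:R * mesh L k).
Proof.
have [xL|xL] := pselect (`[0, L[%classic x); last first.
  by exists x; rewrite lexx ltrDl mesh_gt0.
have [i ik /cellP/andP[ix xi]] := cell_ex L0 k xL.
exists (i%:R * mesh L k); split; last by move=> _; exists i.
by rewrite ix/= (lt_le_trans xi)// -natr1 mulrDl mul1r.
Qed.

Lemma dyad_ae_cvg f : mu.-integrable setT (EFin \o f) ->
  {ae mu, forall x, dyad L mu k f x @[k --> \oo] --> f x}.
Proof.
move=> fi; have [fi' mf] := (integrable_lebesgueE f).1 fi.
pose f0 := f \_ (`[0, L[%classic : set R).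
have mD : measurable (`[0, L[%classic : set R) by exact: measurable_itv.
have loc : locally_integrable setT f0 by exact: integrable_locally_restrict.
have [N [mN N0 subN]] := lebesgue_differentiation loc.
pose a (x : R) k := sval (cid (exists_cell_around x k)).
have aP x k : a x k <= x < a x k + mesh L k /\
  (`[0, L[%classic x -> exists2 i, (i < 2 ^ k)%N & a x k = i%:R * mesh L k).
  by rewrite /a /sval; case: cid.
pose E (x : R) k := `[a x k, a x k + mesh L k[%classic : set R.
have mesh_cvg0 : mesh L k @[k --> \oo] --> (0 : R).
  have -> : mesh L = geometric L 2^-1.
    by apply/funext => k; rewrite /mesh /geometric/= exprVn.
  by apply: cvg_geometric; rewrite ger0_norm// invf_lt1// ltr1n.
have lebE x k : leb (E x k) = (mesh L k)%:E.
  rewrite lebesgue_measure_itv/= lte_fin ltrDl mesh_gt0// -EFinB.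
  by rewrite addrAC subrr add0r.
have shr x : nicely_shrinking x (E x).
  split; first by move=> k; exact: measurable_itv.
  (* The constant 2: an interval of length [mesh L k] around [x] lies in the ball of that radius,
     whose measure is twice the length. *)
  exists (2, fun k => PosNum (mesh_gt0 L0 k)); split => //=.
  - move=> k y; rewrite /E/= in_itv/= => /andP[ay ya].
    have [/andP[ax xa] _] := aP x k.
    by rewrite /ball/= ltr_distlC; apply/andP; split; lra.
  - move=> k; rewrite lebesgue_measure_ball ?mesh_ge0// lebE -EFinM lee_fin.
    by rewrite mulr_natl.
exists (N `|` ~` `[0, L[%classic); split.
- by apply: measurableU => //; exact: measurableC.
- rewrite muE; last by apply: measurableU => //; exact: measurableC.
  rewrite setIUl setICl setU0.
  apply/eqP; rewrite eq_le measure_ge0 andbT -[leRHS]N0.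
  by apply: le_measure; rewrite ?inE//; exact: measurableI.
move=> x /= nx; have [xL|xL] := pselect (`[0, L[%classic x); last by right.
left; apply: subN => /= lx; apply: nx.
have := nice_lebesgue_differentiation shr loc lx.
have -> : f0 x = f x by rewrite /f0 /patch mem_set.
move=> /fine_cvg; apply: cvg_trans; apply: near_eq_cvg.
apply: nearW => k /=.
have [i ik aE] := (aP x k).2 xL.
have EE : E x k = cell L k i.
  by rewrite /E aE /cell -natr1 mulrDl mul1r.
have xi : cell L k i x.
  by rewrite -EE /E/= in_itv/=; exact: (aP x k).1.
rewrite /dyad (stepfE _ _ _ xi)// /avg lebE EE inver gt_eqF ?mesh_gt0//.
have EI : (\int[leb]_(y in cell L k i) (f0 y)%:E = \int[mu]_(y in cell L k i) (f y)%:E)%E.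
  rewrite integral_lebesgueE; last exact: sub_cell.
  by apply: eq_integral => y; rewrite inE => /(sub_cell L0 ik) yL; rewrite /f0 /patch mem_set.
rewrite EI /Rintegral.
have fin : (\int[mu]_(y in cell L k i) (f y)%:E)%E \is a fin_num.
  by apply: integrable_fin_num => //; exact: integrable_cell.
by rewrite -[in LHS](fineK fin).
Qed.

(** Averaging does not increase the L^p norm and converges almost everywhere, which is exactly what
    the Scheffé argument asks for. *)
Lemma dyad_Lnorm_cvg p f : 1 <= p -> measurable_fun setT f ->
  ('N_p[f] < +oo)%E ->
  forall e : R, 0 < e -> \forall k \near \oo, ('N_p[(f \- dyad L mu k f)%R] <= e%:E)%E.
Proof.
move=> p1 mf fp; apply: ae_cvg_Lnorm_cvg => //.
- by move=> k; exact: measurable_dyad.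
- by move=> k; exact: Lnorm_dyad_le.
- by apply: dyad_ae_cvg; exact: (Lnorm_integrable L0 muE p1 mf fp).
Qed.

(** The left side may be infinite a priori: uniform bounds on the averages thus yield a bound on the
    norm itself. *)
Lemma dyad_Lnorm_fatou p f : 0 < p -> mu.-integrable setT (EFin \o f) ->
  ('N_p[f] <= limn_einf (fun k => 'N_p[dyad L mu k f]))%E.
Proof.
move=> p0 fi; apply: ae_cvg_Lnorm_fatou => //.
- by have [] := (integrable_lebesgueE f).1 fi.
- by move=> k; exact: measurable_dyad.
- exact: dyad_ae_cvg.
Qed.

Lemma ge0_lebesgue_integral_shift (s : R) (D : set (measurableTypeR R)) (h : R -> \bar R) :
  measurable D -> measurable_fun setT h -> (forall x, (0 <= h x)%E) ->
  (\int[leb]_(x in D) h x = \int[leb]_(x in (fun x => x + s)%R @^-1` D) h (x + s)%R)%E.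
Proof.
move=> mD mh h0.
have := @ge0_integral_pushforward _ _ _ _ _ _ (measurable_shift s) leb D h mD.
move=> <- //; last exact: measurable_funS mh.
apply: eq_measure_integral => //=; first exact: measurable_shift.
by move=> _ A mA _; apply: esym; exact: lebesgue_measure_shift.
Qed.

Lemma lebesgue_integrable_shift (s : R) (D : set (measurableTypeR R)) f :
  measurable D -> measurable_fun setT f -> leb.-integrable D (EFin \o f) ->
  leb.-integrable ((fun x => x + s) @^-1` D) (EFin \o (fun x => f (x + s))).
Proof.
move=> mD mf /integrableP[_ fi].
have mS : measurable ((fun x : measurableTypeR R => (x + s : measurableTypeR R)) @^-1` D).
  by rewrite -[X in measurable X]setTI; exact: measurable_shift.
apply/integrableP; split.
  apply/measurable_EFinP; apply: (@measurable_funS _ _ _ _ setT) => //.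
  exact: (measurableT_comp mf (measurable_shift s)).
rewrite -(@ge0_lebesgue_integral_shift s D (fun x => `|f x|%:E)) //.
by apply/measurable_EFinP; exact: measurableT_comp.
Qed.

Lemma lebesgue_integral_shift (s : R) (D : set (measurableTypeR R)) f :
  measurable D -> measurable_fun setT f -> leb.-integrable D (EFin \o f) ->
  (\int[leb]_(x in D) (f x)%:E = \int[leb]_(x in (fun x => x + s)%R @^-1` D) (f (x + s)%R)%:E)%E.
Proof.
move=> mD mf fi.
have := @integral_pushforward _ _ _ _ _ _ (measurable_shift s) leb D (EFin \o f).
move=> <- //; first last.
- exact: lebesgue_integrable_shift.
- exact/measurable_EFinP.
apply: eq_measure_integral => //=; first exact: measurable_shift.
by move=> _ A mA _; apply: esym; exact: lebesgue_measure_shift.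
Qed.

Lemma shift_cell k i :
  (fun x => x + mesh L k) @^-1` (cell L k i.+1) = cell L k i.
Proof.
have E1 : i.+1%:R * mesh L k = i%:R * mesh L k + mesh L k.
  by rewrite -natr1 mulrDl mul1r.
have E2 : i.+2%:R * mesh L k = i%:R * mesh L k + mesh L k + mesh L k.
  by rewrite -natr1 mulrDl mul1r E1.
apply/seteqP; split => x /=; rewrite /cell /= !in_itv/= E1 ?E2 => /andP[? ?];
  by apply/andP; split; lra.
Qed.

Lemma sum_double (F : nat -> R) n :
  \sum_(j < n.*2) F j = \sum_(i < n) (F i.*2 + F i.*2.+1).
Proof.
elim: n => [|n ih]; first by rewrite !big_ord0.
by rewrite doubleS !big_ord_recr/= ih addrA.
Qed.

Lemma avg_split k i f : mu.-integrable setT (EFin \o f) ->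
  avg L mu k i f = (avg L mu k.+1 i.*2 f + avg L mu k.+1 i.*2.+1 f) / 2.
Proof.
move=> fi; rewrite /avg (cellS L0) Rintegral_setU//; first last.
- apply/disj_setPS => x [xi xj]; exfalso.
  by move/eqP : (cell_inj L0 xi xj); rewrite ltn_eqF.
- rewrite -cellS//; exact: integrable_cell.
have := mesh_gt0 L0 k.+1; rewrite (meshS L k) => h0.
by field; rewrite gt_eqF.
Qed.

Lemma cell_half k j x : cell L k.+1 j x -> cell L k j./2 x.
Proof.
move=> xj; rewrite (cellS L0); move: xj; rewrite -{1}(odd_double_half j).
by case: (odd j) => /= xj; [right|left].
Qed.

(* The coarse average is the mean of the averages over the two halves of the
   cell, one of which is the translate of the other by [mesh L k.+1]. *)
Lemma dyad_increment k f : mu.-integrable setT (EFin \o f) ->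
  ('N_1[(dyad L mu k.+1 f \- dyad L mu k f)%R] <=
   \int[leb]_(t in `[0%R, (L - mesh L k.+1)%R]) `|f (t + mesh L k.+1) - f t|%:E)%E.
Proof.
move=> fi; have [fi' mf] := (integrable_lebesgueE f).1 fi.
set h := mesh L k.+1; have h0 : 0 < h by exact: mesh_gt0.
pose a j := avg L mu k.+1 j f.
pose c j := a j - avg L mu k j./2 f.
have -> : (dyad L mu k.+1 f \- dyad L mu k f)%R = stepf L k.+1 c.
  apply/funext => x /=; have [xL|xL] := pselect (`[0, L[%classic x); last first.
    by rewrite /dyad !(stepf_out L0)// subrr.
  have [j jk xj] := cell_ex L0 k.+1 xL.
  rewrite (stepfE L0 _ jk xj) /dyad (stepfE L0 _ jk xj).
  rewrite (@stepfE _ _ L0 k _ j./2)//; last exact: cell_half.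
  by rewrite -(ltn_pmul2r (isT : (0 < 2)%N)) -expnSr muln2 (leq_ltn_trans _ jk)// -{2}(odd_double_half j) leq_addl.
rewrite (Lnorm1_stepf L0 muE).
have mfs : measurable_fun setT (fun t : R => f (t + h)).
  exact: (measurableT_comp mf (measurable_shift h)).
have md : measurable_fun setT (fun t : R => `|f (t + h) - f t|%:E).
  by apply/measurable_EFinP; apply: measurableT_comp => //; exact: measurable_funB.
have le_cell i : (i < 2 ^ k)%N ->
    ((`|c i.*2| * h + `|c i.*2.+1| * h)%:E <=
     \int[leb]_(t in cell L k.+1 i.*2) `|f (t + h) - f t|%:E)%E.
  move=> ik.
  have ik2 : (i.*2.+1 < 2 ^ k.+1)%N by rewrite expnS mul2n ltn_Sdouble.
  have ik1 : (i.*2 < 2 ^ k.+1)%N by exact: ltn_trans ik2.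
  have sub0 := sub_cell L0 ik1; have sub1 := sub_cell L0 ik2.
  have fc0 : leb.-integrable (cell L k.+1 i.*2) (EFin \o f).
    by apply: integrableS fi'.
  have fc1 : leb.-integrable (cell L k.+1 i.*2.+1) (EFin \o f).
    by apply: integrableS fi'.
  have fcs : leb.-integrable (cell L k.+1 i.*2) (EFin \o (fun t => f (t + h))).
    by rewrite -shift_cell; exact: lebesgue_integrable_shift.
  (* The two halves deviate from the coarse average by opposite amounts, each half the difference of
     the fine averages. Their absolute sum times [h] is the absolute value of the integral of f(t +
     h) - f(t) over the left half. *)
  have E : `|c i.*2| * h + `|c i.*2.+1| * h =
      `|\int[leb]_(t in cell L k.+1 i.*2) (f (t + h) - f t)|.
    rewrite RintegralB//.
    have -> : \int[leb]_(t in cell L k.+1 i.*2) f (t + h) = h * a i.*2.+1.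
      rewrite /a /avg mulrA mulfV ?gt_eqF// mul1r /Rintegral integral_lebesgueE//.
      by rewrite [in RHS](lebesgue_integral_shift h)// shift_cell.
    have -> : \int[leb]_(t in cell L k.+1 i.*2) f t = h * a i.*2.
      by rewrite /a /avg mulrA mulfV ?gt_eqF// mul1r /Rintegral integral_lebesgueE.
    have c0 : c i.*2 = (a i.*2 - a i.*2.+1) / 2.
      by rewrite /c doubleK avg_split// -/(a _) -/(a _); field.
    have c1 : c i.*2.+1 = (a i.*2.+1 - a i.*2) / 2.
      by rewrite /c /= uphalf_double avg_split// -/(a _) -/(a _); field.
    rewrite c0 c1 !normrM (distrC (a i.*2)) normfV (@ger0_norm _ 2)//.
    have -> : `|h * a i.*2.+1 - h * a i.*2| = h * `|a i.*2.+1 - a i.*2|.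
      by rewrite -mulrBr normrM gtr0_norm.
    by rewrite -mulrDl -splitr mulrC.
  rewrite E EFin_normr_Rintegral//; last exact: integrableB_EFin.
  by apply: le_abse_integral => //; apply/measurable_EFinP; apply: (@measurable_funS _ _ _ _ setT) => //; exact: measurable_funB.
have -> : (\sum_(j < 2 ^ k.+1) `|c j| * mesh L k.+1)%:E =
    (\sum_(i < 2 ^ k) (`|c i.*2| * h + `|c i.*2.+1| * h)%:E)%E.
  by rewrite expnS mul2n (sum_double (fun j => `|c j| * h)) -sumEFin.
apply: le_trans (lee_sum _ _) _; first by move=> i _; exact: le_cell.
(* Left halves are disjoint, and each is followed by a right half of length [h], so they stay below
   [L - h]. *)
apply: (@sum_integral_le _ _ _ leb _ (fun i : 'I_(2 ^ k) => cell L k.+1 i.*2) `[0, L - h]%classic) => //.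
- move=> i x /cellP/andP[ix xi]; rewrite /= in_itv/=; apply/andP; split.
    by apply: le_trans ix; rewrite mulr_ge0// mesh_ge0.
  rewrite lerBrDr; apply: le_trans (_ : i.*2.+2%:R * h <= _).
    by rewrite -[X in _ <= X * _]natr1 mulrDl mul1r lerD2r ltW.
  rewrite -(mesh_total L k.+1) ler_pM2r// ler_nat expnS mul2n -doubleS leq_double.
  exact: ltn_ord.
- move=> i j _ _ [x [xi xj]]; apply: val_inj => /=.
  by apply: double_inj; exact: cell_inj xi xj.
Qed.

(** Telescoping: the first n increments from level [k] add up to at most b rho^k (1 - rho^n) / (1 -
    rho), and level k + n approximates [f] arbitrarily well in L^1. *)
Lemma dyad_error_geometric k0 f (b rho : R) : mu.-integrable setT (EFin \o f) ->
  0 <= b -> 0 < rho < 1 ->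
  (forall j, (k0 <= j)%N ->
    ('N_1[(dyad L mu j.+1 f \- dyad L mu j f)%R] <= (b * rho ^+ j)%:E)%E) ->
  forall k, (k0 <= k)%N ->
    ('N_1[(f \- dyad L mu k f)%R] <= (b * rho ^+ k / (1 - rho))%:E)%E.
Proof.
move=> fi b0 /andP[r0 r1] hj k k0k; have [fi' mf] := (integrable_lebesgueE f).1 fi.
have md j : measurable_fun setT (dyad L mu j f) by exact: measurable_dyad.
have tel n : ('N_1[(dyad L mu (k + n) f \- dyad L mu k f)%R] <=
    (b * rho ^+ k * (1 - rho ^+ n) / (1 - rho))%:E)%E.
  elim: n => [|n ih].
    rewrite addn0 (_ : _ \- _ = cst 0); last by apply/funext => x /=; rewrite subrr.
    by rewrite expr0 subrr mulr0 mul0r (_ : EFin \o cst 0 = cst 0%E)// Lnorm0.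
  rewrite (_ : _ \- _ = (dyad L mu (k + n).+1 f \- dyad L mu (k + n) f) \+
     (dyad L mu (k + n) f \- dyad L mu k f)); last first.
    by apply/funext => x /=; rewrite addnS addrA subrK.
  apply: le_trans (eminkowski mu (measurable_funB (md _) (md _)) (measurable_funB (md _) (md _)) _) _ => //.
  apply: le_trans (leeD (hj _ _) ih) _; first by rewrite (leq_trans k0k)// leq_addr.
  rewrite -EFinD lee_fin exprD exprS.
  rewrite le_eqVlt; apply/orP; left; apply/eqP; field.
  by rewrite subr_eq0 gt_eqF.
apply/lee_addgt0Pr => e e0.
have fp : ('N_1[f] < +oo)%E.
  by rewrite Lnorm1; case/integrableP : fi.
have [n _ Hn] := dyad_Lnorm_cvg (lexx 1) mf fp e0.
rewrite (_ : f \- dyad L mu k f = (f \- dyad L mu (k + n) f) \+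
   (dyad L mu (k + n) f \- dyad L mu k f)); last first.
  by apply/funext => x /=; rewrite addrA subrK.
apply: le_trans (eminkowski mu (measurable_funB mf (md _)) (measurable_funB (md _) (md _)) _) _ => //.
rewrite addeC; apply: leeD; last by apply: Hn; rewrite /= leq_addl.
apply: le_trans (tel n) _; rewrite lee_fin ler_pM2r ?invr_gt0 ?subr_gt0//.
rewrite ler_piMr//; first by rewrite mulr_ge0// exprn_ge0// ltW.
by rewrite lerBlDr lerDl exprn_ge0// ltW.
Qed.

End dyadic_convergence.

(** * Smooth approximation of arc indicators *)

Section smooth_approximation.
Context {R : realType}.
Implicit Types c s x : R.

(** A logistic function of n (cos(x - c) - s): smooth and 2 pi periodic, it tends to 1 where cos(x -
    c) > s, an arc centred at [c], and to 0 where cos(x - c) < s. *)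
Definition bump (n : nat) (c s x : R) : R :=
  (1 + expR (n%:R * (s - cos (x - c))))^-1.

(** The logistic function y satisfies y' = y (1 - y), so the algebra generated by the constants, the
    shifted cosine and sine and the bump is stable under differentiation. Smoothness follows by
    induction, without a formula for higher derivatives. *)
Inductive bump_algebra (n : nat) (c s : R) : (R -> R) -> Prop :=
| bump_algebra_cst r : bump_algebra n c s (cst r)
| bump_algebra_cos : bump_algebra n c s (fun x => cos (x - c))
| bump_algebra_sin : bump_algebra n c s (fun x => sin (x - c))
| bump_algebra_bump : bump_algebra n c s (bump n c s)
| bump_algebraD f g : bump_algebra n c s f -> bump_algebra n c s g ->
    bump_algebra n c s (f + g)
| bump_algebraM f g : bump_algebra n c s f -> bump_algebra n c s g ->
    bump_algebra n c s (f * g).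

Let den_gt0 n c s x : 0 < 1 + expR (n%:R * (s - cos (x - c))).
Proof. by rewrite addr_gt0// expR_gt0. Qed.

Let is_derive1_eq (f : R -> R) x (a b : R) :
  is_derive x 1 f a -> a = b -> is_derive x 1 f b.
Proof. by move=> h <-. Qed.

Lemma is_derive_subr c x : is_derive x 1 (fun y : R => y - c) 1.
Proof. by apply: is_derive_eq; rewrite subr0. Qed.

Lemma bump_algebra_derive n c s f : bump_algebra n c s f ->
  exists2 f', bump_algebra n c s f' & forall x, is_derive x 1 f (f' x).
Proof.
elim=> [r||||g h _ [g' bg' dg] _ [h' bh' dh]|g h bg [g' bg' dg] bh [h' bh' dh]].
- by exists (cst 0); [exact: bump_algebra_cst|move=> x; exact: is_derive_cst].
- exists (cst (-1) * (fun x => sin (x - c))).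
    by apply: bump_algebraM; [exact: bump_algebra_cst|exact: bump_algebra_sin].
  move=> x; have := @is_derive1_comp R (@cos R) (fun y => y - c) x _ _ (is_derive_cos (x - c)) (is_derive_subr c x).
  by move=> /is_derive1_eq; apply; rewrite /= mulr1 [RHS]mulN1r.
- exists (fun x => cos (x - c)); first exact: bump_algebra_cos.
  move=> x; have := @is_derive1_comp R (@sin R) (fun y => y - c) x _ _ (is_derive_sin (x - c)) (is_derive_subr c x).
  by move=> /is_derive1_eq; apply; rewrite /= mulr1.
- exists (cst (- n%:R) * (fun x => sin (x - c)) * (bump n c s * (cst 1 + cst (-1) * bump n c s))).
    do ![apply: bump_algebraM|apply: bump_algebraD|exact: bump_algebra_cst|
       exact: bump_algebra_sin|exact: bump_algebra_bump].
  move=> x.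
  have dcos : is_derive x 1 (fun y : R => cos (y - c)) (- sin (x - c)).
    have := @is_derive1_comp R (@cos R) (fun y => y - c) x _ _ (is_derive_cos (x - c)) (is_derive_subr c x).
    by move=> /is_derive1_eq; apply; rewrite /= mulr1.
  have darg : is_derive x 1 (fun y : R => n%:R * (s - cos (y - c))) (n%:R * sin (x - c)).
    by apply: is_derive_eq; rewrite /GRing.scale/=; ring.
  have dexp := @is_derive1_comp R (@expR R) _ x _ _ (is_derive_expR _) darg.
  have dden : is_derive x 1 (fun y : R => 1 + expR (n%:R * (s - cos (y - c))))
      (expR (n%:R * (s - cos (x - c))) * (n%:R * sin (x - c))).
    by apply: is_derive_eq; rewrite /GRing.scale/=; ring.
  have := @is_deriveV R _ x _ 1 _ dden.
  rewrite gt_eqF ?den_gt0// => /(_ isT) /is_derive1_eq; apply.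
  have := den_gt0 n c s x; rewrite /bump /= => d0.
  have d1 : 1 + expR (n%:R * (s - cos (x - c))) != 0 by rewrite gt_eqF.
  rewrite -[RHS]/(- n%:R * sin (x - c) * (bump n c s x * (1 + -1 * bump n c s x))).
  rewrite /GRing.scale/= /bump.
  move: (expR _) d1 => y d1; field.
  exact: d1.
- exists (g' + h'); first exact: bump_algebraD.
  by move=> x; exact: is_deriveD.
- exists (g * h' + h * g').
    by apply: bump_algebraD; apply: bump_algebraM.
  by move=> x; exact: is_deriveM.
Qed.

Lemma bump_algebra_derive1n n c s f k : bump_algebra n c s f ->
  bump_algebra n c s (derive1n k f).
Proof.
move=> bf; elim: k => [//|k ih]; rewrite derive1nS.
have [f' bf' df] := bump_algebra_derive ih.
suff -> : (derive1n k f)^`()%classic = f' by [].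
by apply/funext => x; rewrite derive1E; have := df x => /@derive_val.
Qed.

Lemma bump_smooth n c s : smooth_circle (bump n c s).
Proof.
split.
  move=> x; rewrite /bump; congr (_ ^-1); congr (1 + expR (_ * (_ - _))).
  by rewrite mulr_natl addrAC cosD2pi.
move=> k x; have := bump_algebra_derive1n k (bump_algebra_bump n c s).
by move=> /bump_algebra_derive[f' _ df]; have := df x => /@ex_derive.
Qed.

Lemma measurable_bump n c s : measurable_fun setT (bump n c s).
Proof.
apply: continuous_measurable_fun => x.
have [_ /(_ 0%N x)] := bump_smooth n c s.
by move=> /derivable1_diffP/differentiable_continuous.
Qed.

Lemma bump_ge0 n c s x : 0 <= bump n c s x.
Proof. by rewrite invr_ge0 ltW. Qed.

Lemma bump_le1 n c s x : bump n c s x <= 1.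
Proof. by rewrite invf_le1// lerDl expR_ge0. Qed.

Let logistic_le (z : R) : 0 <= z -> (1 + expR z)^-1 <= (1 + z)^-1.
Proof.
move=> z0; have := expR_gt0 z; have := expR_ge1Dx z => e1 e0.
by rewrite lef_pV2 ?posrE; lra.
Qed.

Lemma bump_lt n c s x : cos (x - c) < s ->
  bump n c s x <= (1 + n%:R * (s - cos (x - c)))^-1.
Proof. by move=> cs; apply: logistic_le; rewrite mulr_ge0// subr_ge0 ltW. Qed.

Lemma bump_gt n c s x : s < cos (x - c) ->
  1 - bump n c s x <= (1 + n%:R * (cos (x - c) - s))^-1.
Proof.
move=> cs; have -> : 1 - bump n c s x = (1 + expR (n%:R * (cos (x - c) - s)))^-1.
  rewrite /bump -[X in n%:R * X]opprB mulrN expRN.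
  have := expR_gt0 (n%:R * (cos (x - c) - s)); move: (expR _) => y y0.
  by field; rewrite !gt_eqF// addr_gt0.
by apply: logistic_le; rewrite mulr_ge0// subr_ge0 ltW.
Qed.

Lemma cvg_harmonic_scaled (z : R) : 0 < z ->
  (1 + n%:R * z)^-1 @[n --> \oo] --> (0 : R).
Proof.
move=> z0; apply/cvgrPdist_le => e e0.
near=> n; rewrite sub0r normrN ger0_norm; last first.
  by rewrite invr_ge0 addr_ge0// mulr_ge0// ltW.
rewrite invf_ple ?posrE//; last by apply: ltr_pwDl => //; rewrite mulr_ge0// ltW.
apply: le_trans (_ : n%:R * z <= _); last by rewrite lerDr.
by rewrite -ler_pdivrMr//; near: n; exact: nbhs_infty_ger.
Unshelve. all: by end_near. Qed.

(** With [c] the midpoint and [r] the half length, the arc is |x - c| < r, and the cosine decreases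
    on [0, pi]. Outside, r < |x - c| < 2 pi - r; if |x - c| exceeds pi, reflecting y to 2 pi - y
    returns to [0, pi]. At the endpoints the bump equals 1/2 for every n, hence their exclusion. *)
Lemma bump_cvg (a b x : R) : 0 <= a -> a < b -> b <= 2 * pi ->
  0 < x < 2 * pi -> x != a -> x != b ->
  bump n ((a + b) / 2) (cos ((b - a) / 2)) x @[n --> \oo] -->
  (\1_(`[a, b[%classic) x : R).
Proof.
move=> a0 ab bpi /andP[x0 xpi] xa xb.
set c := (a + b) / 2; set r := (b - a) / 2.
have r0 : 0 < r by rewrite divr_gt0// subr_gt0.
have rpi : r <= pi by rewrite /r; lra.
have dec y z : 0 <= y -> z <= pi -> y < z -> cos z < cos y :> R.
  move=> y0 zpi yz; rewrite ltr_cos// in_itv/=.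
    by rewrite y0/= ltW// (lt_le_trans yz).
  by rewrite zpi andbT ltW// (le_lt_trans y0).
have [xin|xout] := boolP (a < x < b).
  have -> : \1_(`[a, b[%classic) x = 1 :> R.
    by rewrite indicE mem_set//= in_itv/=; move: xin => /andP[/ltW -> ->].
  have d : 0 < cos (x - c) - cos r.
    rewrite subr_gt0 -(cos_norm (x - c)); apply: dec => //.
    by rewrite ltr_norml /c /r; move: xin => /andP[? ?]; apply/andP; split; lra.
  apply/cvgrPdist_le => e e0; have /cvgrPdist_le/(_ _ e0) := cvg_harmonic_scaled d.
  apply: filterS => n; rewrite sub0r normrN; apply: le_trans.
  rewrite ger0_norm ?subr_ge0 ?bump_le1//; apply: le_trans (ler_norm _).
  by apply: bump_gt; rewrite -subr_gt0.
have -> : \1_(`[a, b[%classic) x = 0 :> R.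
  rewrite indicE memNset//= in_itv/= le_eqVlt eq_sym (negbTE xa)/=.
  exact/negP.
have d : 0 < cos r - cos (x - c).
  rewrite subr_gt0 -(cos_norm (x - c)); set y := `|x - c|.
  have /andP[ry yr] : r < y < 2 * pi - r.
    rewrite /y; have [xlt|xgt] := ltP x a.
      rewrite ltr0_norm; last by rewrite /c; lra.
      by rewrite /c /r; apply/andP; split; lra.
    have {}xgt : b < x.
      move: xout; rewrite negb_and -!leNgt; case/orP => [xle|].
        by move: xa; rewrite eq_le xle xgt.
      by rewrite le_eqVlt eq_sym (negbTE xb).
    rewrite gtr0_norm; last by rewrite /c; lra.
    by rewrite /c /r; apply/andP; split; lra.
  have [ypi|ypi] := leP y pi; first by apply: dec => //; exact: ltW.
  have -> : cos y = cos (2 * pi - y).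
    by rewrite -[RHS]cosN opprB -[RHS]cosD2pi mulr_natl subrK.
  by apply: dec; [exact: ltW|lra|lra].
apply/cvgrPdist_le => e e0; have /cvgrPdist_le/(_ _ e0) := cvg_harmonic_scaled d.
apply: filterS => n; rewrite !sub0r !normrN; apply: le_trans.
rewrite ger0_norm ?bump_ge0//; apply: le_trans (ler_norm _).
by apply: bump_lt; rewrite -subr_gt0.
Qed.

End smooth_approximation.

(** * Pairings and weakly measurable fields *)

Section pairing_tools.
Context {R : realType} (L : R) (mu : {measure set (measurableTypeR R) -> \bar R}).
Hypothesis L0 : 0 < L.
Hypothesis muE : forall A : set (measurableTypeR R), measurable A ->
  mu A = lebesgue_measure (A `&` `[0, L[%classic).
Variables p q : R.
Hypothesis p1 : 1 < p.
Hypothesis q1 : 1 < q.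
Hypothesis pq : p^-1 + q^-1 = 1.
Implicit Types (f g phi : R -> R) (k i j : nat).
Local Notation "'N_ p [ f ]" := (Lnorm mu p%:E (EFin \o f)).

Let p0 : 0 < p. Proof. exact: lt_trans p1. Qed.
Let q0 : 0 < q. Proof. exact: lt_trans q1. Qed.

Definition in_Lp (r : R) f := measurable_fun setT f /\ ('N_r[f] < +oo)%E.

Lemma in_LpB r f g : 1 <= r -> in_Lp r f -> in_Lp r g -> in_Lp r (fun x => f x - g x).
Proof.
move=> r1 [mf ff] [mg fg]; split; first exact: measurable_funB.
have mN : measurable_fun setT (fun x => - g x) by exact: measurableT_comp.
apply: le_lt_trans (eminkowski mu mf mN _) _; first by rewrite lee_fin.
rewrite lte_add_pinfty//.
by have := oppe_Lnorm mu (EFin \o g) r%:E; rewrite /comp /= => ->.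
Qed.

Lemma in_Lp_dyad r k f : 1 <= r -> in_Lp r f -> in_Lp r (dyad L mu k f).
Proof.
move=> r1 [mf ff]; split; first exact: measurable_dyad.
by apply: le_lt_trans ff; exact: Lnorm_dyad_le.
Qed.

Lemma in_Lp_integrable r f : 1 <= r -> in_Lp r f -> mu.-integrable setT (EFin \o f).
Proof. by move=> r1 [mf ff]; exact: (Lnorm_integrable L0 muE r1 mf ff). Qed.

Lemma in_Lp_bounded r f (C : R) : 1 <= r -> measurable_fun setT f ->
  (forall x, `|f x| <= C) -> in_Lp r f.
Proof.
move=> r1 mf fC; split => //; have r0 : 0 < r by exact: lt_le_trans r1.
apply/Lnorm_lty => //.
have C0 : 0 <= C by apply: le_trans (fC 0).
apply: (@le_lt_trans _ _ (\int[mu]_x (cst (C `^ r)%:E x))%E).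
  apply: ge0_le_lower_integral => x; rewrite lee_fin ?powR_ge0//.
  by apply: ge0_ler_powR; rewrite ?nnegrE// ltW.
rewrite integral_cst// muE// setTI lebesgue_measure_itv/= lte_fin L0 -EFinB -EFinM.
exact: ltry.
Qed.

Lemma in_Lp_indic_cell r k i : 1 <= r -> in_Lp r (\1_(cell L k i)).
Proof.
move=> r1; apply: (@in_Lp_bounded _ _ 1) => //.
by move=> x; rewrite indicE; case: (_ \in _); rewrite ?normr1 ?normr0.
Qed.

(** For [circle] this is [pairing]; the version for a general measure is also applied to [time T],
    for Hölder estimates in time. *)
Definition pair phi f : R := \int[mu]_x (phi x * f x).

Lemma pair_integrable phi f : in_Lp q phi -> in_Lp p f ->
  mu.-integrable setT (EFin \o (fun x => phi x * f x)).
Proof.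
move=> [mphi fphi] [mf ff]; apply/integrableP; split.
  by apply/measurable_EFinP; exact: measurable_funM.
have := hoelder mu mphi mf q0 p0; rewrite addrC pq => /(_ erefl) h.
rewrite -Lnorm1; apply: le_lt_trans h _.
by rewrite lte_mul_pinfty ?Lnorm_ge0// ge0_fin_numE ?Lnorm_ge0.
Qed.

Lemma pair_le phi f : in_Lp q phi -> in_Lp p f ->
  (`|pair phi f|%:E <= 'N_q[phi] * 'N_p[f])%E.
Proof.
move=> Lphi Lf; have int := pair_integrable Lphi Lf.
have [[mphi fphi] [mf ff]] := (Lphi, Lf).
have := hoelder mu mphi mf q0 p0; rewrite addrC pq => /(_ erefl).
apply: le_trans; rewrite /pair EFin_normr_Rintegral// Lnorm1.
by apply: le_abse_integral => //; case/integrableP : int.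
Qed.

Lemma pairBr phi f g : in_Lp q phi -> in_Lp p f -> in_Lp p g ->
  pair phi (fun x => f x - g x) = pair phi f - pair phi g.
Proof.
move=> Lphi Lf Lg; rewrite /pair -RintegralB//; try exact: pair_integrable.
by apply: eq_Rintegral => x _; rewrite mulrBr.
Qed.

Lemma pairBl phi psi f : in_Lp q phi -> in_Lp q psi -> in_Lp p f ->
  pair (fun x => phi x - psi x) f = pair phi f - pair psi f.
Proof.
move=> Lphi Lf Lg; rewrite /pair -RintegralB//; try exact: pair_integrable.
by apply: eq_Rintegral => x _; rewrite mulrBl.
Qed.

Lemma pair_ae phi f g : measurable_fun setT phi -> measurable_fun setT f ->
  measurable_fun setT g -> {ae mu, forall x, f x = g x} -> pair phi f = pair phi g.
Proof.
move=> mphi mf mg fg; rewrite /pair /Rintegral; congr fine.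
apply: ae_eq_integral => //.
- by apply/measurable_EFinP; exact: measurable_funM.
- by apply/measurable_EFinP; exact: measurable_funM.
by apply: (@filterS _ _ (ae_filter_ringOfSetsType mu)) fg => x -> _.
Qed.

Lemma pair_indic_cell k i f : pair (\1_(cell L k i)) f = mesh L k * avg L mu k i f.
Proof.
rewrite /avg mulrA mulfV ?gt_eqF ?mesh_gt0// mul1r Rintegral_mkcond /pair.
apply: eq_Rintegral => x _; rewrite indicE /patch.
by case: (x \in _); rewrite ?mul1r ?mul0r.
Qed.

(** The pairing of [f] with the level [k] averages of [phi]: it sees [f] through finitely many cell
    averages, so measurability and convergence of averages pass to it. *)
Definition dyad_pair k phi f : R :=
  \sum_(i < 2 ^ k) avg L mu k i phi * (mesh L k * avg L mu k i f).

Lemma pair_dyadl k phi f : in_Lp p f -> pair (dyad L mu k phi) f = dyad_pair k phi f.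
Proof.
move=> Lf; rewrite /pair /dyad_pair.
transitivity (\int[mu]_x (\sum_(i < 2 ^ k) avg L mu k i phi * (\1_(cell L k i) x * f x))).
  apply: eq_Rintegral => x _; rewrite /dyad /stepf mulr_suml.
  by apply: eq_bigr => i _; rewrite mulrA.
have int i : mu.-integrable setT (EFin \o (fun x => \1_(cell L k i) x * f x)).
  by apply: pair_integrable => //; apply: in_Lp_indic_cell; exact: ltW.
rewrite /Rintegral; under eq_integral do rewrite -sumEFin.
rewrite integral_sum//; last by move=> i; exact: integrableZ_EFin.
have E i : (\int[mu]_x (avg L mu k i phi * (\1_(cell L k i) x * f x))%:E)%E =
   (avg L mu k i phi * (mesh L k * avg L mu k i f))%:E.
  rewrite -pair_indic_cell /pair -RintegralZl// /Rintegral fineK//.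
  by apply: integrable_fin_num => //; exact: integrableZ_EFin.
by under eq_bigr do rewrite E; rewrite sumEFin.
Qed.

(** The whole error sits on [phi], so one level [k] works for all [f] in a bounded set. This is the
    form in which density of dyadic step functions is used. *)
Lemma pair_dyad_le k phi f : in_Lp q phi -> in_Lp p f ->
  (`|pair phi f - dyad_pair k phi f|%:E <=
   'N_q[(phi \- dyad L mu k phi)%R] * 'N_p[f])%E.
Proof.
move=> Lphi Lf; have Ld := in_Lp_dyad k (ltW q1) Lphi.
rewrite -pair_dyadl// -pairBl//; apply: pair_le => //.
exact: in_LpB (ltW q1) _ _.
Qed.

Lemma dyad_pair_cvg phi f : in_Lp q phi -> in_Lp p f ->
  dyad_pair k phi f @[k --> \oo] --> pair phi f.
Proof.
move=> Lphi Lf; apply/cvgrPdist_le => e e0.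
have fN : 'N_p[f] \is a fin_num by rewrite ge0_fin_numE ?Lnorm_ge0//; case: Lf.
set M := fine 'N_p[f]; have M0 : 0 <= M by rewrite fine_ge0// Lnorm_ge0.
have eM : 0 < e / (M + 1) by rewrite divr_gt0// ltr_pwDr.
have := dyad_Lnorm_cvg L0 muE (ltW q1) Lphi.1 Lphi.2 eM.
apply: filterS => k hk; rewrite -lee_fin; apply: le_trans (pair_dyad_le k Lphi Lf) _.
apply: le_trans (lee_wpmul2r _ hk) _; first exact: Lnorm_ge0.
rewrite -(fineK fN) -/M -EFinM lee_fin -mulrA ler_piMr ?ltW//.
by rewrite mulrC ltr_pdivrMr ?ltr_pwDr// mul1r ltrDl.
Qed.

End pairing_tools.

Section circle_and_time.
Context {R : realType}.
Local Notation tau := (2 * pi : R).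

Lemma tau_gt0 : 0 < tau. Proof. by rewrite mulr_gt0// pi_gt0. Qed.

Lemma circleE (A : set (measurableTypeR R)) : measurable A ->
  @circle R A = lebesgue_measure (A `&` `[0, tau[%classic).
Proof. by []. Qed.

(** The endpoint T is a null set; removing it gives the half-open interval that the cells
    partition. *)
Lemma timeE (T : R) (A : set (measurableTypeR R)) : 0 < T -> measurable A ->
  time T A = lebesgue_measure (A `&` `[0, T[%classic).
Proof.
move=> T0 mA; rewrite /time /= /mrestr.
have mo : measurable (`[0, T[%classic : set (measurableTypeR R)) by exact: measurable_itv.
have mc := @measurable_time R T.
apply/eqP; rewrite eq_le; apply/andP; split; last first.
  apply: le_measure; rewrite ?inE; [exact: measurableI|exact: measurableI|].
  by apply: setIS => x /=; rewrite !in_itv/= => /andP[-> /ltW ->].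
have m1 : measurable ([set T] : set (measurableTypeR R)) by exact: measurable_set1.
pose B := (A `&` `[0, T[%classic) `|` [set T] : set (measurableTypeR R).
apply: (@le_trans _ _ (lebesgue_measure B)).
  apply: le_measure; rewrite ?inE; [exact: measurableI| |].
    by apply: measurableU => //; exact: measurableI.
  move=> x [Ax]; rewrite /= in_itv/= => /andP[x0]; rewrite le_eqVlt => /orP[/eqP ->|xT].
    by right.
  by left; split => //=; rewrite in_itv/= x0.
apply: le_trans (measureU2 _ _ _) _ => //; first exact: measurableI.
by have := lebesgue_measure_set1 T => /= ->; rewrite adde0.
Qed.

Definition dual_exponent (p : R) : R := p / (p - 1).

Lemma hoelder_conjugate_EFin (p : R) : 1 < p ->
  hoelder_conjugate p%:E = (dual_exponent p)%:E.
Proof.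
move=> p1; rewrite /hoelder_conjugate/= eqe gt_eqF ?(lt_trans ltr01)//.
by rewrite -EFinD inver subr_eq0 gt_eqF.
Qed.

Lemma dual_exponent_gt1 (p : R) : 1 < p -> 1 < dual_exponent p.
Proof.
move=> p1; rewrite /dual_exponent ltr_pdivlMr ?subr_gt0// mul1r.
by rewrite ltrBlDr ltrDl.
Qed.

Lemma dual_exponent_conj (p : R) : 1 < p -> p^-1 + (dual_exponent p)^-1 = 1.
Proof.
move=> p1; have p0 : p != 0 by rewrite gt_eqF// (lt_trans ltr01).
rewrite /dual_exponent; field; rewrite p0 /=.
by rewrite subr_eq0 gt_eqF.
Qed.

End circle_and_time.

Section Lq_functions.
Context {R : realType} (p2 : R) (hp2 : 1 < p2).
Local Notation mu := (@circle R).

Lemma Lq_in_Lp (c : Lq hp2) : in_Lp mu p2 c.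
Proof.
split; last exact: Lebesgue_finite.
exact: (@measurable_funPT _ _ _ _ (repr (c : {mfun_ mu, measurableTypeR R >-> measurableTypeR R}))).
Qed.

Lemma Lq_of_function (f : R -> R) : in_Lp mu p2 f ->
  exists c : Lq hp2, {ae mu, forall x, c x = f x}.
Proof.
move=> [mf ff].
pose f1 : {mfun measurableTypeR R >-> measurableTypeR R} :=
  HB.pack f (isMeasurableFun.Build _ _ (measurableTypeR R) (measurableTypeR R) f mf).
pose c0 : {mfun_ mu, measurableTypeR R >-> measurableTypeR R} := (\pi_({mfun_ mu, measurableTypeR R >-> measurableTypeR R}) f1)%qT.
have c0E : {ae mu, forall x, c0 x = f x}.
  have /eqmodP/= : (repr c0 = f1 %[mod {mfun_ mu, measurableTypeR R >-> measurableTypeR R}])%qT.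
    by rewrite reprK.
  move=> /asboolP.
  by apply: (@filterS _ _ (ae_filter_ringOfSetsType mu)) => x /(_ I).
have c0fin : finite_norm mu p2%:E c0.
  rewrite /finite_norm (@ae_eq_Lnorm _ _ _ mu p2 _ (EFin \o f))//.
  by apply: (@filterS _ _ (ae_filter_ringOfSetsType mu)) c0E => x /= ->.
pose c : LspaceType mu (lt1_le1e hp2) :=
  HB.pack c0 (isFinLebesgue.Build _ _ _ mu p2%:E (lt1_le1e hp2) c0 c0fin).
by exists c.
Qed.

End Lq_functions.

(** * Everywhere defined representatives with measurable averages *)

Section fields.
Context {R : realType} (p2 : R).
Hypothesis hp2 : 1 < p2.
Local Notation tau := (2 * pi : R).
Local Notation mu := (@circle R).
Local Notation q := (dual_exponent p2).
Local Notation "'N_ p [ f ]" := (Lnorm mu p%:E (EFin \o f)).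

Let tau0 : 0 < tau. Proof. exact: tau_gt0. Qed.
Let q1 : 1 < q. Proof. exact: dual_exponent_gt1. Qed.
Let pq : p2^-1 + q^-1 = 1. Proof. exact: dual_exponent_conj. Qed.

(* Weak measurability in time is only required for the dyadic averages in
   space: they determine the pairings with all of [L^q]. *)
Definition Lp_field (u : R -> R -> R) : Prop :=
  (forall t, in_Lp mu p2 (u t)) /\
  (forall k i, measurable_fun setT (fun t => avg tau mu k i (u t))).

Lemma avg_le_Lnorm k i (f : R -> R) : in_Lp mu p2 f ->
  (`|mesh tau k * avg tau mu k i f|%:E <= 'N_q[\1_(cell tau k i)] * 'N_p2[f])%E.
Proof.
move=> Lf; rewrite -(@pair_indic_cell _ tau)//; apply: (pair_le hp2 q1 pq) => //.
by apply: (in_Lp_indic_cell tau0 circleE); exact: ltW.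
Qed.

Lemma cvg_avg k i (f : nat -> R -> R) (g : R -> R) :
  (forall n, in_Lp mu p2 (f n)) -> in_Lp mu p2 g ->
  (Lnorm mu p2%:E (fun x => (f n x - g x)%:E) @[n --> \oo] --> 0)%E ->
  avg tau mu k i (f n) @[n --> \oo] --> avg tau mu k i g.
Proof.
move=> Lf Lg /Lnorm_cvg0P cv; apply/cvgrPdist_le => e e0.
have [_ cfin] := in_Lp_indic_cell tau0 circleE k i (ltW q1).
have cN : 'N_q[\1_(cell tau k i)] \is a fin_num by rewrite ge0_fin_numE ?Lnorm_ge0.
set M := fine 'N_q[\1_(cell tau k i)]; have M0 : 0 <= M by rewrite fine_ge0// Lnorm_ge0.
have h0 := mesh_gt0 tau0 k.
have M1 : 0 < M + 1 by exact: ltr_pwDr.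
have eM : 0 < e * mesh tau k / (M + 1) by apply: divr_gt0 => //; exact: mulr_gt0.
have p20 : 0 < p2 by exact: lt_trans hp2.
apply: filterS (cv p20 _ eM) => n hn.
have Ld : in_Lp mu p2 (fun x => f n x - g x) by apply: in_LpB => //; exact: ltW.
have := avg_le_Lnorm k i Ld; rewrite -(fineK cN) -/M => h.
have {}h : (`|mesh tau k * avg tau mu k i (fun x => f n x - g x)|%:E <=
    M%:E * (e * mesh tau k / (M + 1))%:E)%E.
  by apply: le_trans h _; apply: lee_wpmul2l.
move: h; rewrite avgB; [|exact: (in_Lp_integrable tau0 circleE (ltW hp2))..].
rewrite -EFinM lee_fin normrM gtr0_norm// distrC => h.
rewrite -(ler_pM2l h0); apply: le_trans h _.
rewrite mulrA ler_pdivrMr//; have := mulr_gt0 h0 e0; move: (mesh _ _) => h; nra.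
Qed.

Variable T : R.

Lemma measurable_simple_map (s : R -> Lq hp2) (g : Lq hp2 -> R) :
  simple_map s -> measurable_fun setT (g \o s).
Proof.
move=> [fs ms] _ B mB; rewrite setTI.
have -> : (g \o s) @^-1` B = \bigcup_(c in range s `&` [set c | B (g c)]) (s @^-1` [set c]).
  apply/seteqP; split => t /=.
    by move=> Bt; exists (s t) => //; split => //; exists t.
  by move=> [c [_ Bc]] /= ->.
apply: fin_bigcup_measurable => //; first exact: finite_setIl.
by move=> c _; exact: ms.
Qed.

(** Setting the field to 0 on a measurable null set that contains all times where the simple
    approximations fail makes each dyadic average an everywhere limit of measurable functions of
    time. *)
Lemma strongly_measurable_field (z : R -> Lq hp2) : strongly_measurable T z ->
  exists2 u, Lp_field u & {ae time T, forall t, u t = z t}.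
Proof.
move=> [s [ss [N [mN N0 cvN]]]].
pose u t : R -> R := if t \in N then cst 0 else z t.
have u0 t : t \in N -> u t = cst 0 by rewrite /u => ->.
have uz t : t \notin N -> u t = z t by rewrite /u => /negbTE ->.
have Lu t : in_Lp mu p2 (u t).
  have [tN|tN] := boolP (t \in N); last by rewrite uz//; exact: Lq_in_Lp.
  rewrite u0//; apply: (@in_Lp_bounded _ _ _ tau0 circleE _ _ 0) => //; first exact: ltW.
  by move=> x; rewrite normr0.
exists u; last first.
  exists N; split => // t /= ut; apply: contrapT => tN; apply: ut.
  by apply: uz; rewrite notin_setE.
split => // k i.
pose v n t := \1_(~` N) t * avg tau mu k i (s n t).
apply: (@measurable_fun_cvg _ _ _ _ v).
  move=> n; apply: measurable_funM.
    by apply: measurable_indic; exact: measurableC.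
  exact: (measurable_simple_map (fun c : Lq hp2 => avg tau mu k i c) (ss n)).
move=> t _; rewrite /v; have [tN|tN] := boolP (t \in N).
  rewrite u0//.
  have -> : avg tau mu k i (cst 0) = 0.
    by rewrite /avg Rintegral_cst// mul0r mulr0.
  rewrite (_ : (fun n => _) = cst 0); first exact: cvg_cst.
  by apply/funext => n; rewrite indicE memNset ?mul0r//= => nN; apply: nN; rewrite inE in tN.
have tN' : ~ N t by move: tN; rewrite notin_setE.
rewrite uz// indicE mem_set//; under eq_fun do rewrite mul1r.
apply: cvg_avg; [by move=> n; exact: Lq_in_Lp|exact: Lq_in_Lp|].
by apply: contrapT => ncv; apply: tN'; exact: cvN.
Qed.

Lemma measurable_field_pair (u : R -> R -> R) (phi : R -> R) :
  Lp_field u -> in_Lp mu q phi -> measurable_fun setT (fun t => pair mu phi (u t)).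
Proof.
move=> [Lu mu_] Lphi.
apply: (@measurable_fun_cvg _ _ _ _ (fun k t => dyad_pair tau mu k phi (u t))).
  move=> k; apply: measurable_sum => i; apply: measurable_funM => //.
  exact: measurable_funM.
by move=> t _; exact: (dyad_pair_cvg tau0 circleE hp2 q1 pq).
Qed.

End fields.

Section field_norm.
Context {R : realType} (p2 : R).
Hypothesis hp2 : 1 < p2.
Local Notation tau := (2 * pi : R).
Local Notation mu := (@circle R).
Local Notation "'N_ p [ f ]" := (Lnorm mu p%:E (EFin \o f)).

Let tau0 : 0 < tau. Proof. exact: tau_gt0. Qed.
Let p20 : 0 < p2. Proof. exact: lt_trans hp2. Qed.
Let p21 : 1 <= p2. Proof. exact: ltW. Qed.

Lemma in_Lp_fin f : in_Lp mu p2 f -> 'N_p2[f] \is a fin_num.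
Proof. by move=> [_ ff]; rewrite ge0_fin_numE ?Lnorm_ge0. Qed.

Definition fnorm (f : R -> R) : R := fine 'N_p2[f].

Lemma fnormE f : in_Lp mu p2 f -> (fnorm f)%:E = 'N_p2[f].
Proof. by move=> Lf; rewrite /fnorm fineK//; exact: in_Lp_fin. Qed.

Lemma fnorm_ge0 f : 0 <= fnorm f.
Proof. by rewrite fine_ge0// Lnorm_ge0. Qed.

(** The L^p2 norm of the step function with coefficients [c], in closed form: its dependence on the
    coefficients is visibly measurable. *)
Definition snorm k (c : nat -> R) : R :=
  (\sum_(i < 2 ^ k) `|c i| `^ p2 * mesh tau k) `^ p2^-1.

Lemma snorm_ge0 k c : 0 <= snorm k c. Proof. exact: powR_ge0. Qed.

Lemma Lnorm_stepf k c : 'N_p2[stepf tau k c] = (snorm k c)%:E.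
Proof.
rewrite unlock.
have -> : (\int[mu]_x (`|(EFin \o stepf tau k c) x| `^ p2) = (\sum_(i < 2 ^ k) `|c i| `^ p2 * mesh tau k)%:E)%E.
  by rewrite -(integral_stepf tau0 circleE).
by rewrite poweR_EFin.
Qed.

Definition dnorm k (f : R -> R) : R := snorm k (fun i => avg tau mu k i f).

Lemma dnormE k f : (dnorm k f)%:E = 'N_p2[dyad tau mu k f].
Proof. by rewrite -Lnorm_stepf. Qed.

Lemma dnorm_le k f : in_Lp mu p2 f -> dnorm k f <= fnorm f.
Proof.
move=> Lf; rewrite -lee_fin dnormE fnormE//.
by apply: Lnorm_dyad_le => //; case: Lf.
Qed.

Lemma dnorm_cvg f : in_Lp mu p2 f -> dnorm k f @[k --> \oo] --> fnorm f.
Proof.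
move=> Lf; apply/cvgrPdist_le => e e0.
have := dyad_Lnorm_cvg tau0 circleE p21 Lf.1 Lf.2 e0.
apply: filterS => k hk; rewrite ger0_norm ?subr_ge0 ?dnorm_le//.
rewrite lerBlDr -lee_fin fnormE// EFinD dnormE.
have md : measurable_fun setT (dyad tau mu k f) by exact: measurable_dyad.
have -> : 'N_p2[f] = 'N_p2[(f \- dyad tau mu k f) \+ dyad tau mu k f].
  by congr Lnorm; apply/funext => x /=; rewrite subrK.
apply: le_trans (eminkowski mu (measurable_funB Lf.1 md) md _) _ => //.
exact: leeD.
Qed.

Lemma measurable_snorm k (c : R -> nat -> R) :
  (forall i, measurable_fun setT (fun t => c t i)) ->
  measurable_fun setT (fun t => snorm k (c t)).
Proof.
move=> mc; apply: (@measurableT_comp _ _ _ _ _ _ (@powR R ^~ p2^-1)) => //.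
apply: measurable_sum => i; apply: measurable_funM => //.
exact: (measurable_normpowR p2 (mc i)).
Qed.

Lemma measurable_dnorm k (u : R -> R -> R) : Lp_field p2 u ->
  measurable_fun setT (fun t => dnorm k (u t)).
Proof. by move=> [_ mu_]; apply: measurable_snorm => i; exact: mu_. Qed.

Lemma measurable_fnorm (u : R -> R -> R) : Lp_field p2 u ->
  measurable_fun setT (fun t => fnorm (u t)).
Proof.
move=> Lu; apply: (@measurable_fun_cvg _ _ _ _ (fun k t => dnorm k (u t))).
  by move=> k; exact: measurable_dnorm.
by move=> t _; apply: dnorm_cvg; exact: Lu.1.
Qed.

(** Minkowski's inequality, one cell at a time. It turns finitely many estimates on coefficients
    into an estimate on the norm of the whole step function. *)
Lemma snorm_le_sum k (c d : nat -> R) :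
  snorm k c <= snorm k d +
    \sum_(i < 2 ^ k) `|c i - d i| * fnorm (\1_(cell tau k i)).
Proof.
suff : ('N_p2[stepf tau k c] <= 'N_p2[stepf tau k d] +
    (\sum_(i < 2 ^ k) `|c i - d i| * fnorm (\1_(cell tau k i)))%:E)%E.
  by rewrite Lnorm_stepf Lnorm_stepf -EFinD lee_fin.
have ms (a : nat -> R) : measurable_fun setT (stepf tau k a) by exact: measurable_stepf.
pose D n x := \sum_(i < n) (c i - d i) * \1_(cell tau k i) x : R.
have mterm i : measurable_fun setT (fun x : R => (c i - d i) * \1_(cell tau k i) x).
  by apply: measurable_funM => //; exact: measurable_indic_cell.
have mD n : measurable_fun setT (D n).
  by apply: measurable_sum => i; exact: mterm.
have -> : 'N_p2[stepf tau k c] = 'N_p2[stepf tau k d \+ D (2 ^ k)%N].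
  congr Lnorm; apply/funext => x /=; congr EFin; rewrite /stepf /D -big_split/=.
  by apply: eq_bigr => i _; rewrite mulrBl addrC subrK.
apply: le_trans (eminkowski mu (ms d) (mD _) _) _ => //.
rewrite leeD2l//; elim: (2 ^ k)%N => [|n ih].
  rewrite big_ord0 (_ : D 0%N = cst 0); last by apply/funext => x; rewrite /D big_ord0.
  by rewrite (_ : EFin \o cst 0 = cst 0%E)// Lnorm0// eqe gt_eqF.
rewrite big_ord_recr/= EFinD.
have -> : 'N_p2[D n.+1] = 'N_p2[D n \+ (fun x => (c n - d n) * \1_(cell tau k n) x)].
  by congr Lnorm; apply/funext => x /=; rewrite /D big_ord_recr.
apply: le_trans (eminkowski mu (mD n) (mterm n) _) _ => //.
apply: leeD => //.
have Lc := in_Lp_indic_cell tau0 circleE k n p21.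
rewrite le_eqVlt; apply/orP; left; apply/eqP.
rewrite EFinM fnormE//.
have LI : \1_(cell tau k n) \in Lfun mu p2%:E.
  by rewrite inE; apply/andP; split; rewrite inE; case: Lc.
have p2e : (1 <= p2%:E)%E by rewrite lee_fin.
have := LnormZ (Lfun_Sub p2e LI) (c n - d n).
by rewrite -/(_ \o _) => <-; congr Lnorm; apply/funext => x.
Qed.

Variables (T p1 : R).
Hypothesis hp1 : 1 < p1.
Local Notation "'T_ p [ f ]" := (Lnorm (time T) p%:E (EFin \o f))
  (at level 10, p at level 9, f at level 200, format "''T_' p [ f ]").

Lemma mixed_norm_field (u : R -> R -> R) : Lp_field p2 u ->
  mixed_norm T p1 p2 u = 'T_p1[fun t => fnorm (u t)].
Proof.
move=> [Lu _]; rewrite /mixed_norm; congr Lnorm; apply/funext => t /=.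
by rewrite fnormE.
Qed.

Lemma fnorm_le_of_dnorm (u : R -> R -> R) (M : R) : Lp_field p2 u ->
  (forall k, ('T_p1[fun t => dnorm k (u t)] <= M%:E)%E) ->
  ('T_p1[fun t => fnorm (u t)] <= M%:E)%E.
Proof.
move=> Lu hM.
apply: le_trans (@ae_cvg_Lnorm_fatou _ _ _ (time T) p1 _ (fun k t => dnorm k (u t)) _ _ _ _) _.
- exact: lt_trans hp1.
- exact: measurable_fnorm.
- by move=> k; exact: measurable_dnorm.
- by apply: aeW => t; apply: dnorm_cvg; exact: Lu.1.
exact: limn_einf_le.
Qed.

End field_norm.

(** * Strong measurability of weakly measurable fields *)

Section pettis.
Context {R : realType} (p2 : R).
Hypothesis hp2 : 1 < p2.
Local Notation tau := (2 * pi : R).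
Local Notation mu := (@circle R).
Local Notation "'N_ p [ f ]" := (Lnorm mu p%:E (EFin \o f)).

Let tau0 : 0 < tau. Proof. exact: tau_gt0. Qed.
Let p20 : 0 < p2. Proof. exact: lt_trans hp2. Qed.
Let p21 : 1 <= p2. Proof. exact: ltW. Qed.

(* [fun c => grid_value m (fun j => above m j c)] rounds [- m 2^m, m 2^m] down
   to the grid of step [2^-m]; its value depends on finitely many threshold
   tests, so it takes finitely many values. *)
Definition grid_size (m : nat) : nat := 2 * m * 4 ^ m.

Definition grid_origin (m : nat) : R := - (m%:R * 2 ^+ m).

Definition grid_step (m : nat) : R := 2 ^- m.

Definition above (m j : nat) (c : R) : bool :=
  grid_origin m + j.+1%:R * grid_step m <= c.

Definition grid_value (m : nat) (b : nat -> bool) : R :=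
  grid_origin m + grid_step m * \sum_(j < grid_size m) (b j)%:R.

Lemma grid_step_gt0 m : 0 < grid_step m.
Proof. by rewrite invr_gt0 exprn_gt0. Qed.

Lemma count_lt (n k : nat) : (k <= n)%N -> (\sum_(j < n) (j < k) = k)%N.
Proof.
move=> kn; rewrite -(subnKC kn) big_split_ord/=.
rewrite [X in (_ + X)%N]big1 => [|i _]; last by rewrite ltnNge leq_addr.
rewrite addn0 (eq_bigr (fun=> 1%N)) => [|i _]; last by rewrite ltn_ord.
by rewrite sum1_card card_ord.
Qed.

Lemma quantize_error m (c : R) : `|c| <= m%:R * 2 ^+ m ->
  `|c - grid_value m (fun j => above m j c)| <= grid_step m.
Proof.
move=> cm; set y := c - grid_origin m; have s0 := grid_step_gt0 m.
have y0 : 0 <= y by rewrite /y /grid_origin; move: cm; rewrite ler_norml => /andP[? _]; lra.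
pose k := Num.Def.trunc (y / grid_step m).
have yk0 : 0 <= y / grid_step m by rewrite divr_ge0// ltW.
have /andP[k1 k2] := truncn_itv yk0.
have kn : (k <= grid_size m)%N.
  rewrite -(ler_nat R); apply: le_trans k1 _.
  rewrite ler_pdivrMr//.
  have -> : (grid_size m)%:R * grid_step m = 2 * (m%:R * 2 ^+ m).
    rewrite /grid_size /grid_step !natrM natrX.
    have -> : (4 : R) = 2 * 2 by rewrite -natrM.
    rewrite exprMn; have : 2 ^+ m != 0 :> R by rewrite expf_neq0.
    by move: (2 ^+ m) => z z0; field.
  rewrite /y /grid_origin; move: cm; rewrite ler_norml => /andP[? ?]; lra.
(* Threshold [j] is passed exactly when j + 1 is at most y divided by the step, that is, when j < k:
   the successor in [above] makes the number of passed thresholds equal the integer part [k]. *)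
have E : \sum_(j < grid_size m) (above m j c)%:R = k%:R :> R.
  rewrite -[in RHS](count_lt kn) natr_sum; apply: eq_bigr => j _; congr (_%:R).
  congr nat_of_bool; rewrite /above -lerBrDl -/y -ler_pdivlMr//.
  apply/idP/idP => [jy|jk].
    rewrite ltnNge; apply/negP => kj.
    have := le_lt_trans jy k2; rewrite ltr_nat ltnS => jk.
    by have := leq_ltn_trans kj jk; rewrite ltnn.
  by apply: le_trans k1; rewrite ler_nat.
rewrite /grid_value E; rewrite -/k in k1 k2.
rewrite ler_pdivlMr// in k1; rewrite ltr_pdivrMr// in k2.
rewrite ler_norml; apply/andP; split; rewrite /y in k1 k2.
  by move: k1; nra.
by move: k2; rewrite -natr1; nra.
Qed.

(** The successors keep both ordinal types inhabited, as [inord] requires ([grid_size 0] is 0); the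
    spare entries are never read by [decode]. *)
Definition code (m : nat) : finType :=
  {ffun 'I_(2 ^ m).+1 -> {ffun 'I_(grid_size m).+1 -> bool}}.

Definition code_coef m (b : code m) (i : nat) : R :=
  grid_value m (fun j => b (inord i) (inord j)).

Lemma in_Lp_stepf m (c : nat -> R) : in_Lp mu p2 (stepf tau m c).
Proof.
split; first exact: measurable_stepf.
by rewrite (Lnorm_stepf hp2) ltry.
Qed.

Definition decode m (b : code m) : Lq hp2 :=
  sval (cid (Lq_of_function hp2 (in_Lp_stepf m (code_coef b)))).

Lemma decodeE m (b : code m) :
  {ae mu, forall x, decode b x = stepf tau m (code_coef b) x}.
Proof. by rewrite /decode; case: cid. Qed.

Definition encode m (f : R -> R) : code m :=
  [ffun i : 'I_(2 ^ m).+1 => [ffun j : 'I_(grid_size m).+1 => above m j (avg tau mu m i f)]].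

Lemma encode_coef m f i : (i < 2 ^ m)%N ->
  code_coef (encode m f) i = grid_value m (fun j => above m j (avg tau mu m i f)).
Proof.
move=> im; rewrite /code_coef /grid_value; congr (_ + _ * _).
apply: eq_bigr => j _; rewrite !ffunE !inordK//.
  by rewrite ltnS ltnW.
by rewrite ltnS ltnW.
Qed.

(** There are finitely many codes, and each is attained on a finite intersection of threshold events
    for measurable averages. *)
Lemma simple_map_decode m (u : R -> R -> R) : Lp_field p2 u ->
  simple_map (fun t => decode (encode m (u t))).
Proof.
move=> [_ mu_]; split.
  apply: (@sub_finite_set _ _ (range (@decode m))).
    by move=> _ [t _ <-]; exists (encode m (u t)).
  by apply: finite_image; exact: finite_finset.
move=> c.
have -> : (fun t => decode (encode m (u t))) @^-1` [set c] =
    \bigcup_(b in [set b : code m | decode b = c]) ((fun t => encode m (u t)) @^-1` [set b]).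
  apply/seteqP; split => t /=; first by move=> <-; exists (encode m (u t)).
  by case=> b /= <- ->.
apply: fin_bigcup_measurable; first exact: finite_finset.
move=> b _.
have -> : (fun t => encode m (u t)) @^-1` [set b] =
    \bigcap_(ij in [set: 'I_(2 ^ m).+1 * 'I_(grid_size m).+1])
      [set t | above m ij.2 (avg tau mu m ij.1 (u t)) = b ij.1 ij.2].
  apply/seteqP; split => t /=; first by move=> <- [i j] _ /=; rewrite !ffunE.
  by move=> h; apply/ffunP => i; apply/ffunP => j; rewrite !ffunE; exact: (h (i, j)).
apply: fin_bigcap_measurable; first exact: finite_finset.
move=> [i j] _ /=.
have mge : measurable_fun setT (fun t => above m j (avg tau mu m i (u t))).
  by apply: measurable_fun_ler => //; exact: mu_.
have := mge measurableT [set b i j] I.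
by rewrite setTI.
Qed.

(** A level m average is at most 2^m times the L^1 norm of [f] over 2 pi, so once m exceeds that
    quotient no average leaves the range m 2^m of the grid. Rounding then costs at most 2^-m
    pointwise, and the dyadic error tends to 0. *)
Lemma decode_cvg (f : R -> R) (z : Lq hp2) : in_Lp mu p2 f ->
  {ae mu, forall x, z x = f x} ->
  (Lnorm mu p2%:E (fun x => (decode (encode m f) x - z x)%:E) @[m --> \oo] --> 0)%E.
Proof.
move=> Lf zf.
have fi := in_Lp_integrable tau0 circleE p21 Lf.
apply/Lnorm_cvg0P => // e e0.
have C0 : 0 < tau `^ p2^-1 by exact: powR_gt0.
have e2 : 0 < e / 2 by rewrite divr_gt0.
have step_small : \forall m \near \oo, grid_step m * tau `^ p2^-1 <= e / 2.
  have : grid_step m @[m --> \oo] --> (0 : R).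
    have -> : grid_step = geometric 1 2^-1.
      by apply/funext => k; rewrite /grid_step /geometric/= exprVn mul1r.
    by apply: cvg_geometric; rewrite ger0_norm// invf_lt1// ltr1n.
  move=> /cvgr0Pnorm_le /(_ (e / 2 / tau `^ p2^-1)); rewrite divr_gt0// => /(_ isT).
  apply: filterS => m; rewrite ger0_norm ?(ltW (grid_step_gt0 _))//.
  by rewrite ler_pdivlMr.
pose I1 := \int[mu]_x `|f x|.
have I10 : 0 <= I1 by exact: Rintegral_ge0.
have big : \forall m \near \oo, I1 / tau <= m%:R by exact: nbhs_infty_ger.
have dy := dyad_Lnorm_cvg tau0 circleE p21 Lf.1 Lf.2 e2.
near=> m.
have avg_bound i : (i < 2 ^ m)%N -> `|avg tau mu m i f| <= m%:R * 2 ^+ m.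
  move=> im; apply: le_trans (le_norm_avg tau0 _ _ fi) _.
  rewrite /avg -ler_pdivlMl ?invr_gt0 ?mesh_gt0// invrK.
  have -> : mesh tau m * (m%:R * 2 ^+ m) = m%:R * tau.
    rewrite /mesh; have : 2 ^+ m != 0 :> R by rewrite expf_neq0.
    by move: (2 ^+ m) => w w0; field.
  rewrite -ler_pdivrMr//; apply: le_trans (_ : I1 / tau <= _); last by near: m.
  rewrite ler_pM2r ?invr_gt0// /I1.
  have fin := integrable_norm fi.
  rewrite -lee_fin /Rintegral !fineK.
  - apply: ge0_subset_integral => //.
    by case/integrableP : fin.
  - exact: integrable_fin_num fin.
  - by apply: integrable_fin_num => //; apply: integrableS fin.
pose g := stepf tau m (code_coef (encode m f)).
have mg : measurable_fun setT g by exact: measurable_stepf.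
have md : measurable_fun setT (dyad tau mu m f) by exact: measurable_dyad.
have mf := Lf.1.
have -> : Lnorm mu p2%:E (fun x => (decode (encode m f) x - z x)%:E) =
   'N_p2[(g \- dyad tau mu m f) \+ (dyad tau mu m f \- f)].
  apply: ae_eq_Lnorm.
  apply: (@filterS2 _ _ (ae_filter_ringOfSetsType mu)) (decodeE (encode m f)) zf => x -> ->.
  by rewrite /= addrA subrK.
apply: le_trans (eminkowski mu (measurable_funB mg md) (measurable_funB md mf) _) _ => //.
rewrite (splitr e) EFinD; apply: leeD; last first.
  have -> : 'N_p2[dyad tau mu m f \- f] = 'N_p2[f \- dyad tau mu m f].
    rewrite -(oppe_Lnorm mu (EFin \o (f \- dyad tau mu m f))).
    by congr Lnorm; apply/funext => x /=; rewrite opprB.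
  by near: m; exact: dy.
apply: (@le_trans _ _ (grid_step m * tau `^ p2^-1)%:E); last by rewrite lee_fin; near: m.
have s0 := grid_step_gt0 m.
apply/Lnorm_leP => //; first by rewrite mulr_ge0// ltW.
have pt x : `|(g \- dyad tau mu m f) x| <= grid_step m.
  rewrite /g /dyad/=; have [xL|xL] := pselect (`[0, tau[%classic x); last first.
    by rewrite !(stepf_out tau0)// subrr normr0 ltW.
  have [i im xi] := cell_ex tau0 m xL.
  rewrite !(stepfE tau0 _ im xi) encode_coef// distrC.
  by apply: quantize_error; exact: avg_bound.
apply: (@le_trans _ _ (\int[mu]_x (cst (grid_step m `^ p2)%:E x))%E).
  apply: ge0_le_lower_integral => x; first by rewrite lee_fin powR_ge0.
  by rewrite lee_fin; apply: ge0_ler_powR; [exact: ltW|rewrite nnegrE|rewrite nnegrE ltW|exact: pt].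
rewrite integral_cst// circleE// setTI lebesgue_measure_itv/= lte_fin tau0.
have sg := ltW s0; have tg := ltW tau0.
by rewrite -EFinB subr0 -EFinM lee_fin powRM ?powR_ge0// powR_root.
Unshelve. all: by end_near. Qed.

Variables (T p1 : R).

Lemma field_bochner (u : R -> R -> R) : Lp_field p2 u ->
  (mixed_norm T p1 p2 u < +oo)%E ->
  exists z : bochner T p1 hp2,
    {ae time T, forall t, {ae mu, forall x, z t x = u t x}}.
Proof.
move=> Lu ufin.
pose z t : Lq hp2 := sval (cid (Lq_of_function hp2 (Lu.1 t))).
have zE t : {ae mu, forall x, z t x = u t x} by rewrite /z; case: cid.
have zs : strongly_measurable T z.
  exists (fun m t => decode (encode m (u t))); split.
    by move=> m; exact: simple_map_decode.
  by apply: aeW => t; exact: decode_cvg (Lu.1 t) (zE t).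
have zfin : (mixed_norm T p1 p2 (fun t => z t) < +oo)%E.
  rewrite (_ : mixed_norm _ _ _ _ = mixed_norm T p1 p2 u)//.
  rewrite /mixed_norm; congr Lnorm; apply/funext => t; apply: ae_eq_Lnorm.
  by apply: (@filterS _ _ (ae_filter_ringOfSetsType mu)) (zE t) => x ->.
exists (\pi_(bochner T p1 hp2) (BochnerFun zs zfin))%qT.
have := reprK (\pi_(bochner T p1 hp2) (BochnerFun zs zfin))%qT.
move=> /eqP /bochner_eqP.
apply: (@filterS _ _ (ae_filter_ringOfSetsType (time T))) => t zt.
rewrite /bochner_val zt; exact: zE.
Qed.

End pettis.

(** * Actions of fields on planar Borel sets and their ultralimits *)

Section finite_packaging.
Context {R : realType}.

Lemma circle_fin : fin_num_fun (@circle R).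
Proof.
move=> A mA; rewrite ge0_fin_numE// circleE//.
apply: (@le_lt_trans _ _ (lebesgue_measure `[0, 2 * pi[)).
  by apply: le_measure; rewrite ?inE//; exact: measurableI.
by rewrite lebesgue_measure_itv/= lte_fin tau_gt0 -EFinB ltry.
Qed.

Lemma time_fin (T : R) : fin_num_fun (time T).
Proof.
move=> A mA; rewrite ge0_fin_numE//.
have mT := measurable_time T.
apply: (@le_lt_trans _ _ (lebesgue_measure `[0, T])).
  by apply: le_measure; rewrite ?inE//; exact: measurableI.
by rewrite lebesgue_measure_itv/=; case: ifP => _; rewrite -?EFinB ltry.
Qed.

(** The same measures, packaged with their finiteness: product measures, Fubini's theorem and the
    Radon-Nikodym theorem are applied to them. *)
Definition circleF : {sigma_finite_measure set (measurableTypeR R) -> \bar R} :=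
  HB.pack (mrestr lebesgue_measure (@measurable_circle R))
    (Measure_isFinite.Build _ _ _ (@circle R) circle_fin).

Definition timeF (T : R) : {sigma_finite_measure set (measurableTypeR R) -> \bar R} :=
  HB.pack (mrestr lebesgue_measure (measurable_time T))
    (Measure_isFinite.Build _ _ _ (time T) (@time_fin T)).

Lemma time_circle_fin (T : R) : fin_num_fun (timeF T \x circleF)%E.
Proof.
move=> A mA; rewrite ge0_fin_numE//.
apply: (@le_lt_trans _ _ ((timeF T \x circleF) setT)%E).
  by apply: le_measure; rewrite ?inE.
rewrite -setXTT product_measure1E// lte_mul_pinfty//.
  exact: time_fin.
by have := @circle_fin setT measurableT; rewrite ge0_fin_numE.
Qed.

Definition time_circle (T : R) :
    {sigma_finite_measure set (measurableTypeR R * measurableTypeR R)%type -> \bar R} :=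
  HB.pack (timeF T \x circleF)%E
    (Measure_isFinite.Build _ _ _ (timeF T \x circleF)%E (@time_circle_fin T)).

End finite_packaging.

Section section_action.
Context {R : realType} (T p1 p2 : R).
Hypothesis T0 : 0 < T.
Hypothesis hp1 : 1 < p1.
Hypothesis hp2 : 1 < p2.
Local Notation tau := (2 * pi : R).
Local Notation mu := (@circle R).
Local Notation q := (dual_exponent p2).
Local Notation r := (dual_exponent p1).
Local Notation plane := (measurableTypeR R * measurableTypeR R)%type.
Local Notation "'N_ p [ f ]" := (Lnorm mu p%:E (EFin \o f)).
Local Notation "'T_ p [ f ]" := (Lnorm (time T) p%:E (EFin \o f))
  (at level 10, p at level 9, f at level 200, format "''T_' p [ f ]").

Let tau0 : 0 < tau. Proof. exact: tau_gt0. Qed.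
Let q1 : 1 < q. Proof. exact: dual_exponent_gt1. Qed.
Let q0 : 0 < q. Proof. exact: lt_trans q1. Qed.
Let pq : p2^-1 + q^-1 = 1. Proof. exact: dual_exponent_conj. Qed.
Let r1 : 1 < r. Proof. exact: dual_exponent_gt1. Qed.
Let pr : p1^-1 + r^-1 = 1. Proof. exact: dual_exponent_conj. Qed.
Let tE (A : set (measurableTypeR R)) : measurable A ->
  time T A = lebesgue_measure (A `&` `[0, T[%classic).
Proof. exact: timeE. Qed.

Definition sec (A : set plane) (t : R) : R -> R := \1_(xsection A t).

(** The L^q norm of [sec A t]. Hölder in space and then in time bounds the action on [A] by the L^r
    norm of this function of time. *)
Definition smass (A : set plane) (t : R) : R := fine (mu (xsection A t)) `^ q^-1.

Lemma measurable_sec (A : set plane) t : measurable A -> measurable_fun setT (sec A t).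
Proof. by move=> mA; apply: measurable_indic; exact: measurable_xsection. Qed.

Lemma in_Lp_sec s (A : set plane) t : measurable A -> 1 <= s -> in_Lp mu s (sec A t).
Proof.
move=> mA s1; apply: (in_Lp_bounded tau0 circleE (C := 1)) => //.
  exact: measurable_sec.
by move=> x; rewrite /sec indicE; case: (_ \in _); rewrite ?normr1 ?normr0.
Qed.

Lemma Lnorm_sec (A : set plane) t : measurable A -> 'N_q[sec A t] = (smass A t)%:E.
Proof.
move=> mA; have mx : measurable (xsection A t) by exact: measurable_xsection.
rewrite unlock.
have -> : (\int[mu]_x (`|(EFin \o sec A t) x| `^ q) = mu (xsection A t))%E.
  transitivity (\int[mu]_x (\1_(xsection A t) x)%:E)%E.
    apply: eq_integral => x _; rewrite /sec /= indicE.
    case: (x \in _); rewrite ?normr1 ?normr0 ?poweR_EFin ?powR1//.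
    by rewrite powR0// gt_eqF.
  by rewrite integral_indic// setIT.
by rewrite -{1}[mu _]fineK ?circle_fin// poweR_EFin.
Qed.

Lemma measurable_smass (A : set plane) : measurable A -> measurable_fun setT (smass A).
Proof.
move=> mA; apply: (@measurableT_comp _ _ _ _ _ _ (@powR R ^~ q^-1)) => //.
apply: measurableT_comp => //.
exact: (measurable_fun_xsection circleF mA).
Qed.

Lemma smass_le (A : set plane) t : measurable A -> `|smass A t| <= tau `^ q^-1.
Proof.
move=> mA; have mx : measurable (xsection A t) by exact: measurable_xsection.
rewrite ger0_norm ?powR_ge0//.
apply: ge0_ler_powR; rewrite ?invr_ge0 ?nnegrE ?fine_ge0 ?(ltW tau0) ?(ltW q0)//.
rewrite -lee_fin fineK ?circle_fin// circleE//.
apply: (@le_trans _ _ (lebesgue_measure `[0, tau[)).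
  by apply: le_measure; rewrite ?inE//; exact: measurableI.
by rewrite lebesgue_measure_itv/= lte_fin tau0 -EFinB subr0.
Qed.

Lemma in_Lp_smass (A : set plane) : measurable A -> in_Lp (time T) r (smass A).
Proof.
move=> mA; apply: (in_Lp_bounded T0 tE (ltW r1) (C := tau `^ q^-1)).
  exact: measurable_smass.
by move=> t; exact: smass_le.
Qed.

(** The test function moves with [t]. In each term of [dyad_pair] the average of the section and
    that of [u t] separate; the first is a section measure, measurable by Fubini's theory. *)
Lemma measurable_sec_pair (u : R -> R -> R) (A : set plane) :
  Lp_field p2 u -> measurable A ->
  measurable_fun setT (fun t : R => pair mu (sec A t) (u t)).
Proof.
move=> [Lu mu_] mA.
apply: (@measurable_fun_cvg _ _ _ _ (fun k (t : R) => dyad_pair tau mu k (sec A t) (u t))).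
  move=> k; apply: measurable_sum => i; apply: measurable_funM; last first.
    by apply: measurable_funM => //; exact: mu_.
  apply: measurable_funM => //.
  have mc : measurable (cell tau k i) by exact: measurable_cell.
  have -> : (fun t : R => \int[mu]_(x in cell tau k i) sec A t x) =
     fine \o (mu \o xsection (A `&` (setT `*` cell tau k i))).
    apply/funext => t /=; rewrite /Rintegral /sec integral_indic//; last exact: measurable_xsection.
    congr (fine (mu _)); apply/seteqP; split => x; rewrite /xsection /=.
      by move=> [/set_mem Ax cx]; apply/mem_set; split.
    by move=> /set_mem [Ax [_ cx]]; split => //; exact: mem_set.
  apply: measurableT_comp => //.
  apply: (measurable_fun_xsection circleF).
  by apply: measurableI => //; exact: measurableX.
by move=> t _; apply: (dyad_pair_cvg tau0 circleE hp2 q1 pq); [apply: in_Lp_sec => //; exact: ltW|].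
Qed.

(** In essence the integral of [u] over [A]; it is iterated because a field is only known to have
    measurable averages in time, not joint measurability. *)
Definition act (A : set plane) (u : R -> R -> R) : R :=
  \int[time T]_t pair mu (sec A t) (u t).

Section one_field.
Variable u : R -> R -> R.
Hypothesis Lu : Lp_field p2 u.
Hypothesis fu : ('T_p1[fun t => fnorm p2 (u t)] < +oo)%E.

Let in_Lp_fnorm : in_Lp (time T) p1 (fun t => fnorm p2 (u t)).
Proof. by split => //; exact: measurable_fnorm. Qed.

Lemma sec_pair_le (A : set plane) t : measurable A ->
  `|pair mu (sec A t) (u t)| <= smass A t * fnorm p2 (u t).
Proof.
move=> mA; rewrite -lee_fin EFinM fnormE; last exact: Lu.1.
rewrite -Lnorm_sec//; apply: (pair_le hp2 q1 pq); last exact: Lu.1.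
by apply: in_Lp_sec => //; exact: ltW.
Qed.

Lemma sec_pair_integrable (A : set plane) : measurable A ->
  (time T).-integrable setT (EFin \o (fun t => pair mu (sec A t) (u t))).
Proof.
move=> mA; have := pair_integrable hp1 r1 pr (in_Lp_smass mA) in_Lp_fnorm.
apply: le_integrable => //; first by apply/measurable_EFinP; exact: measurable_sec_pair.
by move=> t _ /=; rewrite lee_fin; apply: le_trans (sec_pair_le t mA) (ler_norm _).
Qed.

Lemma act_le (A : set plane) : measurable A ->
  (`|act A u|%:E <= 'T_r[smass A] * 'T_p1[fun t => fnorm p2 (u t)])%E.
Proof.
move=> mA.
apply: le_trans (pair_le hp1 r1 pr (in_Lp_smass mA) in_Lp_fnorm).
rewrite lee_fin; apply: le_trans (le_normr_Rintegral _ (sec_pair_integrable mA)) _ => //.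
rewrite ger0_norm; last first.
  apply: Rintegral_ge0 => t _; apply: mulr_ge0; [exact: powR_ge0|exact: fnorm_ge0].
apply: le_Rintegral => //.
- by have := integrable_abse (sec_pair_integrable mA).
- exact: (pair_integrable hp1 r1 pr (in_Lp_smass mA) in_Lp_fnorm).
- by move=> t _; exact: sec_pair_le.
Qed.

Lemma actU (A B : set plane) : measurable A -> measurable B -> A `&` B = set0 ->
  act (A `|` B) u = act A u + act B u.
Proof.
move=> mA mB AB.
have mAB : measurable (A `|` B) by exact: measurableU.
apply/eqP; rewrite -subr_eq; apply/eqP; rewrite /act -RintegralB//; try exact: sec_pair_integrable.
apply: eq_Rintegral => t _.
rewrite -(pairBl hp2 q1 pq); last exact: Lu.1.
- rewrite /pair; apply: eq_Rintegral => x _; congr (_ * _).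
  rewrite /sec !indicE !mem_xsection in_setU.
  have : ~~ (((t, x) \in A) && ((t, x) \in B)).
    by rewrite -in_setI AB in_set0.
  by case: (_ \in A); case: (_ \in B) => //= _; rewrite ?subrr ?subr0.
- by apply: in_Lp_sec => //; exact: ltW.
- by apply: in_Lp_sec => //; exact: ltW.
Qed.

End one_field.

End section_action.

(** The image of an ultrafilter is an ultrafilter, and here it contains a compact segment. *)
Lemma ultra_bounded_cvg (R : realType) (I : Type) (F : set_system I) (FU : UltraFilter F)
    (g : I -> R) (M : R) : F [set i | `|g i| <= M] -> cvg (g i @[i --> F]).
Proof.
move=> FM.
have GU : UltraFilter (g @ F).
  apply: Build_UltraFilter => G PG sG.
  apply/seteqP; split => // A GA.
  have [//|FA] := in_ultra_setVsetC (g @^-1` A) FU.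
  have GA' : G (~` A) by exact: sG.
  by exfalso; apply: (@filter_not_empty _ G PG); rewrite -(setICr A); exact: filterI.
have := @segment_compact R (- M) M; rewrite compact_ultra => /(_ (g @ F) GU).
case.
  change (F (g @^-1` [set` `[- M, M]])).
  by apply: (@filterS _ F _ _ _ _ FM) => i /= gi; rewrite in_itv/= -ler_norml.
by move=> l [_ lF]; apply/cvg_ex; exists l.
Qed.

(** * The limit charge and its density *)

Section weak_density.
Context {R : realType} (T p1 p2 : R).
Hypothesis T0 : 0 < T.
Hypothesis hp1 : 1 < p1.
Hypothesis hp2 : 1 < p2.
Local Notation tau := (2 * pi : R).
Local Notation mu := (@circle R).
Local Notation q := (dual_exponent p2).
Local Notation r := (dual_exponent p1).
Local Notation plane := (measurableTypeR R * measurableTypeR R)%type.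
Local Notation "'T_ p [ f ]" := (Lnorm (time T) p%:E (EFin \o f))
  (at level 10, p at level 9, f at level 200, format "''T_' p [ f ]").

Let q1 : 1 < q. Proof. exact: dual_exponent_gt1. Qed.
Let q0 : 0 < q. Proof. exact: lt_trans q1. Qed.
Let r1 : 1 < r. Proof. exact: dual_exponent_gt1. Qed.
Let r0 : 0 < r. Proof. exact: lt_trans r1. Qed.

Let tE (A : set (measurableTypeR R)) : measurable A ->
  time T A = lebesgue_measure (A `&` `[0, T[%classic).
Proof. exact: timeE. Qed.

(** At each time the measures of the sections decrease to 0 by continuity from above; dominated
    convergence in time concludes, [smass] being bounded by a constant on a set of finite
    measure. *)
Lemma smass_cvg0 (B : nat -> set plane) : (forall n, measurable (B n)) ->
  {homo B : n m / (n <= m)%N >-> (m <= n)%O} -> \bigcap_n B n = set0 ->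
  forall e : R, 0 < e -> \forall n \near \oo, ('T_r[smass p2 (B n)] <= e%:E)%E.
Proof.
move=> mB dB B0.
have pt t : smass p2 (B n) t @[n --> \oo] --> (0 : R).
  rewrite -(@powR0 _ (q^-1)) ?invr_eq0 ?gt_eqF//.
  apply: cvg_powR => //.
    by rewrite invr_gt0.
  have c : (mu \o (fun n => xsection (B n) t)) n @[n --> \oo] --> mu (\bigcap_n (xsection (B n) t)).
    apply: nonincreasing_cvg_mu.
    - by have := circle_fin (measurable_xsection t (mB 0%N)); rewrite ge0_fin_numE.
    - by move=> n; exact: measurable_xsection.
    - by apply: bigcap_measurable => // n _; exact: measurable_xsection.
    - by move=> n m nm; apply/subsetPset; apply: le_xsection; apply/subsetPset; exact: dB.
  rewrite (_ : \bigcap_n _ = set0) ?measure0 in c; last first.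
    apply/seteqP; split => // x hx.
    have [] : (set0 : set plane) (t, x).
    by rewrite -B0 => n _; have := hx n I; rewrite /xsection/= => /set_mem.
  by case/fine_cvgP : c.
have cv : (\int[time T]_t (`|smass p2 (B n) t| `^ r)%:E)%E @[n --> \oo] --> (\int[time T]_t (cst 0%E t))%E.
  apply: (@dominated_cvg _ _ _ _ _ _ _ _ (cst ((tau `^ q^-1) `^ r)%:E)) => //.
  - move=> n; apply/measurable_EFinP; apply: measurable_normpowR.
    exact: measurable_smass.
  - move=> t _; apply: cvg_EFin; first by near=> n.
    have := @cvg_powR _ _ \oo _ (fun n => `|smass p2 (B n) t|) 0 r.
    by rewrite powR0 ?gt_eqF//; apply => //; rewrite -(normr0 R); apply: cvg_norm; exact: pt.
  - apply: (in_Lp_integrable T0 tE (lexx 1) (f := cst ((tau `^ q^-1) `^ r))).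
    by apply: (in_Lp_bounded T0 tE (lexx 1) (C := (tau `^ q^-1) `^ r)) => // t; rewrite ger0_norm ?powR_ge0.
  - move=> n t _; rewrite /= lee_fin ger0_norm ?powR_ge0//.
    by apply: ge0_ler_powR; rewrite ?nnegrE ?powR_ge0 ?(ltW r0)//; exact: smass_le.
rewrite integral0 in cv.
move=> e e0; have er : 0 < e `^ r by rewrite powR_gt0.
move: cv => /fine_cvgP[/= fin /cvgr0Pnorm_le /(_ _ er)].
apply: filterS2 fin => n fin; rewrite ger0_norm; last first.
  by rewrite fine_ge0// integral_ge0.
by move=> /= h; apply/Lnorm_leP; rewrite ?(ltW e0)//; move: h; rewrite -lee_fin fineK.
Unshelve. all: by end_near.
Qed.

Section limit_charge.
Context (I : Type) (F : set_system I) {FP : ProperFilter F}.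
Variables (K : set I) (u : I -> R -> R -> R) (M : R).
Hypothesis FU : UltraFilter F.
Hypothesis FK : F K.
Hypothesis Lu : forall i, Lp_field p2 (u i).
Hypothesis uM : forall i, K i -> ('T_p1[fun t => fnorm p2 (u i t)] <= M%:E)%E.

Let fu i : K i -> ('T_p1[fun t => fnorm p2 (u i t)] < +oo)%E.
Proof. by move=> /uM /le_lt_trans; apply; exact: ltry. Qed.

Let smassT (A : set plane) : R := fine ('T_r[smass p2 A]).

Let smassTE (A : set plane) : measurable A -> (smassT A)%:E = 'T_r[smass p2 A].
Proof.
move=> mA; rewrite fineK// ge0_fin_numE ?Lnorm_ge0//.
by have [] := in_Lp_smass T0 hp1 hp2 mA.
Qed.

Let act_bound (A : set plane) i : measurable A -> K i -> `|act T A (u i)| <= smassT A * M.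
Proof.
move=> mA Ki; rewrite -lee_fin EFinM smassTE//.
apply: le_trans (act_le T0 hp1 hp2 (Lu i) (fu Ki) mA) _.
by apply: lee_wpmul2l; [exact: Lnorm_ge0|exact: uM].
Qed.

Definition limit_act (A : set plane) : R := lim (act T A (u i) @[i --> F]).

Lemma limit_act_cvg (A : set plane) : measurable A ->
  act T A (u i) @[i --> F] --> limit_act A.
Proof.
move=> mA; apply: ultra_bounded_cvg.
by apply: filterS FK => i; exact: act_bound mA.
Qed.

Let limit_act_bound (A : set plane) : measurable A -> `|limit_act A| <= smassT A * M.
Proof.
move=> mA; apply: (cvgr_to_le (cvg_norm (limit_act_cvg mA))).
by apply: filterS FK => i; exact: act_bound.
Qed.

Let limit_actU (A B : set plane) : measurable A -> measurable B -> A `&` B = set0 ->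
  limit_act (A `|` B) = limit_act A + limit_act B.
Proof.
move=> mA mB AB; have mAB : measurable (A `|` B) by exact: measurableU.
apply: (cvg_unique _ (limit_act_cvg mAB)) => //.
apply: cvg_trans (cvgD (limit_act_cvg mA) (limit_act_cvg mB)); apply: near_eq_cvg; apply: filterS FK => i Ki /=.
by rewrite (actU T0 hp1 hp2 (Lu i) (fu Ki)).
Qed.

Let nu0 (A : set plane) : \bar R := (limit_act A)%:E.

Let limit_act0 : limit_act set0 = 0.
Proof.
have := limit_actU measurable0 measurable0 (setI0 _).
by rewrite setU0 => /eqP; rewrite -subr_eq subrr eq_sym => /eqP.
Qed.

Let nu0_0 : nu0 set0 = 0%E. Proof. by rewrite /nu0 limit_act0. Qed.

Let nu0_fin (A : set plane) : measurable A -> nu0 A \is a fin_num.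
Proof. by []. Qed.

(** A limit along an ultrafilter is in general only finitely additive. Here the tails [C n] decrease
    to the empty set, and their action is at most [smassT (C n) * M] for all fields of [K] at once,
    so the limit on the tails vanishes as well. *)
Let nu0_sigma : semi_sigma_additive nu0.
Proof.
move=> A mA tA mU; pose B n := \big[setU/set0]_(i < n) A i.
have mB n : measurable (B n) by exact: bigsetU_measurable.
pose C n := (\bigcup_i A i) `\` B n.
have mC n : measurable (C n) by exact: measurableD.
have BS n : B n.+1 = B n `|` A n by rewrite /B big_ord_recr.
have BE n : (\sum_(0 <= i < n) nu0 (A i) = (limit_act (B n))%:E)%E.
  rewrite /nu0 sumEFin; congr EFin; rewrite big_mkord; elim: n => [|n IH].
    by rewrite /B !big_ord0 limit_act0.
  rewrite big_ord_recr/= IH BS; apply/esym/limit_actU; [exact: mB|exact: mA|].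
  apply/seteqP; split => // x [+ Anx]; rewrite /B -bigcup_mkord => -[i /= ilt Aix].
  have e : i = n by apply: tA => //; exists x.
  by rewrite e ltnn in ilt.
have BC n : limit_act (\bigcup_i A i) = limit_act (B n) + limit_act (C n).
  rewrite -(limit_actU (mB n) (mC n)); last by rewrite /C setDE setICA setICr setI0.
  by congr limit_act; rewrite /C setDUK// => x; rewrite /B -bigcup_mkord => -[i _ Aix]; exists i.
have cC : limit_act (C n) @[n --> \oo] --> (0 : R).
  apply/cvgr0Pnorm_le => e e0.
  have M1 : 0 < `|M| + 1 by rewrite ltr_wpDl.
  have := @smass_cvg0 C mC _ _ (e / (`|M| + 1)) (divr_gt0 e0 M1).
  have d1 : {homo C : n m / (n <= m)%N >-> (m <= n)%O}.
    move=> n m nm; apply/subsetPset => x [Ux nB]; split => //; apply: contra_not nB.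
    by rewrite /B -!bigcup_mkord => -[i /= /leq_trans h Aix]; exists i => //; exact: h.
  have d2 : \bigcap_n C n = set0.
    apply/seteqP; split => // x h; have [[i _ Aix] _] := h 0%N Logic.I.
    have [_] := h i.+1 Logic.I; apply; rewrite /B -bigcup_mkord; exists i => //=.
  move=> /(_ d1 d2); apply: filterS => n hn.
  apply: le_trans (limit_act_bound (mC n)) _.
  apply: le_trans (ler_norm _) _; rewrite normrM.
  have : `|smassT (C n)| <= e / (`|M| + 1).
    by rewrite ger0_norm ?fine_ge0 ?Lnorm_ge0// -lee_fin smassTE.
  move=> h; apply: (@le_trans _ _ (e / (`|M| + 1) * (`|M| + 1))).
    by apply: ler_pM => //; rewrite lerDl.
  by rewrite divfK// gt_eqF.
under eq_fun do rewrite BE.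
apply: cvg_EFin; first by near=> n.
have BD n : limit_act (B n) = limit_act (\bigcup_i A i) - limit_act (C n).
  by apply/esym/eqP; rewrite subr_eq; apply/eqP; exact: BC.
rewrite (_ : fine \o _ = (fun n => limit_act (\bigcup_i A i) - limit_act (C n))); last first.
  by apply/funext => n; exact: BD.
by rewrite -[X in _ --> X]subr0; apply: cvgB => //; exact: cvg_cst.
Unshelve. all: by end_near.
Qed.

Lemma limit_density : exists f : plane -> \bar R,
  [/\ (time_circle T).-integrable setT f, (forall x, f x \is a fin_num)
    & forall A : set plane, measurable A ->
      act T A (u i) @[i --> F] --> fine (\int[time_circle T]_(x in A) f x)%E].
Proof.
pose nu : {charge set plane -> \bar R} := HB.pack nu0 (isCharge.Build _ _ _ nu0 nu0_0 nu0_fin nu0_sigma).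
(* A null set of the plane has null sections at almost every time, so its [smass] vanishes and the
   uniform bound leaves no action. *)
have dom : nu `<< time_circle T.
  apply/null_content_dominatesP => A mA A0.
  suff : limit_act A = 0 by move=> h; rewrite /= /nu0 h.
  apply/eqP; rewrite -normr_le0; apply: le_trans (limit_act_bound mA) _.
  suff -> : smassT A = 0 by rewrite mul0r.
  apply/EFin_inj; rewrite smassTE//.
  rewrite (@ae_eq_Lnorm _ _ _ (time T) r _ (cst 0%E)).
    by rewrite Lnorm0// eqe gt_eqF.
  have h : (\int[time T]_t mu (xsection A t) = 0)%E by exact: A0.
  have mxs : measurable_fun setT (mu \o xsection A) by exact: (measurable_fun_xsection circleF mA).
  have [+ _] := ae_eq_integral_abs (time T) measurableT mxs.
  under eq_integral do rewrite /= gee0_abs//.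
  move=> /(_ h); apply: (@filterS _ _ (ae_filter_ringOfSetsType (time T))) => t /(_ Logic.I) t0.
  have {}t0 : mu (xsection A t) = 0%E by [].
  have s0 : smass p2 A t = 0 by rewrite /smass t0 /= powR0// invr_eq0 gt_eqF.
  by rewrite /comp s0.
exists (Radon_Nikodym nu (time_circle T)); split.
- exact: Radon_Nikodym_integrable.
- by move=> x; exact: Radon_Nikodym_fin_num.
- move=> A mA; rewrite -Radon_Nikodym_integral//=; exact: limit_act_cvg.
Qed.

End limit_charge.

End weak_density.

(** * Convergence of the dyadic coefficients *)

Section Lnorm_bounds.
Context d (T : measurableType d) (R : realType) (mu : {measure set T -> \bar R}).
Implicit Types (f g h : T -> R).
Local Notation "'N_ p [ f ]" := (Lnorm mu p%:E (EFin \o f)).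

Lemma Lnorm_le_add p f g h (a b : R) : 1 <= p ->
  measurable_fun setT g -> measurable_fun setT h ->
  (forall t, `|f t| <= `|g t| + `|h t|) ->
  ('N_p[g] <= a%:E)%E -> ('N_p[h] <= b%:E)%E -> ('N_p[f] <= (a + b)%:E)%E.
Proof.
move=> p1 mg mh fgh ga hb; have p0 : 0 < p by exact: lt_le_trans p1.
have NN k : ('N_p[(fun x => `|k x|)%R] <= 'N_p[k])%E.
  by apply: ae_le_Lnorm => //; apply: aeW => x /=; rewrite normr_id.
have mg' : measurable_fun setT (fun x => `|g x|) by exact: measurableT_comp.
have mh' : measurable_fun setT (fun x => `|h x|) by exact: measurableT_comp.
apply: (@le_trans _ _ ('N_p[((fun x => `|g x|) \+ (fun x => `|h x|))%R])).
  apply: ae_le_Lnorm => //; apply: aeW => x /=; rewrite lee_fin.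
  by rewrite [leRHS]ger0_norm ?addr_ge0.
apply: le_trans (eminkowski mu mg' mh' _) _; first by rewrite lee_fin.
by rewrite EFinD; apply: leeD; [exact: le_trans (NN g) ga|exact: le_trans (NN h) hb].
Qed.

Lemma Lnorm_dist3 p f f' g g' (a b c : R) : 1 <= p ->
  measurable_fun setT f -> measurable_fun setT f' ->
  measurable_fun setT g -> measurable_fun setT g' ->
  ('N_p[(f \- f')%R] <= a%:E)%E -> ('N_p[(f' \- g')%R] <= b%:E)%E ->
  ('N_p[(g \- g')%R] <= c%:E)%E -> ('N_p[(f \- g)%R] <= (a + (b + c))%:E)%E.
Proof.
move=> p1 mf mf' mg mg' ha hb hc.
have m1 : measurable_fun setT (f \- f') by exact: measurable_funB.
have m2 : measurable_fun setT (f' \- g') by exact: measurable_funB.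
have m3 : measurable_fun setT (g \- g') by exact: measurable_funB.
pose h t := `|(f' \- g') t| + `|(g \- g') t|.
have mh : measurable_fun setT h by apply: measurable_funD; exact: measurableT_comp.
apply: (Lnorm_le_add p1 m1 mh _ ha).
  move=> t; rewrite /h [X in _ <= _ + X]ger0_norm ?addr_ge0//=.
  rewrite [X in _ <= _ + (_ + X)]distrC.
  apply: le_trans (ler_distD (f' t) _ _) _; rewrite lerD2l.
  exact: ler_distD.
apply: (Lnorm_le_add p1 m2 m3 _ hb hc) => t.
by rewrite /h ger0_norm// addr_ge0.
Qed.

Lemma Lnorm_le_scale p (c : R) f (a : R) : 0 < p -> measurable_fun setT f ->
  ('N_p[f] <= a%:E)%E -> ('N_p[(fun t => c * f t)%R] <= (`|c| * a)%:E)%E.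
Proof.
move=> p0 mf fa; have a0 : 0 <= a by rewrite -lee_fin; apply: le_trans fa; exact: Lnorm_ge0.
apply/Lnorm_leP; rewrite ?mulr_ge0//.
move/Lnorm_leP : fa => /(_ p0 a0) fa.
under eq_integral do rewrite normrM powRM// EFinM.
rewrite ge0_integralZl_EFin ?powR_ge0//; last first.
  by apply/measurable_EFinP; exact: measurable_normpowR.
by rewrite powRM// EFinM; apply: lee_wpmul2l => //; rewrite lee_fin powR_ge0.
Qed.

Lemma Lnorm_le_sum p n (f : 'I_n -> T -> R) (a : 'I_n -> R) : 1 <= p ->
  (forall i, measurable_fun setT (f i)) -> (forall i, ('N_p[f i] <= (a i)%:E)%E) ->
  ('N_p[(fun t => \sum_i `|f i t|)%R] <= (\sum_i a i)%:E)%E.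
Proof.
move=> p1 mf fa; have p0 : 0 < p by exact: lt_le_trans p1.
elim: n f a mf fa => [|n IH] f a mf fa.
  rewrite big_ord0 (_ : _ \o _ = cst 0%E) ?Lnorm0// ?eqe ?gt_eqF//.
  by apply/funext => t /=; rewrite big_ord0.
rewrite big_ord_recl addrC.
apply: (@Lnorm_le_add _ _ (fun t => \sum_i `|f (lift ord0 i) t|) (f ord0)) => //.
- by apply: measurable_sum => i; exact: measurableT_comp.
- by move=> t; rewrite big_ord_recl addrC; apply: le_trans (ler_normD _ _) _; rewrite normr_id.
- by apply: IH => i; [exact: mf|exact: fa].
Qed.

(** The threshold [l] is chosen so that l^(p-q) b'^q = e^p / 2; then [dl] makes the L^1 term at most
    e^p / 2 too. Replacing [b] by |b| + 1 ensures positivity. Since [dl] does not depend on [f], it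
    can be fixed before the index of a family. *)
Lemma Lnorm_interpolation p q (e b : R) : 1 <= p -> p < q -> 0 < e ->
  exists2 dl : R, 0 < dl & forall f, measurable_fun setT f ->
    ('N_1[f] <= dl%:E)%E -> ('N_q[f] <= b%:E)%E -> ('N_p[f] <= e%:E)%E.
Proof.
move=> p1 pq e0; have p0 : 0 < p by exact: lt_le_trans p1.
have q0 : 0 < q by exact: lt_trans pq.
pose b' := `|b| + 1; have b0 : 0 < b' by rewrite ltr_wpDl.
have ep : 0 < e `^ p by exact: powR_gt0.
have bq : 0 < b' `^ q by exact: powR_gt0.
pose l := (2 * b' `^ q / e `^ p) `^ (q - p)^-1.
have l0 : 0 < l by apply: powR_gt0; rewrite divr_gt0// mulr_gt0.
have qp : 0 < q - p by rewrite subr_gt0.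
have lE : l `^ (p - q) * b' `^ q = e `^ p / 2.
  rewrite -opprB powRN /l powR_root//; last by rewrite divr_ge0 ?mulr_ge0 ?ltW.
  by field; rewrite !gt_eqF.
have lp : 0 < l `^ (p - 1) by exact: powR_gt0.
exists (e `^ p / 2 / l `^ (p - 1)); first by rewrite !divr_gt0.
move=> f mf f1 fq.
apply/Lnorm_leP; rewrite ?(ltW e0)//.
have mq r : measurable_fun setT (fun x => (`|f x| `^ r)%:E).
  by apply/measurable_EFinP; exact: measurable_normpowR.
have m1 : measurable_fun setT (fun x => `|f x|%:E).
  by apply/measurable_EFinP; exact: measurableT_comp.
have M1 : measurable_fun setT (fun x => (l `^ (p - 1))%:E * `|f x|%:E)%E.
  by apply/(@measurable_EFinP _ _ _ setT (fun x => l `^ (p - 1) * `|f x|)); apply: measurable_funM => //; exact: measurableT_comp.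
have M2 : measurable_fun setT (fun x => (l `^ (p - q))%:E * (`|f x| `^ q)%:E)%E.
  by apply/(@measurable_EFinP _ _ _ setT (fun x => l `^ (p - q) * `|f x| `^ q)); apply: measurable_funM => //; exact: measurable_normpowR.
apply: (@le_trans _ _ (\int[mu]_x ((l `^ (p - 1))%:E * `|f x|%:E + (l `^ (p - q))%:E * (`|f x| `^ q)%:E))%E).
  apply: ge0_le_integral => //.
  - exact: (emeasurable_funD M1 M2).
  - move=> x _; rewrite -!EFinM -EFinD lee_fin.
    by apply: powR_interpolation => //; exact: ltW.
rewrite ge0_integralD//; last first.
- by move=> x _; rewrite -EFinM lee_fin mulr_ge0// powR_ge0.
- by move=> x _; rewrite -EFinM lee_fin mulr_ge0// powR_ge0.
rewrite !ge0_integralZl_EFin ?powR_ge0//.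
rewrite [(e `^ p)]splitr EFinD; apply: leeD.
  rewrite Lnorm1 in f1; apply: (@le_trans _ _ ((l `^ (p - 1))%:E * (e `^ p / 2 / l `^ (p - 1))%:E)%E).
    by apply: lee_wpmul2l; [rewrite lee_fin ltW|exact: f1].
  by rewrite -EFinM lee_fin mulrC divfK// gt_eqF.
rewrite -lE EFinM; apply: lee_wpmul2l; first by rewrite lee_fin powR_ge0.
have bb : ('N_q[f] <= b'%:E)%E.
  by apply: le_trans fq _; rewrite lee_fin /b'; apply: le_trans (ler_norm b) _; rewrite lerDl.
by move/Lnorm_leP : bb; apply => //; exact: ltW.
Qed.

End Lnorm_bounds.

(** * Dyadic coefficients of the limit density *)

Section limit_field.
Context {R : realType} (T : R).
Hypothesis T0 : 0 < T.
Local Notation tau := (2 * pi : R).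
Local Notation mu := (@circle R).
Local Notation plane := (measurableTypeR R * measurableTypeR R)%type.

Let tau0 : 0 < tau. Proof. exact: tau_gt0. Qed.

Definition coef m j (v : R -> R -> R) (t : R) : R := avg tau mu m j (v t).

Lemma avgZ k l (c : R) (g : R -> R) : (time T).-integrable setT (EFin \o g) ->
  avg T (time T) k l (fun t => c * g t) = c * avg T (time T) k l g.
Proof.
move=> ig; rewrite /avg RintegralZl//; first by rewrite mulrCA.
exact: integrable_cell ig.
Qed.

(** This links the charge to the coefficients: convergence of actions on dyadic rectangles is
    convergence of the time averages of [coef m j]. *)
Lemma act_rectangle k l m j (v : R -> R -> R) :
  act T (cell T k l `*` cell tau m j) v =
  mesh T k * avg T (time T) k l (fun t => mesh tau m * coef m j v t).
Proof.
rewrite -pair_indic_cell// /act /pair; apply: eq_Rintegral => t _.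
rewrite -[mesh tau m * _](@pair_indic_cell _ tau mu)// /sec indicE.
have [tl|tl] := boolP (t \in cell T k l).
  rewrite mul1r; congr pair; congr indic.
  by apply/seteqP; split => x; rewrite /xsection /=; [move/set_mem => []|move=> cx; apply/mem_set; split => //; exact: set_mem].
rewrite mul0r /pair (_ : xsection _ _ = set0).
  by under eq_Rintegral do rewrite indic0 mul0r; rewrite /Rintegral integral0.
apply/seteqP; split => x; rewrite /xsection //= => /set_mem [/= tc _].
by move: tl; rewrite mem_set.
Qed.

Section density.
Variable f : plane -> \bar R.
Hypothesis If : (time_circle T).-integrable setT f.
Hypothesis ff : forall x, f x \is a fin_num.

Definition fiber (t x : R) : R := fine (f (t, x)).

Lemma fiberE t x : (fiber t x)%:E = f (t, x).
Proof. by rewrite fineK. Qed.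

Lemma ae_integrable_fiber : {ae time T, forall t, mu.-integrable setT (EFin \o fiber t)}.
Proof.
have := ae_integrable1 If.
apply: (@filterS _ _ (ae_filter_ringOfSetsType (time T))) => t h.
rewrite (_ : EFin \o fiber t = (fun y => f (t, y)))//.
by apply/funext => x; rewrite -fiberE.
Qed.

Lemma measurable_fiber t : measurable_fun setT (fiber t).
Proof.
apply: measurableT_comp => //.
apply: (@measurableT_comp _ _ _ _ _ _ f _ (fun x : measurableTypeR R => (t : measurableTypeR R, x))).
  exact: (measurable_int _ If).
exact: measurable_pair1.
Qed.

Lemma fubini_restrict (C D : set (measurableTypeR R)) t :
  (fubini_F circleF (f \_ (C `*` D)) t =
   (\1_C t)%:E * \int[mu]_(x in D) (fiber t x)%:E)%E.
Proof.
rewrite /fubini_F [in RHS]integral_mkcond indicE.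
have [tC|tC] := boolP (t \in C).
  rewrite mul1e; apply: eq_integral => x _; rewrite /patch.
  have -> : ((t, x) \in C `*` D) = (x \in D).
    apply/idP/idP => /set_mem; last by move=> h; apply/mem_set; split => //; exact: set_mem.
    by move=> [_ h]; exact: mem_set.
  by rewrite fiberE.
rewrite mul0e; rewrite -[RHS](integral0 circleF setT); apply: eq_integral => x _.
rewrite /patch; case: ifPn => // /set_mem [/= h _].
by move: tC; rewrite mem_set.
Qed.

Lemma coef_fiberE m j t : coef m j fiber t =
  (mesh tau m)^-1 * fine (fubini_F circleF (f \_ (setT `*` cell tau m j)) t).
Proof. by rewrite fubini_restrict indicT mul1e. Qed.

Let int_restrict (A : set plane) : measurable A ->
  (time_circle T).-integrable setT (f \_ A).
Proof.
move=> mA; apply/(integrable_mkcond f mA).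
by apply: (@integrableS _ _ _ _ setT) If.
Qed.

Lemma measurable_coef_fiber m j : measurable_fun setT (coef m j fiber).
Proof.
rewrite (_ : coef m j fiber = (fun t => (mesh tau m)^-1 * fine (fubini_F circleF (f \_ (setT `*` cell tau m j)) t))).
  apply: measurable_funM => //; apply: measurableT_comp => //.
  by apply: (@measurable_fubini_F _ _ _ _ _ (timeF T)); apply: int_restrict; exact: measurableX.
by apply/funext => t; exact: coef_fiberE.
Qed.

Lemma integrable_coef_fiber m j : (time T).-integrable setT (EFin \o coef m j fiber).
Proof.
have mX : measurable (setT `*` cell tau m j : set plane) by exact: measurableX.
have ib : (time T).-integrable setT (fubini_F circleF (f \_ (setT `*` cell tau m j))).
  exact: (@integrable_fubini_F _ _ _ _ _ (timeF T) circleF _ (int_restrict mX)).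
rewrite (_ : _ \o _ = (fun t => (mesh tau m)^-1%:E * (EFin \o (fine \o fubini_F circleF (f \_ (setT `*` cell tau m j)))) t)%E); last first.
  by apply/funext => t /=; rewrite coef_fiberE EFinM.
have mb := measurable_int _ ib.
apply: integrableZl => //; apply: le_integrable ib => //.
  by apply/measurable_EFinP; exact: measurableT_comp.
have fine_le (y : \bar R) : (`|(fine y)%:E| <= `|y|)%E.
  by case: y => [r| |] //=; rewrite ?normr0 ?leey.
by move=> t _; exact: fine_le.
Qed.

Lemma integral_rectangle k l m j :
  fine (\int[time_circle T]_(x in cell T k l `*` cell tau m j) f x)%E =
  mesh T k * avg T (time T) k l (fun t => mesh tau m * coef m j fiber t).
Proof.
have mX : measurable (cell T k l `*` cell tau m j : set plane) by exact: measurableX.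
rewrite -pair_indic_cell// /pair /Rintegral; congr fine.
rewrite [LHS]integral_mkcond.
transitivity (\int[timeF T]_t fubini_F circleF (f \_ (cell T k l `*` cell tau m j)) t)%E.
  by rewrite (integral12_prod_meas1 (int_restrict mX)).
apply: ae_eq_integral => //.
- exact: (@measurable_fubini_F _ _ _ _ _ (timeF T) circleF _ (int_restrict mX)).
- apply/measurable_EFinP; apply: measurable_funM => //; apply: measurable_funM => //.
  exact: measurable_coef_fiber.
apply: (@filterS _ _ (ae_filter_ringOfSetsType (time T))) ae_integrable_fiber => t it _.
rewrite fubini_restrict EFinM; congr (_ * _)%E.
rewrite /coef /avg mulrA mulfV ?gt_eqF ?mesh_gt0// mul1r /Rintegral fineK//.
by apply: integrable_fin_num => //; exact: integrable_cell it.
Qed.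

End density.

End limit_field.

Lemma filter_forall_ord (J : Type) (F : set_system J) {FF : Filter F} n (P : nat -> set J) :
  (forall l, (l < n)%N -> F (P l)) -> F [set i | forall l, (l < n)%N -> P l i].
Proof.
elim: n => [|n IH] h; first by apply: filterS filterT => i _ l.
have h1 := IH (fun l ln => h l (ltnW ln)).
apply: filterS2 h1 (h n (leqnn _)) => i /= a b l.
by rewrite ltnS leq_eqVlt => /predU1P[->//|]; exact: a.
Qed.

Lemma ler_norm_distD (R : realType) (a b : R) : `|a| <= `|b| + `|a - b|.
Proof. by have := ler_normD b (a - b); rewrite [b + (a - b)]addrC subrK. Qed.

Section limit_convergence.
Context {R : realType} (T p1 p2 pb : R).
Hypothesis T0 : 0 < T.
Hypothesis hp1 : 1 < p1.
Hypothesis hpb : p1 < pb.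
Local Notation tau := (2 * pi : R).
Local Notation plane := (measurableTypeR R * measurableTypeR R)%type.
Local Notation "'T_ p [ f ]" := (Lnorm (time T) p%:E (EFin \o f))
  (at level 10, p at level 9, f at level 200, format "''T_' p [ f ]").

Let tau0 : 0 < tau. Proof. exact: tau_gt0. Qed.
Let tE (A : set (measurableTypeR R)) : measurable A ->
  time T A = lebesgue_measure (A `&` `[0, T[%classic).
Proof. exact: timeE. Qed.
Let p11 : 1 <= p1. Proof. exact: ltW. Qed.
Let pb1 : 1 < pb. Proof. exact: lt_trans hpb. Qed.
Let pb11 : 1 <= pb. Proof. exact: ltW. Qed.
Let pb0 : 0 < pb. Proof. exact: lt_trans pb1. Qed.

Lemma Lnorm_le_bounded (p dl : R) (g : R -> R) : 0 < p -> 0 <= dl ->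
  (forall t, `|g t| <= dl) -> ('T_p[g] <= (dl * T `^ p^-1)%:E)%E.
Proof.
move=> p0 d0 gd; apply/Lnorm_leP; rewrite ?mulr_ge0 ?powR_ge0//.
rewrite powRM ?powR_ge0// powR_root ?(ltW T0)//.
apply: (@le_trans _ _ (\int[time T]_t (cst (dl `^ p)%:E t))%E).
  apply: ge0_le_lower_integral => t; first by rewrite lee_fin powR_ge0.
  by rewrite lee_fin; apply: ge0_ler_powR; rewrite ?nnegrE ?(ltW p0).
rewrite integral_cst// tE// setTI lebesgue_measure_itv/= lte_fin T0 -EFinB subr0.
by rewrite -EFinM.
Qed.

Context (J : Type) (F : set_system J) {FP : ProperFilter F}.
Variables (K : set J) (u : J -> R -> R -> R).
Hypothesis FK : F K.
Hypothesis Lu : forall i, Lp_field p2 (u i).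
Hypothesis ub : forall m j, (j < 2 ^ m)%N ->
  exists B : R, forall i, K i -> ('T_pb[coef m j (u i)] <= B%:E)%E.
Hypothesis ut : forall m j, (j < 2 ^ m)%N -> forall e : R, 0 < e ->
  exists k0, forall k, (k0 <= k)%N -> forall i, K i ->
   ('T_1[(coef m j (u i) \- dyad T (time T) k (coef m j (u i)))%R] <= e%:E)%E.
Variable f : plane -> \bar R.
Hypothesis If : (time_circle T).-integrable setT f.
Hypothesis ff : forall x, f x \is a fin_num.
Hypothesis fa : forall A : set plane, measurable A ->
  act T A (u i) @[i --> F] --> fine (\int[time_circle T]_(x in A) f x)%E.

Let mc m j i : measurable_fun setT (coef m j (u i)).
Proof. exact: (Lu i).2. Qed.

Let mc0 m j : measurable_fun setT (coef m j (fiber f)).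
Proof. exact: (measurable_coef_fiber If). Qed.

Let md k (v : R -> R) : measurable_fun setT (dyad T (time T) k v).
Proof. exact: measurable_dyad. Qed.

Let ic0 m j : (time T).-integrable setT (EFin \o coef m j (fiber f)).
Proof. exact: (integrable_coef_fiber If). Qed.

Let ic m j i : (j < 2 ^ m)%N -> K i -> (time T).-integrable setT (EFin \o coef m j (u i)).
Proof.
move=> jm Ki; have [B hB] := ub jm.
apply: (Lnorm_integrable T0 tE pb11) => //.
by apply: le_lt_trans (hB i Ki) _; exact: ltry.
Qed.

Lemma avg_coef_cvg k l m j : (j < 2 ^ m)%N ->
  avg T (time T) k l (coef m j (u i)) @[i --> F] --> avg T (time T) k l (coef m j (fiber f)).
Proof.
move=> jm; have mX : measurable (cell T k l `*` cell tau m j : set plane) by exact: measurableX.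
have h1 : mesh T k != 0 by rewrite gt_eqF// mesh_gt0.
have h2 : mesh tau m != 0 by rewrite gt_eqF// mesh_gt0.
have := fa mX; rewrite integral_rectangle// avgZ// => c.
have {}c : (mesh T k * mesh tau m)^-1 * act T (cell T k l `*` cell tau m j) (u i) @[i --> F] -->
   (mesh T k * mesh tau m)^-1 * (mesh T k * (mesh tau m * avg T (time T) k l (coef m j (fiber f)))).
  by apply: cvgM => //; exact: cvg_cst.
have EE x : (mesh T k * mesh tau m)^-1 * (mesh T k * (mesh tau m * x)) = x.
  by rewrite (mulrA (mesh T k)) mulKf// mulf_neq0.
rewrite EE in c; apply: cvg_trans c; apply: near_eq_cvg; apply: filterS FK => i Ki /=.
by rewrite act_rectangle// avgZ ?EE//; exact: ic.
Qed.

(** Only finitely many averages occur at level [k], so their convergence is uniform in time, hence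
    holds in every L^p of the finite interval. *)
Lemma dyad_coef_cvg k m j (p e : R) : (j < 2 ^ m)%N -> 0 < p -> 0 < e ->
  F [set i | ('T_p[(dyad T (time T) k (coef m j (fiber f)) \-
     dyad T (time T) k (coef m j (u i)))%R] <= e%:E)%E].
Proof.
move=> jm p0 e0; have Tp : 0 < T `^ p^-1 by exact: powR_gt0.
pose dl := e / T `^ p^-1; have d0 : 0 < dl by exact: divr_gt0.
have : F [set i | forall l, (l < 2 ^ k)%N -> `|avg T (time T) k l (coef m j (fiber f)) -
    avg T (time T) k l (coef m j (u i))| <= dl].
  by apply: filter_forall_ord => l _; have /cvgrPdist_le := @avg_coef_cvg k l m j jm; exact.
apply: filterS => i /= hi.
have -> : e = dl * T `^ p^-1 by rewrite divfK// gt_eqF.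
apply: Lnorm_le_bounded => //; first exact: ltW.
move=> t /=; have [tT|tT] := pselect (`[0, T[%classic t).
  have [l lk tl] := cell_ex T0 k tT.
  by rewrite /dyad (stepfE T0 _ lk tl) (stepfE T0 _ lk tl); exact: hi.
by rewrite /dyad !stepf_out// subrr normr0 ltW.
Qed.

(** Three errors: coefficient of the limit to its dyadic average, dyadic average to dyadic average,
    and back to the coefficient of [u i]. The level [k] is fixed by the outer two, uniformly over
    [K], before the filter handles the middle one. *)
Lemma coef_cvg1 m j (e : R) : (j < 2 ^ m)%N -> 0 < e ->
  F [set i | ('T_1[(coef m j (fiber f) \- coef m j (u i))%R] <= e%:E)%E].
Proof.
move=> jm e0; have e3 : 0 < e / 3 by exact: divr_gt0.
have [k0 hk0] := ut jm e3.
have f1 : ('T_1[coef m j (fiber f)] < +oo)%E by rewrite Lnorm1; case/integrableP : (ic0 m j).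
have [k1 _ hk1] := dyad_Lnorm_cvg T0 tE (lexx 1) (mc0 m j) f1 e3.
pose k := maxn k0 k1.
have h1 := hk1 k (leq_maxr _ _).
have h0 := hk0 k (leq_maxl _ _).
apply: filterS2 FK (dyad_coef_cvg k jm ltr01 e3) => i Ki /= h2.
have {}h0 := h0 i Ki.
have -> : e = e / 3 + (e / 3 + e / 3) by field.
exact: (@Lnorm_dist3 _ (measurableTypeR R) R (time T) _ _ _ _ _ _ _ _ (lexx 1) (mc0 m j) (md _ _) (mc m j i) (md _ _) h1 h2 h0).
Qed.

(** For each level some [u i] in [K] has its dyadic average within 1 of that of the limit, which
    explains [B + 1]; the index may change with the level since Fatou only needs the bound. *)
Lemma coef_limit_bound m j : (j < 2 ^ m)%N ->
  exists B : R, ('T_pb[coef m j (fiber f)] <= B%:E)%E.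
Proof.
move=> jm; have [B hB] := ub jm; exists (B + 1).
apply: le_trans (dyad_Lnorm_fatou T0 tE pb0 (ic0 m j)) _.
apply: limn_einf_le => k.
have [i /= [Ki hi]] := filter_ex (filterI FK (dyad_coef_cvg k jm pb0 ltr01)).
apply: (@Lnorm_le_add _ (measurableTypeR R) R (time T) pb _ (dyad T (time T) k (coef m j (u i)))
  (dyad T (time T) k (coef m j (fiber f)) \- dyad T (time T) k (coef m j (u i)))) => //.
- exact: md.
- by apply: measurable_funB; exact: md.
- by move=> t; exact: ler_norm_distD.
- by apply: le_trans (hB i Ki); apply: Lnorm_dyad_le => //; exact: mc.
Qed.

Lemma coef_cvg m j (e : R) : (j < 2 ^ m)%N -> 0 < e ->
  F [set i | ('T_p1[(coef m j (fiber f) \- coef m j (u i))%R] <= e%:E)%E].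
Proof.
move=> jm e0; have [B hB] := ub jm; have [B0 hB0] := coef_limit_bound jm.
have [dl dl0 hdl] := Lnorm_interpolation (time T) (B0 + B) p11 hpb e0.
apply: filterS2 FK (coef_cvg1 jm dl0) => i Ki /= h1.
apply: hdl => //; first by apply: measurable_funB; [exact: mc0|exact: mc].
apply: (@Lnorm_le_add _ (measurableTypeR R) R (time T) pb _ (coef m j (fiber f)) (coef m j (u i))) => //.
- exact: mc0.
- exact: mc.
- by move=> t; exact: ler_normB.
- exact: hB.
Qed.

End limit_convergence.

(** * The limit field and convergence against all test functions *)

Section limit_point.
Context {R : realType} (T p1 p2 : R).
Hypothesis hp1 : 1 < p1.
Hypothesis hp2 : 1 < p2.
Local Notation tau := (2 * pi : R).
Local Notation mu := (@circle R).
Local Notation q := (dual_exponent p2).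
Local Notation plane := (measurableTypeR R * measurableTypeR R)%type.
Local Notation "'N_ p [ f ]" := (Lnorm mu p%:E (EFin \o f)).
Local Notation "'T_ p [ f ]" := (Lnorm (time T) p%:E (EFin \o f))
  (at level 10, p at level 9, f at level 200, format "''T_' p [ f ]").

Let tau0 : 0 < tau. Proof. exact: tau_gt0. Qed.
Let p10 : 0 < p1. Proof. exact: lt_trans hp1. Qed.
Let p11 : 1 <= p1. Proof. exact: ltW. Qed.
Let p20 : 0 < p2. Proof. exact: lt_trans hp2. Qed.
Let q1 : 1 < q. Proof. exact: dual_exponent_gt1. Qed.
Let pq : p2^-1 + q^-1 = 1. Proof. exact: dual_exponent_conj. Qed.

Context (J : Type) (F : set_system J) {FP : ProperFilter F}.
Variables (K : set J) (u : J -> R -> R -> R) (M : R).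
Hypothesis FK : F K.
Hypothesis Lu : forall i, Lp_field p2 (u i).
Hypothesis uM : forall i, K i -> ('T_p1[fun t => fnorm p2 (u i t)] <= M%:E)%E.
Variable f : plane -> \bar R.
Hypothesis If : (time_circle T).-integrable setT f.
Hypothesis ff : forall x, f x \is a fin_num.
Hypothesis cc : forall m j (e : R), (j < 2 ^ m)%N -> 0 < e ->
  F [set i | ('T_p1[(coef m j (fiber f) \- coef m j (u i))%R] <= e%:E)%E].

Let mc m j i : measurable_fun setT (coef m j (u i)).
Proof. exact: (Lu i).2. Qed.

Let mc0 m j : measurable_fun setT (coef m j (fiber f)).
Proof. exact: (measurable_coef_fiber If). Qed.

Let mfib t : measurable_fun setT (fiber f t).
Proof. exact: (measurable_fiber If). Qed.

(** A single member of [K] suffices: with tolerance 1 / (S + 1) on each coefficient, where [S] sums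
    the norms of the cell indicators, the level [m] norms differ by at most 1. *)
Lemma dnorm_fiber_bound m : ('T_p1[fun t => dnorm p2 m (fiber f t)] <= (M + 1)%:E)%E.
Proof.
pose S := \sum_(j < 2 ^ m) fnorm p2 (\1_(cell tau m j)).
have S0 : 0 <= S by apply: sumr_ge0 => j _; exact: fnorm_ge0.
have dl0 : 0 < (S + 1)^-1 by rewrite invr_gt0 ltr_wpDl.
have [i /= [Ki hi]] := filter_ex (filterI FK
  (filter_forall_ord (fun j (jm : (j < 2 ^ m)%N) => cc jm dl0))).
pose D (j : 'I_(2 ^ m)) (t : R) : R :=
  fnorm p2 (\1_(cell tau m j)) * (coef m j (fiber f) \- coef m j (u i)) t.
have mdiff (j : 'I_(2 ^ m)) : measurable_fun setT (coef m j (fiber f) \- coef m j (u i)).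
  by apply: measurable_funB; [exact: mc0|exact: mc].
have mD j : measurable_fun setT (D j) by apply: measurable_funM.
have bD j : ('T_p1[D j] <= (fnorm p2 (\1_(cell tau m j)) * (S + 1)^-1)%:E)%E.
  rewrite -[X in (X * _)%:E]ger0_norm ?fnorm_ge0//.
  exact: (@Lnorm_le_scale _ (measurableTypeR R) R (time T) p1 _ _ _ p10 (mdiff j) (hi j (ltn_ord j))).
have := @Lnorm_le_sum _ (measurableTypeR R) R (time T) p1 _ D _ p11 mD bD => hs.
have {}hs : ('T_p1[fun t => (\sum_j `|D j t|)%R] <= 1%:E)%E.
  apply: le_trans hs _; rewrite lee_fin -mulr_suml -/S.
  by rewrite ler_pdivrMr ?ltr_wpDl// mul1r lerDl.
have mu1 : measurable_fun setT (fun t : R => fnorm p2 (u i t)) by exact: measurable_fnorm.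
have mS : measurable_fun setT (fun t : R => \sum_j `|D j t|).
  by apply: measurable_sum => j; apply: measurableT_comp.
apply: (@Lnorm_le_add _ (measurableTypeR R) R (time T) p1 _ _ _ M 1 p11 mu1 mS) => //.
- move=> t; rewrite ger0_norm ?snorm_ge0// [X in _ <= X + _]ger0_norm ?fnorm_ge0//.
  rewrite [X in _ <= _ + X]ger0_norm ?sumr_ge0//.
  apply: le_trans (snorm_le_sum hp2 m _ (fun j => coef m j (u i) t)) _.
  apply: lerD; first by apply: dnorm_le => //; exact: (Lu i).1.
  by apply: ler_sum => j _; rewrite /D normrM [X in _ <= X * _]ger0_norm ?fnorm_ge0// mulrC.
- exact: uM.
Qed.

Let fiberN (t : R) : \bar R := 'N_p2[fiber f t].

Let measurable_fiberN : measurable_fun setT fiberN.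
Proof.
rewrite (_ : fiberN = (fun y : \bar R => y `^ p2^-1)%E \o
    fubini_F circleF (fun z => (`|fine (f z)| `^ p2)%:E)); last first.
  by apply/funext => t; rewrite /fiberN unlock.
apply: measurableT_comp; first exact: measurable_poweR.
apply: measurable_fun_fubini_tonelli_F; last by move=> z; rewrite lee_fin powR_ge0.
apply/measurable_EFinP; apply: measurable_normpowR.
by apply: measurableT_comp => //; exact: (measurable_int _ If).
Qed.

(** The density is only integrable a priori. Fatou is applied twice, over dyadic levels in space and
    then in time, to give its L^p2 norm a finite p1-th moment; that norm is then finite at almost
    every time. *)
Lemma ae_fiber_in_Lp : {ae time T, forall t, in_Lp mu p2 (fiber f t)}.
Proof.
have mH : measurable_fun setT (fun t => fiberN t `^ p1)%E.
  by apply: (@measurableT_comp _ _ _ _ _ _ (fun y : \bar R => y `^ p1)%E) => //; exact: measurable_poweR.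
have g0 (t : R) : (0 <= fiberN t `^ p1)%E by exact: poweR_ge0.
pose g k (t : R) := (`|dnorm p2 k (fiber f t)| `^ p1)%:E.
have mg k : measurable_fun setT (g k).
  apply/measurable_EFinP; apply: measurable_normpowR; apply: measurable_snorm => j.
  exact: mc0.
have M1 : 0 <= M + 1 by rewrite -lee_fin; apply: le_trans (dnorm_fiber_bound 0); exact: Lnorm_ge0.
have iH : (\int[time T]_t (fiberN t `^ p1) <= ((M + 1) `^ p1)%:E)%E.
  apply: (@le_trans _ _ (\int[time T]_t limn_einf (g ^~ t))%E).
    apply: ae_le_lower_integral => //.
      by move=> t; apply/le_limn_einfP => r r0; near=> n; apply: le_trans (ltW r0) _; rewrite lee_fin powR_ge0.
    apply: (@filterS _ _ (ae_filter_ringOfSetsType (time T))) (ae_integrable_fiber If ff) => t it.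
    have := dyad_Lnorm_fatou tau0 circleE p20 it.
    move=> /(poweR_limn_einf p10 (Lnorm_ge0 _ _ _)) h.
    apply: le_trans (h _) _; first by move=> n; exact: Lnorm_ge0.
    rewrite (_ : (fun n => _) = g ^~ t)//; apply/funext => n.
    by rewrite -dnormE// /g ger0_norm ?snorm_ge0// poweR_EFin.
  apply: le_trans (fatou (time T) measurableT mg _) _; first by move=> n t _; rewrite lee_fin powR_ge0.
  apply: limn_einf_le => n.
  by have /Lnorm_leP := dnorm_fiber_bound n; apply.
have IH : (time T).-integrable setT (fun t => fiberN t `^ p1)%E.
  apply/integrableP; split => //; under eq_integral do rewrite gee0_abs//.
  by apply: le_lt_trans iH _; exact: ltry.
have := integrable_ae measurableT IH.
apply: (@filterS _ _ (ae_filter_ringOfSetsType (time T))) => t /(_ I) hN.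
split => //; rewrite -/(fiberN t).
have := @lty_poweRy _ (fiberN t) p1; apply; first by rewrite gt_eqF.
by rewrite ltey_eq hN.
Unshelve. all: by end_near. Qed.

Let good : set (measurableTypeR R) := [set t | (fiberN t < +oo)%E].

Let measurable_good : measurable good.
Proof.
have := measurable_fiberN measurableT (emeasurable_itv `]-oo, (+oo)%E[%O).
by rewrite setTI; congr measurable; apply/seteqP; split => t /=; rewrite in_itv.
Qed.

(** [Lp_field] asks for L^p2 functions at every time, so the fibers of infinite norm are replaced by
    0; this affects a null set of times. *)
Definition limit_point (t x : R) : R := \1_good t * fiber f t x.

Lemma coef_limit_point m j t : coef m j limit_point t = \1_good t * coef m j (fiber f) t.
Proof.
rewrite /coef /limit_point indicE; case: (t \in good); rewrite ?mul1r ?mul0r.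
  by congr avg; apply/funext => x; rewrite mul1r.
rewrite /avg /Rintegral; under eq_integral do rewrite mul0r.
by rewrite integral0 mulr0.
Qed.

Lemma Lp_field_limit_point : Lp_field p2 limit_point.
Proof.
split; last first.
  move=> k i; rewrite (_ : (fun t => _) = (fun t => \1_good t * coef k i (fiber f) t)).
    by apply: measurable_funM => //; exact: mc0.
  by apply/funext => t; rewrite -coef_limit_point.
move=> t; rewrite /limit_point indicE; have [tg|tg] := boolP (t \in good).
  rewrite (_ : (fun x => _) = fiber f t); last by apply/funext => x; rewrite mul1r.
  by split => //; exact: set_mem.
apply: (in_Lp_bounded tau0 circleE (C := 0)); first exact: ltW.
  by apply: measurable_funM.
by move=> x; rewrite mul0r normr0.
Qed.

Lemma ae_limit_point : {ae time T, forall t, limit_point t = fiber f t}.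
Proof.
apply: (@filterS _ _ (ae_filter_ringOfSetsType (time T))) ae_fiber_in_Lp => t [_ h].
by apply/funext => x; rewrite /limit_point indicE mem_set ?mul1r.
Qed.

Lemma fnorm_limit_point : ('T_p1[fun t => fnorm p2 (limit_point t)] <= (M + 1)%:E)%E.
Proof.
apply: fnorm_le_of_dnorm => //; first exact: Lp_field_limit_point.
move=> k; apply: le_trans (dnorm_fiber_bound k).
rewrite le_eqVlt; apply/orP; left; apply/eqP; apply: ae_eq_Lnorm.
by apply: (@filterS _ _ (ae_filter_ringOfSetsType (time T))) ae_limit_point => t h; rewrite /comp h.
Qed.

Lemma coef_limit_point_cvg m j (e : R) : (j < 2 ^ m)%N -> 0 < e ->
  F [set i | ('T_p1[(coef m j limit_point \- coef m j (u i))%R] <= e%:E)%E].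
Proof.
move=> jm e0; apply: filterS (cc jm e0) => i /=; apply: le_trans.
rewrite le_eqVlt; apply/orP; left; apply/eqP; apply: ae_eq_Lnorm.
by apply: (@filterS _ _ (ae_filter_ringOfSetsType (time T))) ae_limit_point => t /= h; rewrite /coef h.
Qed.

(** Replacing [phi] by a dyadic step function costs [eta] times the norms of [u i] and of the limit,
    bounded by M and M + 1; [eta] makes the total e / 2. The remaining e / 2 is shared among
    finitely many coefficients. *)
Lemma pair_limit_point_cvg phi (e : R) : in_Lp mu q phi -> 0 < e ->
  F [set i | ('T_p1[(fun t => pair mu phi (u i t) - pair mu phi (limit_point t))%R] <= e%:E)%E].
Proof.
move=> Lphi e0.
have M0 : 0 <= M.
  by have [i Ki] := filter_ex FK; rewrite -lee_fin; apply: le_trans (uM Ki); exact: Lnorm_ge0.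
have C0 : 0 < M + (M + 1) by lra.
have e2 : 0 < e / 2 by exact: divr_gt0.
have eta0 : 0 < e / 2 / (M + (M + 1)) by exact: divr_gt0.
have [m _ hm] := dyad_Lnorm_cvg tau0 circleE (ltW q1) Lphi.1 Lphi.2 eta0.
have {}hm := hm m (leqnn m).
set eta := e / 2 / _ in eta0 hm.
pose a (j : nat) := avg tau mu m j phi * mesh tau m.
pose S := \sum_(j < 2 ^ m) `|a j|.
have S0 : 0 <= S by exact: sumr_ge0.
have dl0 : 0 < e / 2 / (S + 1) by rewrite divr_gt0// ltr_wpDl.
apply: filterS2 FK (filter_forall_ord (fun j (jm : (j < 2 ^ m)%N) => coef_limit_point_cvg jm dl0)) => i Ki /= hi.
have Lz := Lp_field_limit_point.
pose D (j : 'I_(2 ^ m)) (t : R) : R := a j * (coef m j limit_point \- coef m j (u i)) t.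
have mdiff (j : 'I_(2 ^ m)) : measurable_fun setT (coef m j limit_point \- coef m j (u i)).
  by apply: measurable_funB; [exact: Lz.2|exact: mc].
have mD j : measurable_fun setT (D j) by apply: measurable_funM.
have bD j : ('T_p1[D j] <= (`|a j| * (e / 2 / (S + 1)))%:E)%E.
  exact: (@Lnorm_le_scale _ (measurableTypeR R) R (time T) p1 _ _ _ p10 (mdiff j) (hi j (ltn_ord j))).
have := @Lnorm_le_sum _ (measurableTypeR R) R (time T) p1 _ D _ p11 mD bD => hs.
have {}hs : ('T_p1[fun t => (\sum_j `|D j t|)%R] <= (e / 2)%:E)%E.
  apply: le_trans hs _; rewrite lee_fin -mulr_suml -/S.
  by rewrite mulrCA ler_piMr ?(ltW e2)// ler_pdivrMr ?ltr_wpDl// mul1r lerDl.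
have m1 : measurable_fun setT (fun t : R => fnorm p2 (u i t)) by exact: measurable_fnorm.
have m2 : measurable_fun setT (fun t : R => fnorm p2 (limit_point t)) by exact: measurable_fnorm.
have m3 : measurable_fun setT (fun t : R => \sum_j `|D j t|).
  by apply: measurable_sum => j; exact: measurableT_comp.
have m1' : measurable_fun setT (fun t : R => eta * fnorm p2 (u i t)) by exact: measurable_funM.
have m2' : measurable_fun setT (fun t : R => eta * fnorm p2 (limit_point t)) by exact: measurable_funM.
have b1 : ('T_p1[fun t => (eta * fnorm p2 (u i t))%R] <= (`|eta| * M)%:E)%E.
  exact: (@Lnorm_le_scale _ (measurableTypeR R) R (time T) p1 _ _ _ p10 m1 (uM Ki)).
have b2 : ('T_p1[fun t => (eta * fnorm p2 (limit_point t))%R] <= (`|eta| * (M + 1))%:E)%E.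
  exact: (@Lnorm_le_scale _ (measurableTypeR R) R (time T) p1 _ _ _ p10 m2 fnorm_limit_point).
pose g23 (t : R) : R := `|eta * fnorm p2 (limit_point t)| + `|\sum_j `|D j t| |.
have m23 : measurable_fun setT g23 by apply: measurable_funD; exact: measurableT_comp.
have b23 : ('T_p1[g23] <= (`|eta| * (M + 1) + e / 2)%:E)%E.
  apply: (@Lnorm_le_add _ (measurableTypeR R) R (time T) p1 _ _ _ _ _ p11 m2' m3 _ b2 hs) => t.
  by rewrite /g23 ger0_norm// addr_ge0.
have -> : e = `|eta| * M + (`|eta| * (M + 1) + e / 2).
  by rewrite addrA -mulrDr gtr0_norm// divfK ?gt_eqF// -splitr.
apply: (@Lnorm_le_add _ (measurableTypeR R) R (time T) p1 _ _ _ _ _ p11 m1' m23 _ b1 b23) => t.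
rewrite /g23 [X in _ <= _ + X]ger0_norm ?addr_ge0//.
have close_pair (v : R -> R) : in_Lp mu p2 v ->
    `|pair mu phi v - dyad_pair tau mu m phi v| <= `|eta * fnorm p2 v|.
  move=> Lv; rewrite [leRHS]ger0_norm; last exact: mulr_ge0 (ltW eta0) (fnorm_ge0 _ _).
  rewrite -lee_fin EFinM fnormE//.
  apply: le_trans (pair_dyad_le tau0 circleE hp2 q1 pq m Lphi Lv) _.
  by apply: lee_wpmul2r => //; exact: Lnorm_ge0.
have h1 := close_pair _ ((Lu i).1 t).
have h2 := close_pair _ (Lz.1 t).
have h3 : `|dyad_pair tau mu m phi (u i t) - dyad_pair tau mu m phi (limit_point t)| <= `|\sum_j `|D j t| |.
  rewrite [leRHS]ger0_norm ?sumr_ge0//.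
  rewrite distrC /dyad_pair -sumrB; apply: le_trans (ler_norm_sum _ _ _) _.
  apply: ler_sum => j _; rewrite /D /a /coef /= le_eqVlt; apply/orP; left; apply/eqP.
  by congr `| _ |; rewrite mulrBr !mulrA.
apply: le_trans (ler_distD (dyad_pair tau mu m phi (u i t)) _ _) _; apply: lerD h1 _.
apply: le_trans (ler_distD (dyad_pair tau mu m phi (limit_point t)) _ _) _.
by rewrite addrC; apply: lerD h3; rewrite distrC.
Qed.

End limit_point.

Lemma field_compactness (R : realType) (T p1 p2 pb : R) (T0 : 0 < T)
    (hp1 : 1 < p1) (hp2 : 1 < p2) (hpb : p1 < pb)
    (J : Type) (F : set_system J) (FU : UltraFilter F) (K : set J)
    (u : J -> R -> R -> R) (M : R) :
  F K -> (forall i, Lp_field p2 (u i)) ->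
  (forall i, K i ->
    (Lnorm (time T) p1%:E (EFin \o (fun t => fnorm p2 (u i t))) <= M%:E)%E) ->
  (forall m j, (j < 2 ^ m)%N -> exists B : R, forall i, K i ->
    (Lnorm (time T) pb%:E (EFin \o coef m j (u i)) <= B%:E)%E) ->
  (forall m j, (j < 2 ^ m)%N -> forall e : R, 0 < e ->
    exists k0, forall k, (k0 <= k)%N -> forall i, K i ->
    (Lnorm (time T) 1%:E (EFin \o (coef m j (u i) \- dyad T (time T) k (coef m j (u i)))%R)
      <= e%:E)%E) ->
  exists z, [/\ Lp_field p2 z, (mixed_norm T p1 p2 z < +oo)%E &
    forall phi (e : R), in_Lp circle (dual_exponent p2) phi -> 0 < e ->
      F [set i | (Lnorm (time T) p1%:E
        (EFin \o (fun t => pair circle phi (u i t) - pair circle phi (z t))%R) <= e%:E)%E]].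
Proof.
move=> FK Lu uM ub ut; have FP : ProperFilter F by exact: ultra_proper.
have [f [If ff fa]] := limit_density T0 hp1 hp2 FU FK Lu uM.
have cc := @coef_cvg _ _ _ _ _ T0 hp1 hpb _ _ FP _ _ FK Lu ub ut _ If ff fa.
exists (limit_point p2 f); split.
- exact: (Lp_field_limit_point hp2 If ff).
- rewrite mixed_norm_field//; last exact: (Lp_field_limit_point hp2 If ff).
  apply: le_lt_trans (fnorm_limit_point (FP := FP) hp1 hp2 FK Lu uM If ff cc) _.
  exact: ltry.
- by move=> phi e Lphi e0; exact: (pair_limit_point_cvg (FP := FP) hp1 hp2 FK Lu uM If ff cc).
Qed.

(** * Closed constraints in the weak topology *)

Section representatives.
Context {R : realType} (T p1 p2 : R).
Hypothesis hp1 : 1 < p1.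
Hypothesis hp2 : 1 < p2.
Local Notation mu := (@circle R).
Local Notation q := (dual_exponent p2).
Local Notation B := (bochner T p1 hp2).
Local Notation "'T_ p [ f ]" := (Lnorm (time T) p%:E (EFin \o f))
  (at level 10, p at level 9, f at level 200, format "''T_' p [ f ]").

Let q1 : 1 < q. Proof. exact: dual_exponent_gt1. Qed.
Let pq : p2^-1 + q^-1 = 1. Proof. exact: dual_exponent_conj. Qed.

(** A version of [w], equal to it at almost every time, whose spatial averages are measurable on the
    whole line. *)
Definition field_of (w : B) : R -> R -> R :=
  projT1 (cid2 (strongly_measurable_field (T := T) (bfun_strong (repr w)))).

Lemma Lp_field_of (w : B) : Lp_field p2 (field_of w).
Proof. by rewrite /field_of; case: cid2. Qed.

Lemma field_ofE (w : B) : {ae time T, forall t, field_of w t = w t}.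
Proof. by rewrite /field_of; case: cid2. Qed.

Lemma Lfun_in_Lp (phi : R -> R) :
  phi \in Lfun mu (hoelder_conjugate p2%:E) <-> in_Lp mu q phi.
Proof.
rewrite hoelder_conjugate_EFin//; split.
  by rewrite inE => /andP[]; rewrite !inE /= => mphi fphi; split.
by move=> [mphi fphi]; rewrite inE; apply/andP; split; rewrite inE.
Qed.

Definition wdist (phi : R -> R) (w z : B) : \bar R :=
  'T_p1[fun t => pair mu phi (field_of w t) - pair mu phi (field_of z t)].

Lemma weak_seminormE (phi : R -> R) (w z : B) : in_Lp mu q phi ->
  weak_seminorm T p1 phi (fun t x => w t x - z t x) = wdist phi w z.
Proof.
move=> Lphi; rewrite /weak_seminorm /wdist; apply: ae_eq_Lnorm.
apply: (@filterS2 _ _ (ae_filter_ringOfSetsType (time T))) (field_ofE w) (field_ofE z) => t hw hz.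
congr EFin; rewrite /comp -(pairBr hp2 q1 pq Lphi); [|exact: (Lp_field_of w).1|exact: (Lp_field_of z).1].
by rewrite hw hz.
Qed.

Let weak_openE (U : set B) :
  open U = [set \bigcup_(i in D) id i | D in subset^~ (finI_from (@weak_subbase R T p1 p2 hp2) id)] U.
Proof. reflexivity. Qed.

Lemma subbase_open (U : set B) : weak_subbase U -> open U.
Proof.
move=> sU; rewrite weak_openE; exists [set U]; last by rewrite bigcup_set1.
move=> V ->.
exists (finmap.fset1 U); first by move=> V2; rewrite finmap.in_fset1 => /eqP ->; rewrite inE.
by rewrite set_fset1 bigcap_set1.
Qed.

Lemma subbase_cvg (F : set_system B) (FF : Filter F) (z : B) :
  (forall U, weak_subbase U -> U z -> F U) -> F --> z.
Proof.
move=> h A; rewrite nbhsE => -[V [oV Vz] VA].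
move: oV; rewrite weak_openE => -[D sD DV].
move: Vz; rewrite -DV => -[W DW Wz].
have := sD _ DW => -[D' sD' D'W].
apply: (@filterS _ F _ W).
  by move=> x Wx; apply: VA; rewrite -DV; exists W.
move: Wz; rewrite -D'W => Wz.
apply: filter_bigI => U UD'; apply: h; first by have := sD' _ UD'; rewrite inE.
exact: Wz.
Qed.

End representatives.

Lemma lee_addeps (R : realType) (x : \bar R) (M C : R) : 0 <= C ->
  (forall e : R, 0 < e -> (x <= (M + e * C)%:E)%E) -> (x <= M%:E)%E.
Proof.
move=> C0 h; apply/lee_addgt0Pr => e e0.
have C1 : 0 < C + 1 by rewrite ltr_wpDl.
apply: le_trans (h (e / (C + 1)) (divr_gt0 e0 C1)) _.
rewrite -EFinD lee_fin lerD2l -mulrA ler_piMr ?(ltW e0)//.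
by rewrite mulrC ler_pdivrMr// mul1r lerDl.
Qed.

Section closed_constraints.
Context {R : realType} (T p1 p2 : R).
Hypothesis T0 : 0 < T.
Hypothesis hp1 : 1 < p1.
Hypothesis hp2 : 1 < p2.
Local Notation tau := (2 * pi : R).
Local Notation mu := (@circle R).
Local Notation leb := (@lebesgue_measure R).
Local Notation q := (dual_exponent p2).
Local Notation r := (dual_exponent p1).
Local Notation B := (bochner T p1 hp2).
Local Notation "'T_ p [ f ]" := (Lnorm (time T) p%:E (EFin \o f))
  (at level 10, p at level 9, f at level 200, format "''T_' p [ f ]").

Let tau0 : 0 < tau. Proof. exact: tau_gt0. Qed.
Let tE (A : set (measurableTypeR R)) : measurable A ->
  time T A = lebesgue_measure (A `&` `[0, T[%classic).
Proof. exact: timeE. Qed.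
Let q1 : 1 < q. Proof. exact: dual_exponent_gt1. Qed.
Let pq : p2^-1 + q^-1 = 1. Proof. exact: dual_exponent_conj. Qed.
Let r1 : 1 < r. Proof. exact: dual_exponent_gt1. Qed.
Let pr : p1^-1 + r^-1 = 1. Proof. exact: dual_exponent_conj. Qed.
Let p10 : 0 < p1. Proof. exact: lt_trans hp1. Qed.
Let p11 : 1 <= p1. Proof. exact: ltW. Qed.

(** Finitely many weak balls around [w] intersect in a neighbourhood, so a point of the closure is
    approximated in all these seminorms by one element of [S]. Each constraint then only has to
    tolerate such approximations. *)
Lemma closed_weak n (phi : nat -> R -> R) (S : set B) :
  (forall i, (i < n)%N -> in_Lp mu q (phi i)) ->
  (forall w, (forall e : R, 0 < e -> exists2 w', S w' &
     forall i, (i < n)%N -> (wdist (phi i) w' w <= e%:E)%E) -> S w) ->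
  closed S.
Proof.
move=> Lphi h w Sw; apply: h => e e0.
have nb : nbhs w [set w' | forall i, (i < n)%N -> weak_ball (phi i) w e w'].
  apply: filter_forall_ord => i ilt; apply: open_nbhs_nbhs; split.
    apply: subbase_open => //; exists (phi i), w, e; split => //.
    by apply/Lfun_in_Lp => //; exact: Lphi.
  rewrite /weak_ball /= weak_seminormE//; last exact: Lphi.
  rewrite /wdist (_ : EFin \o _ = cst 0%E) ?Lnorm0 ?lte_fin// ?eqe ?gt_eqF//.
  by apply/funext => t /=; rewrite subrr.
have [w' [Sw' /= hw']] := Sw _ nb.
exists w' => // i ilt; have := hw' i ilt.
by rewrite /weak_ball /= weak_seminormE//; [exact: ltW|exact: Lphi].
Qed.

Let Lcell m j : in_Lp mu q (\1_(cell tau m j)).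
Proof. by apply: (in_Lp_indic_cell tau0 circleE); exact: ltW. Qed.

Lemma coef_pair m j (v : R -> R -> R) t :
  coef m j v t = (mesh tau m)^-1 * pair mu (\1_(cell tau m j)) (v t).
Proof. by rewrite (@pair_indic_cell _ tau)// mulKf// gt_eqF// mesh_gt0. Qed.

Let mpair phi (w : B) : in_Lp mu q phi ->
  measurable_fun setT (fun t => pair mu phi (field_of w t)).
Proof. by move=> Lphi; exact: (measurable_field_pair hp2 (Lp_field_of w) Lphi). Qed.

Definition pair_diff phi (w z : B) (t : R) : R :=
  pair mu phi (field_of w t) - pair mu phi (field_of z t).

Let mdiff phi (w z : B) : in_Lp mu q phi -> measurable_fun setT (pair_diff phi w z).
Proof. by move=> Lphi; apply: measurable_funB; exact: mpair. Qed.

Lemma closed_dnorm m (M : R) :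
  closed [set w : B | ('T_p1[fun t => dnorm p2 m (field_of w t)] <= M%:E)%E].
Proof.
pose phi j : R -> R := \1_(cell tau m j).
apply: (@closed_weak (2 ^ m) phi) => [j _|w hw]; first exact: Lcell.
pose a (j : nat) := fnorm p2 (phi j) * (mesh tau m)^-1.
have a0 j : 0 <= a j by rewrite mulr_ge0 ?fnorm_ge0// invr_ge0 mesh_ge0.
apply: (@lee_addeps _ _ M (\sum_(j < 2 ^ m) a j)) => [|e e0]; first exact: sumr_ge0.
have [w' /= hw' de] := hw e e0.
pose D (j : 'I_(2 ^ m)) (t : R) : R := a j * pair_diff (phi j) w' w t.
have mD (j : 'I_(2 ^ m)) : measurable_fun setT (pair_diff (phi j) w' w) by apply: mdiff; exact: Lcell.
have bD j : ('T_p1[D j] <= (`|a j| * e)%:E)%E.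
  exact: (@Lnorm_le_scale _ (measurableTypeR R) R (time T) p1 _ _ _ p10 (mD j) (de j (ltn_ord j))).
have mD' j : measurable_fun setT (D j) by apply: measurable_funM.
have := @Lnorm_le_sum _ (measurableTypeR R) R (time T) p1 _ D _ p11 mD' bD => hs.
have mw : measurable_fun setT (fun t : R => dnorm p2 m (field_of w' t)).
  by apply: measurable_dnorm; exact: Lp_field_of.
have mS : measurable_fun setT (fun t : R => \sum_j `|D j t|).
  by apply: measurable_sum => j; apply: measurableT_comp.
have -> : e * (\sum_(j < 2 ^ m) a j) = \sum_(j < 2 ^ m) `|a j| * e.
  by rewrite mulrC mulr_suml; apply: eq_bigr => j _; rewrite ger0_norm.
apply: (@Lnorm_le_add _ (measurableTypeR R) R (time T) p1 _ _ _ _ _ p11 mw mS _ hw' hs) => t.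
rewrite [leLHS]ger0_norm; last exact: snorm_ge0.
rewrite [X in _ <= X + _]ger0_norm; last exact: snorm_ge0.
rewrite [X in _ <= _ + X]ger0_norm; last exact: sumr_ge0.
apply: le_trans (snorm_le_sum hp2 m _ (fun j => coef m j (field_of w') t)) _.
rewrite lerD2l; apply: ler_sum => j _; rewrite /D /a normrM ger0_norm//.
rewrite -/(coef m j (field_of w) t) !coef_pair -mulrBr normrM ger0_norm ?invr_ge0 ?mesh_ge0//.
  by rewrite distrC [leLHS]mulrC mulrA.
exact: a0.
Qed.

Lemma avg_le_p1 k l (g : R -> R) (a : R) : in_Lp (time T) p1 g ->
  ('T_p1[g] <= a%:E)%E ->
  `|avg T (time T) k l g| <= fine ('T_r[\1_(cell T k l)]) / mesh T k * a.
Proof.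
move=> Lg ga; have Lc : in_Lp (time T) r (\1_(cell T k l)).
  by apply: (in_Lp_indic_cell T0 tE); exact: ltW.
have h0 := mesh_gt0 T0 k.
have := pair_le hp1 r1 pr Lc Lg; rewrite pair_indic_cell// => h.
have {h} : (`|mesh T k * avg T (time T) k l g|%:E <= 'T_r[\1_(cell T k l)] * a%:E)%E.
  by apply: le_trans h _; apply: lee_wpmul2l => //; exact: Lnorm_ge0.
rewrite -[X in (_ <= X * _)%E]fineK; last by rewrite ge0_fin_numE ?Lnorm_ge0//; case: Lc.
rewrite -EFinM lee_fin normrM gtr0_norm// => h.
by rewrite mulrAC ler_pdivlMr// mulrC.
Qed.

Lemma dyadB k (g h : R -> R) : (time T).-integrable setT (EFin \o g) ->
  (time T).-integrable setT (EFin \o h) ->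
  forall t, dyad T (time T) k (fun t => g t - h t) t =
    dyad T (time T) k g t - dyad T (time T) k h t.
Proof.
move=> ig ih t; rewrite /dyad /stepf -sumrB; apply: eq_bigr => l _.
by rewrite avgB// mulrBl.
Qed.

Lemma in_Lp_pair phi (w : B) : in_Lp mu q phi ->
  in_Lp (time T) p1 (fun t => pair mu phi (field_of w t)).
Proof.
move=> Lphi; split; first exact: mpair.
have Lw := Lp_field_of w.
have mf : measurable_fun setT (fun t : R => fnorm p2 (field_of w t)) by exact: measurable_fnorm.
have ff : ('T_p1[fun t => fnorm p2 (field_of w t)] < +oo)%E.
  rewrite -mixed_norm_field//; apply: le_lt_trans (bfun_fin (repr w)).
  rewrite le_eqVlt; apply/orP; left; apply/eqP; apply: ae_eq_Lnorm.
  by apply: (@filterS _ _ (ae_filter_ringOfSetsType (time T))) (field_ofE w) => t ->.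
have fN : 'T_p1[fun t => fnorm p2 (field_of w t)] \is a fin_num.
  by rewrite ge0_fin_numE// Lnorm_ge0.
have Nfin : Lnorm mu q%:E (EFin \o phi) \is a fin_num by rewrite ge0_fin_numE ?Lnorm_ge0//; case: Lphi.
have fNle : ('T_p1[fun t => fnorm p2 (field_of w t)] <=
    (fine ('T_p1[fun t => fnorm p2 (field_of w t)]))%:E)%E.
  by rewrite fineK.
have := @Lnorm_le_scale _ (measurableTypeR R) R (time T) p1 (fine (Lnorm mu q%:E (EFin \o phi))) _ _ p10 mf fNle.
move=> h; apply: le_lt_trans (ltry _); apply: le_trans h.
apply: ae_le_Lnorm => //; apply: aeW => t /=; rewrite lee_fin.
rewrite [leRHS]ger0_norm ?mulr_ge0 ?fnorm_ge0 ?fine_ge0 ?Lnorm_ge0//.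
rewrite -lee_fin EFinM (fnormE (Lw.1 t)) (fineK Nfin).
by apply: (pair_le hp2 q1 pq) => //; exact: Lw.1.
Qed.

Lemma in_Lp_diff phi (w z : B) : in_Lp mu q phi -> in_Lp (time T) p1 (pair_diff phi w z).
Proof. by move=> Lphi; apply: in_LpB => //; exact: in_Lp_pair. Qed.

Let ipair phi (w : B) : in_Lp mu q phi ->
  (time T).-integrable setT (EFin \o (fun t => pair mu phi (field_of w t))).
Proof. by move=> Lphi; exact: (in_Lp_integrable T0 tE p11 (in_Lp_pair w Lphi)). Qed.

Lemma integrable_coef m j (w : B) :
  (time T).-integrable setT (EFin \o coef m j (field_of w)).
Proof.
have -> : coef m j (field_of w) = (fun t => (mesh tau m)^-1 * pair mu (\1_(cell tau m j)) (field_of w t)).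
  by apply/funext => t; rewrite coef_pair.
by apply: integrableZ_EFin => //; apply: ipair; exact: Lcell.
Qed.

(** The seminorms live in L^p1 of time and do not control an L^pb norm with pb > p1. Averages over
    the cells of level [k] are however continuous in L^p1, and there are finitely many of them; the
    bound on the coefficient itself is recovered later by Fatou. *)
Lemma closed_coef (pb : R) m j k (b : R) : 1 <= pb ->
  closed [set w : B | ('T_pb[dyad T (time T) k (coef m j (field_of w))] <= b%:E)%E].
Proof.
move=> pb1; have pb0 : 0 < pb by exact: lt_le_trans pb1.
pose phi (_ : nat) : R -> R := \1_(cell tau m j).
apply: (@closed_weak 1 phi) => [i _|w hw]; first exact: Lcell.
pose c l := fine ('T_r[\1_(cell T k l)]) / mesh T k.
have c0 l : 0 <= c l by rewrite divr_ge0 ?fine_ge0 ?Lnorm_ge0// mesh_ge0.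
pose C := (mesh tau m)^-1 * (\sum_(l < 2 ^ k) c l).
have C0 : 0 <= C by rewrite mulr_ge0 ?invr_ge0 ?mesh_ge0// sumr_ge0.
have Tp : 0 <= T `^ pb^-1 by exact: powR_ge0.
apply: (@lee_addeps _ _ b (C * T `^ pb^-1)) => [|e e0]; first exact: mulr_ge0.
have [w' /= hw' /(_ 0%N isT) de] := hw e e0.
pose d := dyad T (time T) k (fun t => (mesh tau m)^-1 * pair_diff (phi 0%N) w' w t).
have Ld : in_Lp (time T) p1 (pair_diff (phi 0%N) w' w) by apply: in_Lp_diff; exact: Lcell.
have dE t : d t = dyad T (time T) k (coef m j (field_of w')) t - dyad T (time T) k (coef m j (field_of w)) t.
  rewrite -dyadB; [|exact: integrable_coef|exact: integrable_coef].
  by congr (dyad _ _ _ _ _); apply/funext => s; rewrite !coef_pair -mulrBr.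
have db t : `|d t| <= C * e.
  have [tT|tT] := pselect (`[0, T[%classic t); last first.
    by rewrite /d /dyad stepf_out// normr0 mulr_ge0// ltW.
  have [l lk tl] := cell_ex T0 k tT.
  rewrite /d /dyad (stepfE T0 _ lk tl) avgZ; last first.
    exact: (in_Lp_integrable T0 tE p11 Ld).
  rewrite normrM ger0_norm ?invr_ge0 ?mesh_ge0// /C -mulrA ler_wpM2l ?invr_ge0 ?mesh_ge0//.
  apply: le_trans (avg_le_p1 k l Ld de) _; rewrite ler_wpM2r ?(ltW e0)//.
  rewrite (bigD1 (Ordinal lk))//= lerDl sumr_ge0// => l' _; exact: c0.
have mdy (v : R -> R) : measurable_fun setT (dyad T (time T) k v) by exact: measurable_dyad.
have bd : ('T_pb[d] <= (C * e * T `^ pb^-1)%:E)%E.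
  by apply: Lnorm_le_bounded => //; rewrite mulr_ge0// ltW.
have -> : e * (C * T `^ pb^-1) = C * e * T `^ pb^-1 by rewrite mulrA [e * C]mulrC.
apply: (@Lnorm_le_add _ (measurableTypeR R) R (time T) pb _ _ _ _ _ pb1 (mdy _) (mdy _) _ hw' bd) => t.
by rewrite -/(d t) dE distrC; exact: ler_norm_distD.
Qed.

Lemma Lnorm1_le_p1 (g : R -> R) (a : R) : measurable_fun setT g ->
  ('T_p1[g] <= a%:E)%E -> ('T_1[g] <= (T `^ r^-1 * a)%:E)%E.
Proof.
move=> mg ga; have r0 : 0 < r by exact: lt_trans r1.
have mc : measurable_fun setT (cst 1 : R -> R) by exact: measurable_cst.
have := hoelder (time T) mg mc p10 r0 pr => h.
have -> : 'T_1[g] = 'T_1[(g \* cst 1)%R] by congr Lnorm; apply/funext => t /=; rewrite mulr1.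
apply: le_trans h _.
have c1 : ('T_r[cst (1%R : R)] <= (1 * T `^ r^-1)%:E)%E.
  by apply: Lnorm_le_bounded => // t; rewrite normr1.
rewrite mul1r in c1; have -> : (T `^ r^-1 * a)%:E = (a%:E * (T `^ r^-1)%:E)%E by rewrite -EFinM mulrC.
by apply: lee_pmul => //; exact: Lnorm_ge0.
Qed.

Definition shift_norm (s : R) (g : R -> R) : \bar R :=
  (\int[leb]_(t in `[0%R, (T - s)%R]) `|g (t + s) - g t|%:E)%E.

Lemma Lnorm1_time (g : R -> R) : 'T_1[g] = (\int[leb]_(t in `[0%R, T[) `|g t|%:E)%E.
Proof. by rewrite Lnorm1 (integralT_lebesgueE tE). Qed.

(** The difference of two pairings enters on [0, T - s] and, translated, on [s, T]. Each contributes
    at most its L^1 norm on the whole interval, bounded through Hölder by T^(1/r) e; hence the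
    factor 2. *)
Lemma closed_shift (s : R) phi (b : R) : in_Lp mu q phi -> 0 < s -> s < T ->
  closed [set w : B | (shift_norm s (fun t => pair mu phi (field_of w t)) <= b%:E)%E].
Proof.
move=> Lphi s0 sT.
apply: (@closed_weak 1 (fun _ => phi)) => [//|w hw].
have Tr : 0 <= T `^ r^-1 by exact: powR_ge0.
apply: (@lee_addeps _ _ b (T `^ r^-1 * 2)) => [|e e0]; first exact: mulr_ge0.
have [w' /= hw' /(_ 0%N isT) de] := hw e e0.
pose d := pair_diff phi w' w.
have md : measurable_fun setT d by exact: mdiff.
have d1 : (\int[leb]_(t in `[0%R, T[) `|d t|%:E <= (T `^ r^-1 * e)%:E)%E.
  by rewrite -Lnorm1_time; apply: Lnorm1_le_p1.
pose I : set (measurableTypeR R) := [set` `[0, T - s]].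
have mI : measurable I by exact: measurable_itv.
have mabs (h : R -> R) : measurable_fun setT h -> measurable_fun setT (fun t => `|h t|%:E).
  by move=> mh; apply/measurable_EFinP; exact: measurableT_comp.
have mshift (h : R -> R) : measurable_fun setT h -> measurable_fun setT (fun t : R => h (t + s)).
  by move=> mh; exact: (measurableT_comp mh (measurable_shift s)).
have b1 : (\int[leb]_(t in I) `|d t|%:E <= (T `^ r^-1 * e)%:E)%E.
  apply: (le_trans _ d1); apply: ge0_subset_integral => //.
  - by apply: measurable_funTS; exact: mabs.
  - by move=> t; rewrite /I /= !in_itv/= => /andP[-> h]; apply: le_lt_trans h _; rewrite ltrBlDr ltrDl.
have b2 : (\int[leb]_(t in I) `|d (t + s)%R|%:E <= (T `^ r^-1 * e)%:E)%E.
  have IE : I = (fun t : R => t + s) @^-1` [set` `[s, T]].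
    apply/seteqP; split => t; rewrite /I /= !in_itv/= => /andP[h1 h2]; apply/andP; lra.
  rewrite IE -(@ge0_lebesgue_integral_shift _ s _ (fun t => `|d t|%:E)%E)//; last exact: mabs.
  rewrite -integral_itv_bndo_bndc; last by apply: measurable_funTS; exact: mabs.
  apply: (le_trans _ d1); apply: ge0_subset_integral => //.
  - by apply: measurable_funTS; exact: mabs.
  - by move=> t; rewrite /= !in_itv/= => /andP[h ->]; rewrite andbT; apply: le_trans h; exact: ltW.
have mg (v : B) : measurable_fun setT (fun t => pair mu phi (field_of v t)) by exact: mpair.
pose g (v : B) (t : R) := pair mu phi (field_of v t).
have mgs (v : B) : measurable_fun setT (fun t : R => g v (t + s) - g v t).
  by apply: measurable_funB; [exact: (mshift _ (mg v))|exact: mg].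
have mI1 (h : R -> R) : measurable_fun setT h -> measurable_fun I (fun t : R => `|h t|%:E).
  by move=> mh; apply: measurable_funTS; exact: mabs.
rewrite /shift_norm.
apply: (@le_trans _ _ (\int[leb]_(t in I) (`|g w' (t + s) - g w' t|%:E + (`|d (t + s)|%:E + `|d t|%:E)))%E).
  apply: ge0_le_integral => //.
  - exact: (mI1 _ (mgs w)).
  - by apply: emeasurable_funD; [exact: (mI1 _ (mgs w'))|apply: emeasurable_funD; [exact: (mI1 _ (mshift _ md))|exact: (mI1 _ md)]].
  - move=> t _; rewrite -!EFinD lee_fin /d /pair_diff -/(g w' t) -/(g w t) -/(g w' (t + s)) -/(g w (t + s)).
    have -> : g w (t + s) - g w t = (g w' (t + s) - g w' t) + (- (g w' (t + s) - g w (t + s)) + (g w' t - g w t)) by ring.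
    apply: le_trans (ler_normD _ _) _; rewrite lerD2l.
    by apply: le_trans (ler_normD _ _) _; rewrite normrN.
rewrite ge0_integralD//; last 3 first.
- exact: (mI1 _ (mgs w')).
- by move=> t _; rewrite -EFinD lee_fin addr_ge0.
- by apply: emeasurable_funD; [exact: (mI1 _ (mshift _ md))|exact: (mI1 _ md)].
rewrite ge0_integralD//; last 2 first.
- exact: (mI1 _ (mshift _ md)).
- exact: (mI1 _ md).
have -> : e * (T `^ r^-1 * 2) = T `^ r^-1 * e + T `^ r^-1 * e by ring.
by rewrite EFinD; apply: leeD => //; rewrite EFinD; exact: leeD.
Qed.

End closed_constraints.

(** * Transfer of the translation bound from bumps to arc indicators *)

Section smooth_approximation.
Context {R : realType} (T p1 p2 : R).
Hypothesis T0 : 0 < T.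
Hypothesis hp1 : 1 < p1.
Hypothesis hp2 : 1 < p2.
Local Notation tau := (2 * pi : R).
Local Notation mu := (@circle R).
Local Notation leb := (@lebesgue_measure R).
Local Notation q := (dual_exponent p2).
Local Notation r := (dual_exponent p1).
Local Notation B := (bochner T p1 hp2).
Local Notation "'N_ p [ f ]" := (Lnorm mu p%:E (EFin \o f)).
Local Notation "'T_ p [ f ]" := (Lnorm (time T) p%:E (EFin \o f))
  (at level 10, p at level 9, f at level 200, format "''T_' p [ f ]").

Let tau0 : 0 < tau. Proof. exact: tau_gt0. Qed.
Let tE (A : set (measurableTypeR R)) : measurable A ->
  time T A = lebesgue_measure (A `&` `[0, T[%classic).
Proof. exact: timeE. Qed.
Let q1 : 1 < q. Proof. exact: dual_exponent_gt1. Qed.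
Let q0 : 0 < q. Proof. exact: lt_trans q1. Qed.
Let pq : p2^-1 + q^-1 = 1. Proof. exact: dual_exponent_conj. Qed.
Let p10 : 0 < p1. Proof. exact: lt_trans hp1. Qed.
Let p11 : 1 <= p1. Proof. exact: ltW. Qed.

Definition psi m j l : R -> R :=
  bump l ((j%:R * mesh tau m + j.+1%:R * mesh tau m) / 2)
    (cos ((j.+1%:R * mesh tau m - j%:R * mesh tau m) / 2)).

Let psi_norm m j l x : `|psi m j l x| <= 1.
Proof. by rewrite ger0_norm ?bump_ge0// bump_le1. Qed.

Lemma in_Lp_psi m j l : in_Lp mu q (psi m j l).
Proof.
apply: (in_Lp_bounded tau0 circleE (ltW q1) (C := 1)); first exact: measurable_bump.
exact: psi_norm.
Qed.

(** Dominated convergence on the circle: the bumps converge except possibly at 0 and the two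
    endpoints of the arc, and the differences are bounded by 1. *)
Lemma psi_approx m j (e : R) : (j < 2 ^ m)%N -> 0 < e ->
  exists l, ('N_q[(\1_(cell tau m j) \- psi m j l)%R] <= e%:E)%E.
Proof.
move=> jm e0; pose a := j%:R * mesh tau m; pose b := j.+1%:R * mesh tau m.
have h0 := mesh_gt0 tau0 m.
have a0 : 0 <= a by rewrite mulr_ge0// ltW.
have ab : a < b by rewrite /a /b ltr_pM2r// ltr_nat.
have btau : b <= tau.
  by rewrite -(mesh_total tau m) /b ler_pM2r// ler_nat.
pose g l (x : R) := (`|\1_(cell tau m j) x - psi m j l x| `^ q)%:E.
have mpsi l : measurable_fun setT (psi m j l) by exact: measurable_bump.
have mg l : measurable_fun setT (g l).
  apply/measurable_EFinP; apply: (measurable_normpowR q (f := fun x => \1_(cell tau m j) x - psi m j l x)).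
  by apply: measurable_funB => //; exact: mpsi.
have d01 l x : `|\1_(cell tau m j) x - psi m j l x| <= 1.
  have h1 := bump_ge0 l ((a + b) / 2) (cos ((b - a) / 2)) x.
  have h2 := bump_le1 l ((a + b) / 2) (cos ((b - a) / 2)) x.
  rewrite -/(psi m j l x) in h1 h2; rewrite indicE; case: (_ \in _) => /=; rewrite ler_norml; lra.
have null c : mu.-negligible [set c : R].
  exists [set c]; split => //; rewrite circleE//.
  apply/eqP; rewrite eq_le measure_ge0 andbT.
  rewrite -(lebesgue_measure_set1 c); apply: le_measure; rewrite ?inE//=.
  by apply: measurableI.
have cv : {ae mu, forall x, setT x -> g l x @[l --> \oo] --> (0 : \bar R)%E}.
  have : mu.-negligible ([set 0] `|` ([set a] `|` [set b])).
    by apply: negligibleU => //; apply: negligibleU.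
  move=> h2; have h1 := ae_in_domain (@circleE R).
  apply: (@filterS2 _ _ (ae_filter_ringOfSetsType mu) _ (fun x : R => ~ ([set 0] `|` ([set a] `|` [set b])) x) _ _ h1).
    move=> x; rewrite /= in_itv/= => /andP[x0 xt] hx _.
    have hb : 0 < x < 2 * pi.
      by rewrite xt andbT lt_neqAle x0 andbT; apply/negP => /eqP xx; apply: hx; left.
    have xa : x != a by apply/negP => /eqP xx; apply: hx; right; left.
    have xb : x != b by apply/negP => /eqP xx; apply: hx; right; right.
    have c := bump_cvg a0 ab btau hb xa xb.
    apply: cvg_EFin; first exact: nearW.
    have := @cvg_powR R nat \oo _ (fun l => `|\1_(cell tau m j) x - psi m j l x|) 0 q.
    rewrite powR0 ?gt_eqF//; apply => //.
    rewrite -(normr0 R); apply: cvg_norm; rewrite -(subrr (\1_(cell tau m j) x)).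
    by apply: cvgB; [exact: cvg_cst|exact: c].
  by case: h2 => N [mN N0 hN]; exists N; split => // x /= hx; apply: hN; apply: contrapT.
have i1 : mu.-integrable setT (EFin \o (cst (1 : R))).
  apply: (in_Lp_integrable tau0 circleE (lexx 1)).
  by apply: (in_Lp_bounded tau0 circleE (lexx 1) (C := 1)) => // t; rewrite normr1.
have gb : {ae mu, forall x, forall l, setT x -> (`|g l x| <= (EFin \o cst (1%R : R)) x)%E}.
  apply: aeW => x l _; rewrite /g /= lee_fin ger0_norm ?powR_ge0//.
  have := @ge0_ler_powR R q (ltW q0) _ 1 (normr_ge0 _) ler01 (d01 l x).
  by rewrite powR1.
have [_ _] := @dominated_convergence _ (measurableTypeR R) R mu setT measurableT g (cst 0%E)
  (EFin \o cst 1) mg (measurable_cst _) cv i1 gb.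
rewrite integral0 => c.
have eq0 : 0 < e `^ q by exact: powR_gt0.
move: c => /fine_cvgP[/= fin /cvgr0Pnorm_le /(_ _ eq0) c].
have [l [/= fl]] := filter_ex (filterI fin c).
rewrite ger0_norm ?fine_ge0//; last by apply: integral_ge0 => x _; rewrite lee_fin powR_ge0.
move=> hl; exists l; apply/Lnorm_leP => //; first exact: ltW.
by rewrite -lee_fin fineK in hl.
Qed.

(** The translation bound holds for the smooth [psi0], not for the indicator. Exchanging them costs
    [eta * M] up to constants, twice because time averaging is an L^1 contraction; this part does
    not decay with [k] and is made small by [eta]. *)
Lemma coef_dyad_error (w : B) (M eta b rho : R) m j psi0 i0 :
  in_Lp mu q psi0 -> 0 <= b -> 0 < rho < 1 ->
  ('T_p1[fun t => fnorm p2 (field_of w t)] <= M%:E)%E ->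
  ('N_q[(\1_(cell tau m j) \- psi0)%R] <= eta%:E)%E ->
  (forall i, (i0 <= i)%N ->
    (shift_norm T (mesh T i.+1) (fun t => pair mu psi0 (field_of w t)) <= (b * rho ^+ i)%:E)%E) ->
  forall k, (i0 <= k)%N ->
  ('T_1[(coef m j (field_of w) \- dyad T (time T) k (coef m j (field_of w)))%R] <=
    ((mesh tau m)^-1 * (2 * (T `^ r^-1 * (eta * M)) + b * rho ^+ k / (1 - rho)))%:E)%E.
Proof.
move=> Lpsi b0 rho01 hM heta hs k ik.
have h0 : 0 < (mesh tau m)^-1 by rewrite invr_gt0 mesh_gt0.
set h := (mesh tau m)^-1 in h0 *.
have Lw := Lp_field_of w.
have Lc : in_Lp mu q (\1_(cell tau m j)) by apply: (in_Lp_indic_cell tau0 circleE); exact: ltW.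
pose c := coef m j (field_of w).
pose g (t : R) : R := h * pair mu psi0 (field_of w t).
have ig : (time T).-integrable setT (EFin \o g).
  apply: integrableZ_EFin => //.
  exact: (in_Lp_integrable T0 tE p11 (in_Lp_pair hp1 w Lpsi)).
have ic : (time T).-integrable setT (EFin \o c) by exact: integrable_coef.
have mc : measurable_fun setT c by exact: Lw.2.
have mpsi := measurable_field_pair hp2 Lw Lpsi.
have mg : measurable_fun setT g by exact: measurable_funM.
have eta0 : 0 <= eta by rewrite -lee_fin; apply: le_trans heta; exact: Lnorm_ge0.
have mf : measurable_fun setT (fun t : R => fnorm p2 (field_of w t)) by exact: measurable_fnorm.
have cg : ('T_1[(c \- g)%R] <= (h * (T `^ r^-1 * (eta * M)))%:E)%E.
  have e1 : ('T_p1[(fun t => eta * fnorm p2 (field_of w t))%R] <= (`|eta| * M)%:E)%E.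
    exact: (@Lnorm_le_scale _ (measurableTypeR R) R (time T) p1 _ _ _ p10 mf hM).
  rewrite (ger0_norm eta0) in e1.
  have me : measurable_fun setT (fun t : R => eta * fnorm p2 (field_of w t)) by exact: measurable_funM.
  have e2 := Lnorm1_le_p1 T0 hp1 me e1.
  have := @Lnorm_le_scale _ (measurableTypeR R) R (time T) 1 h _ _ ltr01 me e2.
  rewrite (gtr0_norm h0); apply: le_trans; apply: ae_le_Lnorm => //; apply: aeW => t /=.
  rewrite lee_fin /c coef_pair -mulrBr !normrM ler_pM2l ?normr_gt0 ?gt_eqF//.
  rewrite -normrM [leRHS]ger0_norm ?mulr_ge0 ?fnorm_ge0//.
  rewrite -(pairBl hp2 q1 pq Lc Lpsi); last exact: Lw.1.
  rewrite -lee_fin EFinM fnormE; last exact: Lw.1.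
  apply: le_trans (pair_le hp2 q1 pq _ _) _; [|exact: Lw.1|].
    by apply: in_LpB => //; exact: ltW.
  by apply: lee_wpmul2r => //; exact: Lnorm_ge0.
have ge : ('T_1[(g \- dyad T (time T) k g)%R] <= (h * b * rho ^+ k / (1 - rho))%:E)%E.
  apply: (dyad_error_geometric T0 tE (k0 := i0)) => //; first by rewrite mulr_ge0// ltW.
  move=> i ii; apply: le_trans (dyad_increment T0 tE i ig) _.
  have -> : (\int[leb]_(t in `[0%R, (T - mesh T i.+1)%R]) `|(g (t + mesh T i.+1) - g t)%R|%:E =
    h%:E * shift_norm T (mesh T i.+1) (fun t => pair mu psi0 (field_of w t)))%E.
    rewrite /shift_norm -ge0_integralZl_EFin//; last exact: ltW.
      by apply: eq_integral => t _; rewrite /g -mulrBr normrM gtr0_norm// EFinM.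
    apply: measurable_funTS; apply/measurable_EFinP; apply: measurableT_comp => //.
    apply: measurable_funB => //.
    exact: (measurableT_comp mpsi (measurable_shift (mesh T i.+1))).
  by rewrite -mulrA EFinM; apply: lee_wpmul2l; [rewrite lee_fin ltW|exact: hs].
have dd : ('T_1[(dyad T (time T) k c \- dyad T (time T) k g)%R] <= (h * (T `^ r^-1 * (eta * M)))%:E)%E.
  apply: le_trans cg.
  have -> : (dyad T (time T) k c \- dyad T (time T) k g)%R = dyad T (time T) k (c \- g).
    by apply/funext => t; apply/esym; exact: dyadB.
  by apply: Lnorm_dyad_le => //; exact: measurable_funB.
have -> : h * (2 * (T `^ r^-1 * (eta * M)) + b * rho ^+ k / (1 - rho)) =
  h * (T `^ r^-1 * (eta * M)) + (h * b * rho ^+ k / (1 - rho) + h * (T `^ r^-1 * (eta * M))).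
  by ring.
have mdy (v : R -> R) : measurable_fun setT (dyad T (time T) k v) by exact: measurable_dyad.
exact: (@Lnorm_dist3 _ (measurableTypeR R) R (time T) _ _ _ _ _ _ _ _ (lexx 1) mc mg (mdy _) (mdy _) cg ge dd).
Qed.

End smooth_approximation.

(** * Tightness *)

Lemma geometric_nneseries_le (R : realType) (x : (\bar R)^nat) (a rho : R) :
  0 <= a -> 0 < rho < 1 -> (forall i, 0 <= x i)%E ->
  (forall i, (x i <= (a * rho ^+ i)%:E)%E) ->
  (\sum_(i <oo) x i <= (a / (1 - rho))%:E)%E.
Proof.
move=> a0 /andP[r0 r1] x0 xa; have r1' : 0 < 1 - rho by rewrite subr_gt0.
apply: lime_le; first exact: is_cvg_nneseries.
apply: nearW => n; apply: (@le_trans _ _ (a * (1 - rho ^+ n) / (1 - rho))%:E); last first.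
  rewrite lee_fin ler_pM2r ?invr_gt0// ler_piMr// lerBlDr lerDl.
  by rewrite exprn_ge0// ltW.
elim: n => [|n IH]; first by rewrite big_nil expr0 subrr mulr0 mul0r.
rewrite big_nat_recr//=; apply: le_trans (leeD IH (xa n)) _.
rewrite -EFinD lee_fin le_eqVlt; apply/orP; left; apply/eqP.
by rewrite exprS; field; rewrite gt_eqF.
Qed.

Section markov.
Context {R : realType} d (Omega : measurableType d) (P : probability Omega R)
  (X : ptopologicalType).

Lemma open_borel (U : set X) : open U -> measurable (U : set (borel X)).
Proof. by move=> oU; exact: sub_sigma_algebra. Qed.

(** The function [f] dominates the event without itself being an event variable: measurability is
    provided by the open set [U]. *)
Lemma markov_open (Q : {RV P >-> borel X}) (f : Omega -> \bar R) (U : set X) (c C : R) :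
  open U -> 0 < c -> (forall w, 0 <= f w)%E -> (forall w, U (Q w) -> (c%:E <= f w)%E) ->
  (\int[P]_w f w <= C%:E)%E -> (distribution P Q U <= (C / c)%:E)%E.
Proof.
move=> oU c0 f0 Uf fC; rewrite /distribution /pushforward.
have mA : measurable (Q @^-1` U).
  by rewrite -[X in measurable X]setTI; apply: measurable_funPT => //; exact: open_borel.
have := lower_markov P mA (ltW c0) f0 Uf.
move=> /le_trans /(_ fC) h.
have Pf : P (Q @^-1` U) \is a fin_num by exact: fin_num_measure.
move: h; rewrite /= -(fineK Pf); move: (fine _) => y.
by rewrite -EFinM !lee_fin ler_pdivlMr// mulrC.
Qed.

End markov.

(** * Pathwise domination of the constraints by the given quantities *)

Section dominations.
Context {R : realType} (T p1 p2 : R).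
Hypothesis T0 : 0 < T.
Hypothesis hp1 : 1 < p1.
Hypothesis hp2 : 1 < p2.
Local Notation tau := (2 * pi : R).
Local Notation mu := (@circle R).
Local Notation leb := (@lebesgue_measure R).
Local Notation q := (dual_exponent p2).
Local Notation B := (bochner T p1 hp2).
Local Notation "'T_ p [ f ]" := (Lnorm (time T) p%:E (EFin \o f))
  (at level 10, p at level 9, f at level 200, format "''T_' p [ f ]").

Let tau0 : 0 < tau. Proof. exact: tau_gt0. Qed.
Let tE (A : set (measurableTypeR R)) : measurable A ->
  time T A = lebesgue_measure (A `&` `[0, T[%classic).
Proof. exact: timeE. Qed.
Let q1 : 1 < q. Proof. exact: dual_exponent_gt1. Qed.
Let pq : p2^-1 + q^-1 = 1. Proof. exact: dual_exponent_conj. Qed.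
Let p10 : 0 < p1. Proof. exact: lt_trans hp1. Qed.

Lemma mixed_norm_field_of (w : B) :
  mixed_norm T p1 p2 w = 'T_p1[fun t => fnorm p2 (field_of w t)].
Proof.
rewrite -mixed_norm_field//; last exact: Lp_field_of.
apply: ae_eq_Lnorm.
by apply: (@filterS _ _ (ae_filter_ringOfSetsType (time T))) (field_ofE w) => t ->.
Qed.

Lemma dnorm_le_mixed m (w : B) :
  ('T_p1[fun t => dnorm p2 m (field_of w t)] <= mixed_norm T p1 p2 w)%E.
Proof.
rewrite mixed_norm_field_of; apply: ae_le_Lnorm => //; apply: aeW => t /=.
rewrite lee_fin [leLHS]ger0_norm; last exact: snorm_ge0.
rewrite [leRHS]ger0_norm; last exact: fnorm_ge0.
by apply: dnorm_le => //; exact: (Lp_field_of w).1.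
Qed.

(** The mesh times a cell average is an integral over the cell, at most the L^1 norm in space;
    averaging in time then does not increase the L^pb norm. *)
Lemma coef_le_mixed (pb : R) m j k (w : B) (M : R) : 1 <= pb ->
  (mixed_norm T pb 1 w <= M%:E)%E ->
  ('T_pb[dyad T (time T) k (coef m j (field_of w))] <= ((mesh tau m)^-1 * M)%:E)%E.
Proof.
move=> pb1 wM; have pb0 : 0 < pb by exact: lt_le_trans pb1.
have Lw := Lp_field_of w.
have mc : measurable_fun setT (coef m j (field_of w)) by exact: Lw.2.
apply: le_trans (Lnorm_dyad_le T0 tE k pb1 mc) _.
have h0 := mesh_gt0 tau0 m.
have mmc : measurable_fun setT (fun t : R => mesh tau m * coef m j (field_of w) t) by exact: measurable_funM.
have bb : ('T_pb[fun t => (mesh tau m * coef m j (field_of w) t)%R] <= M%:E)%E.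
  apply: le_trans wM; apply: ae_le_Lnorm => //.
  apply: (@filterS _ _ (ae_filter_ringOfSetsType (time T))) (field_ofE w) => t <-.
  rewrite [leRHS]gee0_abs ?Lnorm_ge0// Lnorm1.
  have ic := in_Lp_integrable tau0 circleE (ltW hp2) (Lw.1 t).
  have icc := @integrable_cell R tau mu m j _ ic.
  rewrite /comp /coef /avg mulVKf ?gt_eqF//= EFin_normr_Rintegral//.
  apply: le_trans (le_abse_integral _ _ _) _ => //; first by case/integrableP : icc.
  apply: ge0_subset_integral => //.
  by apply/measurable_EFinP; apply: measurableT_comp => //; exact: (Lw.1 t).1.
have := @Lnorm_le_scale _ (measurableTypeR R) R (time T) pb (mesh tau m)^-1 _ _ pb0 mmc bb.
rewrite ger0_norm ?invr_ge0 ?(ltW h0)//.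
rewrite (_ : (fun t => _) = coef m j (field_of w))//.
by apply/funext => t; rewrite mulKf// gt_eqF.
Qed.

(** [field_of w] must agree with [w] both at [t] and at [t + s]. The exceptional times form a null
    set and its translate, null by translation invariance. *)
Lemma shift_norm_le_modulus (s theta : R) phi (w : B) : in_Lp mu q phi ->
  0 < s < theta -> s < T ->
  (shift_norm T s (fun t => pair mu phi (field_of w t)) <= translation_modulus T theta phi w)%E.
Proof.
move=> Lphi /andP[s0 st] sT.
have Lw := Lp_field_of w.
have -> : shift_norm T s (fun t => pair mu phi (field_of w t)) =
    (\int[leb]_(t in `[0%R, (T - s)%R]) `|pairing phi (fun x => w (t + s) x - w t x)%R|%:E)%E.
  rewrite /shift_norm integral_mkcond [RHS]integral_mkcond.
  apply: ae_eq_lower_integral.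
  - by move=> t; rewrite /patch; case: ifP.
  - by move=> t; rewrite /patch; case: ifP.
  have [N [mN N0 hN]] := field_ofE w.
  (* A null set for [time T] may be large outside [0, T]; intersecting makes it null for Lebesgue
     measure. *)
  pose N1 : set (measurableTypeR R) := N `&` `[0, T].
  have mN1 : measurable N1 by apply: measurableI => //; exact: measurable_itv.
  pose sh := (fun x : measurableTypeR R => (x + s : measurableTypeR R)).
  have msh : measurable (sh @^-1` N1).
    by rewrite -[X in measurable X]setTI; exact: (measurable_shift s).
  exists (N1 `|` sh @^-1` N1); split.
  - exact: measurableU.
  - have n0 : leb N1 = 0%E by exact: N0.
    have n1 : leb (sh @^-1` N1) = 0%E by rewrite -[RHS]n0; exact: (lebesgue_measure_shift s mN1).
    apply/eqP; rewrite eq_le measure_ge0 andbT.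
    have := @measureU2 _ _ _ leb N1 (sh @^-1` N1) mN1 msh.
    move=> /le_trans; apply; rewrite -[leRHS]adde0.
    by apply: leeD; rewrite le_eqVlt; apply/orP; left; apply/eqP; [exact: n0|exact: n1].
  move=> t; apply: contra_notP => /not_orP[h1 h2].
  rewrite /= /patch; case: ifPn => // /set_mem; rewrite /= in_itv/= => /andP[t0 tT].
  have e1 : field_of w t = w t.
    apply: contrapT => ne; apply: h1; split; first by apply: hN.
    by rewrite /= in_itv/= t0/=; lra.
  have e2 : field_of w (t + s) = w (t + s).
    apply: contrapT => ne; apply: h2; split; first by apply: hN.
    by rewrite /sh /= in_itv/= addr_ge0 ?(ltW s0)//= -lerBrDr.
  rewrite -(pairBr hp2 q1 pq Lphi (Lw.1 _) (Lw.1 _)) e1 e2.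
  by [].
apply: ereal_sup_ubound; exists s => //.
by rewrite /= in_itv/= s0 st.
Qed.

End dominations.

(** * The compact set of fields satisfying all bounds *)

Section compact_set.
Context {R : realType} (T p1 p2 pb : R).
Hypothesis T0 : 0 < T.
Hypothesis hp1 : 1 < p1.
Hypothesis hp2 : 1 < p2.
Hypothesis hpb : p1 < pb.
Local Notation tau := (2 * pi : R).
Local Notation mu := (@circle R).
Local Notation q := (dual_exponent p2).
Local Notation r := (dual_exponent p1).
Local Notation B := (bochner T p1 hp2).
Local Notation "'T_ p [ f ]" := (Lnorm (time T) p%:E (EFin \o f))
  (at level 10, p at level 9, f at level 200, format "''T_' p [ f ]").

Let tau0 : 0 < tau. Proof. exact: tau_gt0. Qed.
Let tE (A : set (measurableTypeR R)) : measurable A ->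
  time T A = lebesgue_measure (A `&` `[0, T[%classic).
Proof. exact: timeE. Qed.
Let p11 : 1 <= p1. Proof. exact: ltW. Qed.
Let pb1 : 1 <= pb. Proof. by apply: ltW; exact: lt_trans hpb. Qed.
Let pb0 : 0 < pb. Proof. exact: lt_le_trans pb1. Qed.

(** One enumeration serves the indices (m, j, l) of bumps and (m, j, k) of averaged coefficients;
    the default value merely repeats a constraint. *)
Definition triple (n : nat) : nat * nat * nat := odflt (0, 0, 0)%N (unpickle n).

Lemma tripleP (x : nat * nat * nat) : exists n, triple n = x.
Proof. by exists (pickle x); rewrite /triple pickleK. Qed.

Definition test_function (n : nat) : R -> R :=
  let: (m, j, l) := triple n in psi m j l.

Lemma in_Lp_test n : in_Lp mu q (test_function n).
Proof. by rewrite /test_function; case: (triple n) => [[m j] l]; exact: in_Lp_psi. Qed.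

Variables (M Mb rho : R) (i0 : nat) (b : nat -> R).
Hypothesis M0 : 0 <= M.
Hypothesis rho01 : 0 < rho < 1.
Hypothesis b0 : forall n, 0 <= b n.

Definition dnorm_ok m : set B :=
  [set w | ('T_p1[fun t => dnorm p2 m (field_of w t)] <= M%:E)%E].

Definition coef_ok n : set B :=
  [set w | let: (m, j, k) := triple n in
    ('T_pb[dyad T (time T) k (coef m j (field_of w))] <= ((mesh tau m)^-1 * Mb)%:E)%E].

Definition shift_ok n i : set B :=
  [set w | (shift_norm T (mesh T (i + i0).+1)
     (fun t => pair mu (test_function n) (field_of w t)) <= (b n * rho ^+ (i + i0))%:E)%E].

(** The grouping follows the probability budget. Family 0 is paid by (i) and family 1 by (ii), in
    each case by one exceedance for the whole union; family n + 2 collects the shifts for test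
    function n, whose constant in (iii) depends on n. *)
Definition bad (n : nat) : set B :=
  match n with
  | 0%N => \bigcup_m ~` dnorm_ok m
  | 1%N => \bigcup_n ~` coef_ok n
  | n.+2 => \bigcup_i ~` shift_ok n i
  end.

Definition good : set B := ~` \bigcup_n bad n.

Lemma mesh_lt i : mesh T i.+1 < T.
Proof.
rewrite /mesh ltr_pdivrMr ?exprn_gt0// ltr_pMr//.
by rewrite exprn_egt1// ltr1n.
Qed.

Lemma open_shift_bad n i : open (~` shift_ok n i).
Proof.
apply: closed_openC; apply: closed_shift => //.
- exact: in_Lp_test.
- exact: mesh_gt0.
- exact: mesh_lt.
Qed.

Lemma open_bad n : open (bad n).
Proof.
case: n => [|[|n]]; apply: bigcup_open => k _.
- by apply: closed_openC; exact: closed_dnorm.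
- apply: closed_openC; rewrite /coef_ok; case: (triple k) => [[m j] l].
  exact: closed_coef.
- exact: open_shift_bad.
Qed.

Lemma closed_good : closed good.
Proof. by apply: open_closedC; apply: bigcup_open => n _; exact: open_bad. Qed.

Let good_dnorm w m : good w -> ('T_p1[fun t => dnorm p2 m (field_of w t)] <= M%:E)%E.
Proof.
move=> gw; apply: contrapT => h; apply: gw; exists 0%N => //; exists m => //.
Qed.

Let good_fnorm w : good w -> ('T_p1[fun t => fnorm p2 (field_of w t)] <= M%:E)%E.
Proof.
by move=> gw; apply: fnorm_le_of_dnorm => //; [exact: Lp_field_of|move=> m; exact: good_dnorm].
Qed.

Let good_coef w m j : good w ->
  ('T_pb[coef m j (field_of w)] <= ((mesh tau m)^-1 * Mb)%:E)%E.
Proof.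
move=> gw; apply: le_trans (dyad_Lnorm_fatou T0 tE pb0 (integrable_coef T0 hp1 m j w)) _.
apply: limn_einf_le => k; apply: contrapT => h; apply: gw; exists 1%N => //.
by have [n tn] := tripleP (m, j, k); exists n => //; rewrite /coef_ok /= tn.
Qed.

Let good_shift w n i : good w -> (i0 <= i)%N ->
  (shift_norm T (mesh T i.+1) (fun t => pair mu (test_function n) (field_of w t)) <=
    (b n * rho ^+ i)%:E)%E.
Proof.
move=> gw ii; apply: contrapT => h; apply: gw; exists n.+2 => //; exists (i - i0)%N => //.
by rewrite /shift_ok /= subnK.
Qed.

(** The order of choices matters: [eta] from [e] and [M], then a bump within [eta] of the indicator,
    and only then the level, since the constant [b n] of the geometric term depends on the bump. *)
Let good_dyad m j (e : R) : (j < 2 ^ m)%N -> 0 < e -> exists k0, forall k, (k0 <= k)%N ->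
  forall w, good w ->
  ('T_1[(coef m j (field_of w) \- dyad T (time T) k (coef m j (field_of w)))%R] <= e%:E)%E.
Proof.
move=> jm e0; have e2 : 0 < e / 2 by exact: divr_gt0.
pose h := (mesh tau m)^-1.
have h0 : 0 <= h by rewrite invr_ge0 mesh_ge0.
pose C := h * (2 * (T `^ r^-1 * M)).
have C0 : 0 <= C by rewrite !mulr_ge0// powR_ge0.
have eta0 : 0 < e / 2 / (C + 1) by rewrite divr_gt0// ltr_wpDl.
have [l hl] := psi_approx hp2 jm eta0.
have [n tn] := tripleP (m, j, l).
have testE : test_function n = psi m j l by rewrite /test_function tn.
have [r0 r1] := andP rho01; have r1' : 0 < 1 - rho by rewrite subr_gt0.
have : h * b n / (1 - rho) * rho ^+ k @[k --> \oo] --> (0 : R).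
  by apply: cvg_geometric; rewrite gtr0_norm.
move/cvgr0Pnorm_le => /(_ _ e2)[k1 _ hk1].
exists (maxn i0 k1) => k; rewrite geq_max => /andP[ik k1k] w gw.
have gs i (ii : (i0 <= i)%N) := @good_shift w n i gw ii.
rewrite -testE in hl.
apply: le_trans (coef_dyad_error T0 hp1 (in_Lp_test n) (b0 n) rho01 (good_fnorm gw) hl gs ik) _.
rewrite lee_fin.
have := hk1 k k1k; move=> /= /(le_trans (ler_norm _)) b2.
have b1 : h * (2 * (T `^ r^-1 * (e / 2 / (C + 1) * M))) <= e / 2.
  have -> : h * (2 * (T `^ r^-1 * (e / 2 / (C + 1) * M))) = C * (e / 2 / (C + 1)).
    by rewrite /C; ring.
  by rewrite mulrCA ler_piMr ?(ltW e2)// ler_pdivrMr ?ltr_wpDl// mul1r lerDl.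
rewrite -/h mulrDr [leRHS](splitr e); apply: lerD => //.
by apply: le_trans b2; rewrite le_eqVlt; apply/orP; left; apply/eqP; ring.
Qed.

Lemma compact_good : compact good.
Proof.
rewrite compact_ultra => F FU FK; have FP : ProperFilter F by exact: ultra_proper.
have h2 m j : (j < 2 ^ m)%N -> exists C : R, forall w, good w ->
    ('T_pb[coef m j (field_of w)] <= C%:E)%E.
  by move=> _; exists ((mesh tau m)^-1 * Mb) => w; exact: good_coef.
have [z [Lz zfin zcv]] := field_compactness T0 hp1 hp2 hpb FU FK (@Lp_field_of R T p1 p2 hp2)
  good_fnorm h2 (fun m j jm e e0 => @good_dyad m j e jm e0).
have [zb zbE] := field_bochner hp2 Lz zfin.
have cv : F --> zb.
  apply: subbase_cvg => U [phi [z1 [e [Lphi e0 ->]]]] /= hz.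
  move/Lfun_in_Lp : Lphi => /(_ hp2) Lphi.
  rewrite /weak_ball /= weak_seminormE// in hz.
  have sfin : wdist phi zb z1 \is a fin_num.
    by rewrite ge0_fin_numE ?Lnorm_ge0//; apply: lt_trans hz _; exact: ltry.
  rewrite -(fineK sfin) lte_fin in hz; set s := fine _ in hz.
  (* The ball around [z1] has radius [e] and contains [zb] at distance [s]; half of the remaining
     room keeps the inequality strict. *)
  have d0 : 0 < (e - s) / 2 by rewrite divr_gt0// subr_gt0.
  apply: filterS (zcv phi _ Lphi d0) => w hw; rewrite /weak_ball /= weak_seminormE//.
  apply: (@le_lt_trans _ _ ((e - s) / 2 + s)%:E); last by rewrite lte_fin; lra.
  have mp (v : B) : measurable_fun setT (fun t : R => pair mu phi (field_of v t)).
    exact: (measurable_field_pair hp2 (Lp_field_of v) Lphi).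
  have m1 : measurable_fun setT (pair_diff phi w zb) by exact: measurable_funB.
  have m2 : measurable_fun setT (pair_diff phi zb z1) by exact: measurable_funB.
  apply: (@Lnorm_le_add _ (measurableTypeR R) R (time T) p1 _ _ _ _ _ p11 m1 m2).
  - by move=> t; rewrite /pair_diff; exact: ler_distD.
  - apply: le_trans hw; rewrite le_eqVlt; apply/orP; left; apply/eqP; apply: ae_eq_Lnorm.
    apply: (@filterS2 _ _ (ae_filter_ringOfSetsType (time T))) zbE (field_ofE zb) => t e1 e2.
    rewrite /pair_diff /comp; congr (EFin (_ - _)).
    apply: pair_ae => //; [exact: Lphi.1|exact: ((Lp_field_of zb).1 t).1|exact: (Lz.1 t).1|].
    by rewrite e2.
  - by rewrite -/(wdist phi zb z1) -(fineK sfin).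
exists zb; split => //.
(* The estimates on the limit only give the bounds up to constants, such as M + 1 for M; its
   membership in [good] comes from closedness. *)
apply: closed_good => A nA.
have [w [gw Aw]] := filter_ex (filterI FK (cv A nA)).
by exists w.
Qed.

End compact_set.

Section smallness.
Context {R : realType}.

(** The Markov quotient for the threshold (|C| + 1) / dl. Adding 1 keeps the threshold positive when
    C = 0. *)
Lemma div_succ_le (C dl : R) : 0 < dl -> C / ((`|C| + 1) / dl) <= dl.
Proof.
move=> d0; have C1 : 0 < `|C| + 1 by rewrite ltr_wpDl.
rewrite invf_div mulrA ler_pdivrMr// mulrC ler_wpM2l ?(ltW d0)//.
by apply: le_trans (ler_norm C) _; rewrite lerDl.
Qed.

Lemma ratio_cancel (c a dl t s : R) : a != 0 -> dl != 0 -> t != 0 -> s != 0 ->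
  c * t / (a / dl * (t / s)) / s = c / (a / dl).
Proof. by move=> a0 d0 t0 s0; field; rewrite a0 d0 t0 s0. Qed.

Lemma ratio_lt1 (alpha : R) : 0 < alpha -> 0 < 2 `^ (- (alpha / 2)) < 1.
Proof.
move=> a0; rewrite powR_gt0//= -[ltRHS](powRr0 2) /powR pnatr_eq0/=.
by rewrite ltr_expR ltr_pM2r ?ln_gt0 ?ltr1n// oppr_lt0 divr_gt0.
Qed.

(** The ratio 2^(-alpha) is split as a square, so that one factor can pay for summation over shifts
    while the other remains as a rate. *)
Lemma mesh_powR (T alpha : R) i : 0 < T ->
  mesh T i `^ alpha =
  T `^ alpha * (2 `^ (- (alpha / 2)) * 2 `^ (- (alpha / 2))) ^+ i.
Proof.
move=> T0; rewrite /mesh powRM ?(ltW T0)//; congr (_ * _).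
rewrite -powRD; last by apply/implyP; rewrite pnatr_eq0.
rewrite -powR_mulrn ?powR_ge0// -powRrM.
rewrite -opprD -splitr -powR_inv1; last by rewrite exprn_ge0.
rewrite -powR_mulrn// -!powRrM; congr (_ `^ _); ring.
Qed.

Lemma mesh_small (T : R) : 0 < T -> exists i0, forall i, mesh T (i + i0) < Num.min T 1.
Proof.
move=> T0; exists (Num.bound T).+1 => i; rewrite addnS lt_min mesh_lt//=.
rewrite /mesh ltr_pdivrMr ?exprn_gt0// mul1r.
apply: lt_trans (archi_boundP (ltW T0)) _.
rewrite -natrX ltr_nat; apply: leq_trans (ltn_expl _ (ltnSn 1)) _.
by rewrite leq_exp2l// leqW// leq_addl.
Qed.

End smallness.

Theorem lemma4p7 (R : realType) (T p1 p2 : R) (hT : 0 < T)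
    (hp1 : 1 < p1) (hp2 : 1 < p2)
    (d : measure_display) (Omega : measurableType d) (P : probability Omega R)
    (hP : standard_probability P)
    (Q : nat -> {RV P >-> borel (bochner T p1 hp2)})
    (hi : exists C : R, forall n : nat,
        (\int[P]_w mixed_norm T p1 p2 (Q n w : bochner T p1 hp2) <= C%:E)%E)
    (hii : exists p1bar : R, p1 < p1bar /\
      exists C : R, forall n : nat,
        (\int[P]_w mixed_norm T p1bar 1 (Q n w : bochner T p1 hp2) <= C%:E)%E)
    (hiii : exists alpha : R, 0 < alpha < 1 /\
      forall phi : R -> R, smooth_circle phi ->
      exists C : R, forall (n : nat) (theta : R), 0 < theta < Num.min T 1 ->
        (\int[P]_w translation_modulus T theta phi (Q n w : bochner T p1 hp2)
           <= (C * theta `^ alpha)%:E)%E) :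
  tight (fun n => distribution P (Q n)).
Proof.
move=> kappa k0.
have [C1 hC1] := hi; have [pb [hpb [C2 hC2]]] := hii.
have [alpha [/andP[a0 _] hC3]] := hiii.
have pb1 : 1 <= pb by apply: ltW; exact: lt_trans hpb.
have [i0 hi0] := mesh_small hT.
have smooth n : smooth_circle (@test_function R n).
  by rewrite /test_function; case: (triple n) => [[m j] l]; exact: bump_smooth.
pose C3 n := projT1 (cid (hC3 _ (smooth n))).
have hC3n n : forall k theta, 0 < theta < Num.min T 1 ->
    (\int[P]_w translation_modulus T theta (test_function n) (Q k w : bochner T p1 hp2)
      <= (C3 n * theta `^ alpha)%:E)%E.
  by rewrite /C3; case: cid.
have rho01 := ratio_lt1 a0; set rho := 2 `^ _ in rho01.
have [r0 r1] := andP rho01; have r1' : 0 < 1 - rho by rewrite subr_gt0.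
pose dl n := kappa / 2 * (2^-1) ^+ n.
(* The allotments kappa / 2^(n+1) to the families of bad events sum to kappa. *)
have dl0 n : 0 < dl n by rewrite mulr_gt0 ?exprn_gt0// divr_gt0.
pose M := (`|C1| + 1) / dl 0%N; pose Mb := (`|C2| + 1) / dl 1%N.
have M0 : 0 < M by rewrite divr_gt0// ltr_wpDl.
have Mb0 : 0 < Mb by rewrite divr_gt0// ltr_wpDl.
have Ta : 0 < T `^ alpha by exact: powR_gt0.
(* The first quotient is the Markov threshold for probability [dl n.+2]; T^alpha cancels the
   constant in [mesh_powR], and 1 / (1 - rho) absorbs the sum over shifts. *)
pose b n := (`|C3 n| + 1) / dl n.+2 * (T `^ alpha / (1 - rho)).
have b0 n : 0 < b n by rewrite mulr_gt0// divr_gt0// ltr_wpDl.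
pose badn := @bad R T p1 p2 pb hp2 M Mb rho i0 b.
exists (@good R T p1 p2 pb hp2 M Mb rho i0 b); split.
  exact: (compact_good hT hp1 hpb (ltW M0) rho01 (fun n => ltW (b0 n))).
move=> k; rewrite /good setCK.
have obad n : open (badn n) by exact: open_bad.
set nu := distribution P (Q k).
apply: le_trans (measure_sigma_subadditive nu (F := badn) _ _ _) _ => //.
- by move=> n; exact: open_borel.
- by apply: open_borel; apply: bigcup_open => n _; exact: obad.
have -> : kappa = kappa / 2 / (1 - 2^-1) by field.
apply: geometric_nneseries_le => //.
- by rewrite ltW// divr_gt0.
- by rewrite invr_gt0 ltr0n invf_lt1// ltr1n.
case=> [|[|n]].
- apply: (@le_trans _ _ (C1 / M)%:E); last by rewrite lee_fin; exact: div_succ_le.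
  (* Failure at any level [m] forces the full norm above [M], so the union over [m] costs no extra
     probability. *)
  apply: (markov_open (obad 0%N) M0 _ _ (hC1 k)) => [w|w [m _ hm]]; first exact: Lnorm_ge0.
  apply: le_trans (dnorm_le_mixed hp1 m _); rewrite leNgt; apply/negP => h; apply: hm.
  exact: ltW.
- apply: (@le_trans _ _ (C2 / Mb)%:E); last by rewrite lee_fin; exact: div_succ_le.
  apply: (markov_open (obad 1%N) Mb0 _ _ (hC2 k)) => [w|w [l _ hl]]; first exact: Lnorm_ge0.
  rewrite leNgt; apply/negP => h; apply: hl; rewrite /coef_ok /=.
  case: (triple l) => [[m j] s].
  by apply: coef_le_mixed => //; exact: ltW.
have mshift i : open (~` @shift_ok R T p1 p2 hp2 rho i0 b n i) by exact: open_shift_bad.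
apply: le_trans (measure_sigma_subadditive nu (F := fun i => ~` @shift_ok R T p1 p2 hp2 rho i0 b n i) _ _ _) _ => //.
- by move=> i; exact: open_borel.
- exact: open_borel (obad n.+2).
have cb : 0 <= `|C3 n| * T `^ alpha / b n by rewrite !mulr_ge0 ?invr_ge0// ltW.
apply: (@le_trans _ _ (`|C3 n| * T `^ alpha / b n / (1 - rho))%:E); last first.
  have -> : `|C3 n| * T `^ alpha / b n / (1 - rho) = `|C3 n| / ((`| `|C3 n| | + 1) / dl n.+2).
    rewrite /b normr_id; apply: ratio_cancel; [|exact: lt0r_neq0 (dl0 _)|exact: lt0r_neq0|exact: lt0r_neq0].
    by rewrite gt_eqF// ltr_wpDl.
  by rewrite lee_fin; exact: div_succ_le.
apply: geometric_nneseries_le => // i.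
have th : 0 < mesh T (i + i0) < Num.min T 1 by rewrite mesh_gt0//= hi0.
(* The modulus takes its supremum over shifts strictly below [theta]; hence [theta] is the mesh one
   level coarser, twice the shift. *)
have sh : 0 < mesh T (i + i0).+1 < mesh T (i + i0).
  by rewrite mesh_gt0//= (meshS T (i + i0)) ltr_pMr ?mesh_gt0// ltr1n.
have rk : 0 < rho ^+ (i + i0) by rewrite exprn_gt0.
have dom w : (shift_norm T (mesh T (i + i0).+1) (fun t => pair circle (test_function n) (field_of (Q k w) t)) <=
    translation_modulus T (mesh T (i + i0)) (test_function n) (Q k w : bochner T p1 hp2))%E.
  by apply: shift_norm_le_modulus => //; [exact: in_Lp_test|exact: mesh_lt].
(* The mean is of order rho^(2(i + i0)) and the threshold of order rho^(i + i0); the quotient is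
   summable in [i]. *)
apply: (@le_trans _ _ (C3 n * mesh T (i + i0) `^ alpha / (b n * rho ^+ (i + i0)))%:E).
  apply: (markov_open (mshift i) (mulr_gt0 (b0 n) rk) _ _ (hC3n n k _ th)) => w.
    by apply: le_trans (dom w); exact: integral_ge0.
  move=> hw; apply: le_trans (dom w); rewrite leNgt; apply/negP => h; apply: hw.
  exact: ltW.
rewrite lee_fin mesh_powR// -/rho exprMn.
have -> : C3 n * (T `^ alpha * (rho ^+ (i + i0) * rho ^+ (i + i0))) / (b n * rho ^+ (i + i0)) =
    C3 n * (T `^ alpha / b n * rho ^+ (i + i0)).
  by field; rewrite !gt_eqF.
have -> : `|C3 n| * T `^ alpha / b n * rho ^+ i = `|C3 n| * (T `^ alpha / b n * rho ^+ i).
  by rewrite !mulrA.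
apply: (@le_trans _ _ (`|C3 n| * (T `^ alpha / b n * rho ^+ (i + i0)))).
  by rewrite ler_wpM2r ?ler_norm// mulr_ge0 ?divr_ge0 ?(ltW Ta) ?(ltW (b0 n)) ?(ltW rk).
rewrite ler_wpM2l// ler_wpM2l ?divr_ge0 ?(ltW Ta) ?(ltW (b0 n))//.
by rewrite exprD ler_piMr ?exprn_ge0 ?(ltW r0)// exprn_ile1// ltW.
Qed.
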